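(* Let $W$ be a finite-dimensional nilpotent Lie algebra over $\mathbb{R}$ which possesses an abelian ideal of codimension one, and let $L$ be a one-dimensional central extension of $W$. Then the central representation of $L$ is nontrivial; that is, there exist an element $z$ of the centre $Z$ of $L$ and a cohomology class $[a]\in H^*(L)$ such that $z\cdot[a]=[i_z a]\neq 0$ in $H^*(L)$.
   Context: All Lie algebras are finite-dimensional over $\mathbb{R}$. $H^*(L)$ denotes the Lie algebra (Chevalley--Eilenberg) cohomology of $L$ with trivial coefficients in $\mathbb{R}$, computed by the complex $(\Lambda L^*, d)$. For $z$ in the centre $Z$ of $L$ and $[a]\in H^k(L)$, one sets $z\cdot[a]:=[i_z a]\in H^{k-1}(L)$, where $i_z$ denotes the interior product by $z$; this is well defined and extends to an action of the exterior algebra $\Lambda Z$ on $H^*(L)$, called the central representation. It is nontrivial if some $z\in Z$ acts as a nonzero map on $H^*(L)$. A one-dimensional central extension of a Lie algebra $W$ is a Lie algebra $L=W\oplus\mathbb{R}z$ (direct sum of vector spaces) in which $z$ is central and $[x,y]=[x,y]_W+\Omega(x,y)z$ for all $x,y\in W$, where $\Omega\in\Lambda^2W^*$ is a closed $2$-form on $W$. *)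

(* Defs.v *)
From HB Require Import structures.
From mathcomp Require Import all_boot all_order all_algebra.
From mathcomp Require Import zify.
From mathcomp Require Import boolp functions reals.

Set Implicit Arguments.
Unset Strict Implicit.
Unset Printing Implicit Defensive.

Import GRing.Theory.
Local Open Scope ring_scope.
Local Open Scope quotient_scope.

HB.mixin Record Vector_isLieAlgebra (R : fieldType) L of Vector R L := {
  lie : L -> L -> L;
  lie_linearl : forall y, linear (fun x => lie x y);
  lie_linearr : forall x, linear (lie x);
  liexx : forall x, lie x x = 0;
  lie_jacobi : forall x y z,
    lie x (lie y z) + lie y (lie z x) + lie z (lie x y) = 0
}.

#[short(type="lieAlgType")]
HB.structure Definition LieAlgebra (R : fieldType) :=
  {L of Vector_isLieAlgebra R L & Vector R L}.

Section LieAlgebraTheory.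
Variables (R : fieldType) (L : lieAlgType R).
Implicit Types (U V A : {vspace L}).

(* The span of all brackets [u, v] with u in U and v in V. *)
Definition lie_brv U V : {vspace L} :=
  <<[seq lie u v | u <- vbasis U, v <- vbasis V]>>%VS.

Fixpoint lower_central (n : nat) : {vspace L} :=
  if n is n'.+1 then lie_brv fullv (lower_central n') else fullv.

Definition lie_nilpotent : Prop := exists n, lower_central n = 0%VS.

Definition lie_ideal A : Prop := forall x a, a \in A -> lie x a \in A.

Definition lie_abelian A : Prop := {in A &, forall a b, lie a b = 0}.

Record centre := Centre {
  centre_val :> L;
  centreP : forall x, lie centre_val x = 0
}.

End LieAlgebraTheory.

Arguments lie_nilpotent {R} L.
Arguments centre {R} L.

Section Cochains.
Variables (R : fieldType) (L : lieAlgType R).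

Definition upd k (x : {ffun 'I_k -> L}) (i : 'I_k) (v : L) :
    {ffun 'I_k -> L} :=
  [ffun j => if j == i then v else x j].

Definition fcons k (v : L) (x : {ffun 'I_k -> L}) : {ffun 'I_k.+1 -> L} :=
  [ffun i => oapp x v (unlift ord0 i)].

Definition multilinear k (w : {ffun 'I_k -> L} -> R) : Prop :=
  forall x i, scalar (fun v => w (upd x i v)).

Definition alternating k (w : {ffun 'I_k -> L} -> R) : Prop :=
  forall (x : {ffun 'I_k -> L}) i j, i != j -> x i = x j -> w x = 0.

Definition is_altform k : {pred {ffun 'I_k -> L} -> R} :=
  fun w => `[< multilinear w /\ alternating w >].
Arguments is_altform : clear implicits.

Lemma is_altform_zmod_closed k : zmod_closed (is_altform k).
Proof.
split=> [|f g /asboolP[fl fa] /asboolP[gl ga]]; apply/asboolP; split.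
- by move=> x i a u v /=; rewrite mulr0 addr0.
- by [].
- move=> x i a u v; have := fl x i a u v; have := gl x i a u v.
  rewrite /= !fctE => -> ->.
  by rewrite mulrBr opprD !addrA; congr (_ + _); rewrite addrAC.
- by move=> x i j ij xij; rewrite !fctE (fa x i j) ?(ga x i j) ?subr0.
Qed.

HB.instance Definition _ k :=
  GRing.isZmodClosed.Build _ (is_altform k) (is_altform_zmod_closed k).

(* Elements of $\Lambda^k L^*$, as alternating k-linear maps L^k -> R. *)
Record altform k := AltForm {
  altform_val :> {ffun 'I_k -> L} -> R;
  _ : altform_val \in is_altform k
}.

HB.instance Definition _ k := [isSub for @altform_val k].
HB.instance Definition _ k := [Choice of altform k by <:].
HB.instance Definition _ k := [SubChoice_isSubZmodule of altform k by <:].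

Lemma altform_valB k (a b : altform k) :
  altform_val (a - b) = altform_val a - altform_val b.
Proof. exact: (raddfB (val : altform k -> _)). Qed.

(* (d w)(x_0, ..., x_k) is the sum over i < j of
   (-1)^(i+j) w([x_i, x_j], x_0, ..., ^x_i, ..., ^x_j, ..., x_k):
   for i < j, m |-> bump j (bump i m) enumerates nat minus {i, j} in
   increasing order. *)
Definition ce_args k (x : {ffun 'I_k.+1 -> L}) (i j : 'I_k.+1) :
    {ffun 'I_k -> L} :=
  [ffun m : 'I_k => if m == 0 :> nat then lie (x i) (x j)
                    else x (inord (bump j (bump i m.-1)))].

Definition ce_diff k (w : {ffun 'I_k -> L} -> R) : {ffun 'I_k.+1 -> L} -> R :=
  fun x => \sum_(i < k.+1) \sum_(j < k.+1 | (i < j)%N)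
             (-1) ^+ (i + j) * w (ce_args x i j).

Lemma ce_diff_zmod k : zmod_morphism (@ce_diff k).
Proof.
move=> f g; apply/funext => x; rewrite /ce_diff !fctE -sumrB.
apply: eq_bigr => i _; rewrite -sumrB; apply: eq_bigr => j _.
by rewrite -mulrBr.
Qed.

HB.instance Definition _ k :=
  GRing.isZmodMorphism.Build _ _ (@ce_diff k) (@ce_diff_zmod k).

Definition is_closed k : {pred altform k} := fun a => ce_diff a == 0.
Arguments is_closed : clear implicits.

Lemma is_closed_zmod_closed k : zmod_closed (is_closed k).
Proof.
split=> [|a b]; rewrite !unfold_in /is_closed; first by rewrite raddf0.
by move=> /eqP da /eqP db; rewrite altform_valB raddfB /= da db subr0.
Qed.

HB.instance Definition _ k :=
  GRing.isZmodClosed.Build _ (is_closed k) (is_closed_zmod_closed k).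

Record cocycle k := Cocycle {
  cocycle_val :> altform k;
  _ : cocycle_val \in is_closed k
}.

HB.instance Definition _ k := [isSub for @cocycle_val k].
HB.instance Definition _ k := [Choice of cocycle k by <:].
HB.instance Definition _ k := [SubChoice_isSubZmodule of cocycle k by <:].

Definition exact k : ({ffun 'I_k -> L} -> R) -> Prop :=
  match k with
  | 0 => fun w => w = 0
  | k'.+1 => fun w => exists b : altform k', w = ce_diff b
  end.

Definition is_coboundary k : {pred cocycle k} := fun a => `[< exact a >].
Arguments is_coboundary : clear implicits.

Lemma is_coboundary_zmod_closed k : zmod_closed (is_coboundary k).
Proof.
case: k => [|k]; split=> [|a b].
- by apply/asboolP.
- by move=> /asboolP /= a0 /asboolP /= b0; apply/asboolP; rewrite /= a0 b0 subr0.
- by apply/asboolP; exists 0; rewrite /= raddf0.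
- move=> /asboolP[a' ea] /asboolP[b' eb]; apply/asboolP; exists (a' - b').
  by rewrite altform_valB raddfB /= -ea -eb.
Qed.

HB.instance Definition _ k :=
  GRing.isZmodClosed.Build _ (is_coboundary k) (is_coboundary_zmod_closed k).

Definition cohomology k := Quotient.quot (is_coboundary k).

Lemma pi_eq0 k (a : cocycle k) :
  (\pi_(cohomology k) a == 0) = (a \in is_coboundary k).
Proof.
rewrite -[in RHS](subr0 a) Quotient.idealrBE.
by rewrite -(raddf0 (\pi_(cohomology k))).
Qed.

Definition interior k (z : L) (w : {ffun 'I_k.+1 -> L} -> R) :
    {ffun 'I_k -> L} -> R :=
  fun x => w (fcons z x).

Lemma fcons0 k v (x : {ffun 'I_k -> L}) : fcons v x ord0 = v.
Proof. by rewrite ffunE unlift_none. Qed.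

Lemma fconsS k v (x : {ffun 'I_k -> L}) i : fcons v x (lift ord0 i) = x i.
Proof. by rewrite ffunE liftK. Qed.

Lemma fcons_upd k v (x : {ffun 'I_k -> L}) i u :
  fcons v (upd x i u) = upd (fcons v x) (lift ord0 i) u.
Proof.
apply/ffunP => j; rewrite [RHS]ffunE; case: (unliftP ord0 j) => [j' ->|->].
  by rewrite !fconsS ffunE (inj_eq lift_inj).
by rewrite !fcons0 (negPf (neq_lift _ _)).
Qed.

Lemma interior_altform k z (a : altform k.+1) : interior z a \in is_altform k.
Proof.
case: a => w /= /asboolP[wl wa]; apply/asboolP; split.
  by move=> x i c u v; rewrite /interior !fcons_upd; apply: wl.
move=> x i j ij xij; apply: (wa _ (lift ord0 i) (lift ord0 j)).
  by rewrite (inj_eq lift_inj).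
by rewrite !fconsS.
Qed.

Definition interior_form k z (a : altform k.+1) : altform k :=
  AltForm (interior_altform z a).

Lemma altform_upd0 k (w : altform k) (x : {ffun 'I_k -> L}) i : x i = 0 -> w x = 0.
Proof.
case: w => w /= /asboolP[wl _] xi0; have := wl x i (-1) 0 0.
rewrite scaler0 addr0 mulN1r addNr => <-; congr w.
by apply/ffunP => j; rewrite ffunE; case: eqP => // ->.
Qed.

Lemma altform_swap k (w : altform k.+2) u v (x : {ffun 'I_k -> L}) :
  w (fcons u (fcons v x)) = - w (fcons v (fcons u x)).
Proof.
case: w => w /= /asboolP[wl wa].
set i0 := @ord0 k.+1; set i1 := lift i0 (@ord0 k).
have E a b : fcons a (fcons b x) = upd (upd (fcons 0 (fcons 0 x)) i0 a) i1 b.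
  rewrite /i1 -[X in upd X i0 a]/(fcons 0 _).
  have -> : upd (fcons 0 (fcons 0 x)) i0 a = fcons a (fcons 0 x).
    apply/ffunP => j; rewrite ffunE; case: (unliftP ord0 j) => [j' ->|->].
      by rewrite !fconsS eq_sym (negPf (neq_lift _ _)).
    by rewrite eqxx fcons0.
  rewrite -fcons_upd; congr fcons; apply/ffunP => j; rewrite [RHS]ffunE.
  by case: (unliftP ord0 j) => [j' ->|->]; rewrite ?fconsS ?fcons0 ?eqxx.
have E' a b : fcons a (fcons b x) = upd (upd (fcons 0 (fcons 0 x)) i1 b) i0 a.
  rewrite E; apply/ffunP => j; rewrite !ffunE.
  by case: (eqVneq j i1) => [->|//]; rewrite eq_sym (negPf (neq_lift _ _)).
have Dr a b c : w (fcons a (fcons (b + c) x)) =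
    w (fcons a (fcons b x)) + w (fcons a (fcons c x)).
  have := wl (upd (fcons 0 (fcons 0 x)) i0 a) i1 1 b c.
  by rewrite scale1r mul1r -!E.
have Dl a b c : w (fcons (a + b) (fcons c x)) =
    w (fcons a (fcons c x)) + w (fcons b (fcons c x)).
  have := wl (upd (fcons 0 (fcons 0 x)) i1 c) i0 1 a b.
  by rewrite scale1r mul1r -!E'.
have Z a : w (fcons a (fcons a x)) = 0.
  apply: (wa _ i0 i1); first by rewrite neq_lift.
  by rewrite fcons0 fconsS fcons0.
have := Z (u + v); rewrite Dl !Dr !Z add0r addr0 => /eqP.
by rewrite addr_eq0 => /eqP.
Qed.

(* For central z, d anticommutes with the interior product by z. *)
Lemma ce_diff_interior k (z : centre L) (a : altform k.+1) x :
  ce_diff a (fcons z x) = - ce_diff (interior z a) x.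
Proof.
rewrite /ce_diff big_ord_recl /= big1 ?add0r => [|j _]; last first.
  rewrite (@altform_upd0 _ _ _ ord0) ?mulr0 //.
  by rewrite ffunE /= fcons0 centreP.
rewrite -sumrN; apply: eq_bigr => i _.
rewrite big_mkcond big_ord_recl /= add0r -sumrN [RHS]big_mkcond /=.
apply: eq_bigr => j _; rewrite /bump /= !add1n ltnS; case: ifP => // ij.
rewrite addSn addnS !exprS !mulN1r opprK -mulrN; congr (_ * _).
case: k a x i j ij => [|k] a x i j ij.
  by move: ij; rewrite !ord1.
pose y : {ffun 'I_k -> L} := [ffun m : 'I_k => x (inord (bump j (bump i m)))].
have -> : ce_args (fcons z x) (lift ord0 i) (lift ord0 j) =
    fcons (lie (x i) (x j)) (fcons z y).
  apply/ffunP => m; rewrite ffunE; case: (unliftP ord0 m) => [m' ->|->].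
    rewrite [RHS]fconsS /=; case: (unliftP ord0 m') => [m'' ->|->].
      rewrite [RHS]fconsS [RHS]ffunE.
      have m_lt := ltn_ord m''.
      have lt1 : (bump j (bump i m'') < k.+2)%N by rewrite /bump; lia.
      have lt2 : (bump (bump 0 j) (bump (bump 0 i) (bump 0 m'')) < k.+3)%N.
        by rewrite /bump; lia.
      have -> : inord (bump (bump 0 j) (bump (bump 0 i) (bump 0 m''))) =
          lift ord0 (inord (bump j (bump i m''))) :> 'I_k.+3.
        by apply/val_inj; rewrite /= !inordK // /bump; lia.
      by rewrite fconsS.
    rewrite [RHS]fcons0; have -> : inord (bump (bump 0 j) (bump (bump 0 i) 0)) =
        ord0 :> 'I_k.+3.
      by apply/val_inj; rewrite /= inordK // /bump; lia.
    by rewrite fcons0.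
  by rewrite [RHS]fcons0 /= !fconsS.
rewrite altform_swap /interior; congr (- a (fcons _ _)).
apply/ffunP => m; rewrite [RHS]ffunE.
case: (unliftP ord0 m) => [m' ->|->]; last by rewrite fcons0.
by rewrite fconsS ffunE.
Qed.

Lemma interior_closed k (z : centre L) (a : cocycle k.+1) :
  interior_form z a \in is_closed k.
Proof.
case: a => a /= /eqP da; apply/eqP/funext => x.
by apply: oppr_inj; rewrite -ce_diff_interior da oppr0.
Qed.

Definition interior_cocycle k (z : centre L) (a : cocycle k.+1) : cocycle k :=
  Cocycle (interior_closed z a).

(* The action z.[a] = [i_z a] of the central representation on cohomology. *)
Definition central_act k (z : centre L) (c : cohomology k.+1) : cohomology k :=
  \pi_(cohomology k) (interior_cocycle z (repr c)).

Lemma interior_coboundary k (z : centre L) (a : cocycle k.+1) :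
  a \in is_coboundary k.+1 -> interior_cocycle z a \in is_coboundary k.
Proof.
move=> /asboolP[b ab]; apply/asboolP.
case: k a b ab => [|k] a b ab.
  apply/funext => x; rewrite /= /interior ab /ce_diff big1 // => i _.
  by rewrite big1 // => j; rewrite !ord1.
exists (- interior_form z b); apply/funext => x.
by rewrite /= /interior ab ce_diff_interior raddfN.
Qed.

Lemma central_act_pi k (z : centre L) (a : cocycle k.+1) :
  central_act z (\pi_(cohomology k.+1) a) =
  \pi_(cohomology k) (interior_cocycle z a).
Proof.
apply/eqP; rewrite -Quotient.idealrBE.
have -> : interior_cocycle z (repr (\pi_(cohomology k.+1) a)) -
    interior_cocycle z a =
    interior_cocycle z (repr (\pi_(cohomology k.+1) a) - a).
  by do 2!apply/val_inj.
by apply: interior_coboundary; rewrite Quotient.idealrBE reprK.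
Qed.

End Cochains.

Arguments is_altform {R} L k.
Arguments is_closed {R} L k.
Arguments is_coboundary {R} L k.
Arguments cocycle {R} L k.
Arguments altform {R} L k.
Arguments cohomology {R} L k.

(* L = W (+) R z as a vector space (the copy of W in L being the image of the
   linear map iota), z is central, and [x, y] = [x, y]_W + Omega(x, y) z. *)
Definition central_extension (R : fieldType) (W L : lieAlgType R) : Prop :=
  exists (iota : {linear W -> L}) (z : centre L) (Omega : cocycle W 2),
    bijective (fun p : W * R => iota p.1 + p.2 *: (z : L)) /\
    forall x y, lie (iota x) (iota y) =
      iota (lie x y) + Omega [ffun i => tnth [tuple x; y] i] *: (z : L).

(* Main.v *)
Require Import Defs.
From mathcomp Require Import all_boot all_order all_algebra reals.
From HB Require Import structures.
From mathcomp Require Import all_fingroup ring zify.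
From mathcomp Require Import boolp functions.

(** Write W = A + R x with A the abelian ideal, D = ad x on A, J the restriction
    of Omega to A and beta = Omega(x, .), so that closedness of Omega reads
    D J + J D^T = 0; vectors are rows and D acts on the right.

    If some k <> 0 in A satisfies k J = 0, k D = 0 and k beta = 0, then k is
    central in L and contracting a closed form kappa /\ xi, where xi is dual to
    x and kappa(k) = 1, gives xi, which is not exact.

    Otherwise the centre element is z, and the cocycle has the form
    zeta /\ xi /\ e_1 /\ ... /\ e_k + (correction free of zeta), zeta being dual
    to z. It exists as soon as J = sum e_i /\ h_i + sum D^r mu_i /\ nu_i and
    the correction terms, primitives of (D^r mu_i) /\ nu_i /\ e_1 /\ ... /\ e_k
    along exp(tD), exist. Contraction with z leaves xi /\ e_1 /\ ... /\ e_k,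
    and two choices of (e_i) keep it from being exact. Let r = dim (ker J) and
    consider, for isotropic U containing ker J, the minors
    det (U exp(tD) Phi), polynomials in t.
    - If one of them has degree at least r, then a Lagrangian V and columns e
      with det (V exp(tD) e) of maximal degree work with no correction: on an
      exact form this polynomial would be a sum of a derivative of such minors
      and of a polynomial of degree less than r.
    - If all of them have degree less than r, the e_i are dual to a D-stable
      isotropic S killed by beta on which D is strictly triangular, and the
      degree bound makes the obstruction to the correction vanish. *)

Set Implicit Arguments.
Unset Strict Implicit.
Unset Printing Implicit Defensive.

Import Order.TTheory GRing.Theory Num.Theory.
Local Open Scope ring_scope.

(** The dimension r of ker J is the threshold in both cases for one reason: ker J is stable under
    the nilpotent D, so D^r kills it. In the first case an exact form contributes k exp(tD) beta
    with k in ker J, of degree less than r. In the second, functionals in the image of D^r vanish on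
    ker J, hence have the form J y.

    The identity exp(tD) J exp(tD)^T = J links the two: the flow preserves isotropy, and it turns
    minors of exp(-tD) against columns J y into minors of exp(tD) on the frame y.

    The obstacle is that J = sum e_i /\ h_i needs e dual to a Lagrangian subspace, and xi /\ e_1 /\
    ... /\ e_k may then be exact. In the first case e is dual to the limit of V exp(tD) at infinity,
    and so reaches the largest possible degree. In the second, the absence of a central k makes
    beta, D beta, ..., D^(r-1) beta a coordinate system on ker J. A maximal S then fails to be
    Lagrangian only by a subspace on which J is nondegenerate; the terms (D^r mu_i) /\ nu_i account
    for exactly that subspace. *)

Notation polyMx A := (map_mx polyC A).
Notation derivMx A := (map_mx (@deriv _) A).

(** * Polynomial matrices and exponentials *)

Section DerivMatrix.
Variable R : comNzRingType.
Implicit Types m n p : nat.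

Lemma derivMxM m n p (A : 'M[{poly R}]_(m, n)) (B : 'M[{poly R}]_(n, p)) :
  derivMx (A *m B) = derivMx A *m B + A *m derivMx B.
Proof.
apply/matrixP => i j; rewrite !mxE raddf_sum /= -big_split /=.
by apply: eq_bigr => k _; rewrite derivM !mxE.
Qed.

Lemma derivMxC m n (A : 'M[R]_(m, n)) : derivMx (polyMx A) = 0.
Proof. by apply/matrixP => i j; rewrite !mxE derivC. Qed.

Lemma horner_polyMx t m n (A : 'M[R]_(m, n)) : map_mx (horner_eval t) (polyMx A) = A.
Proof. by apply/matrixP => i j; rewrite !mxE /horner_eval hornerC. Qed.

Lemma deriv_prod (I : eqType) (s : seq I) (F : I -> {poly R}) : uniq s ->
  (\prod_(i <- s) F i)^`() =
  \sum_(j <- s) \prod_(i <- s) (if i == j then (F i)^`() else F i).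
Proof.
elim: s => [|a s IH] /=; first by rewrite !big_nil derivC.
case/andP=> as_ us; rewrite !big_cons derivM IH // eqxx; congr (_ + _).
  congr (_ * _); apply: eq_big_seq => i is_.
  by case: eqP => // ia; rewrite -ia is_ in as_.
rewrite mulr_sumr; apply: eq_big_seq => j js.
by rewrite big_cons; case: eqP => // aj; rewrite aj js in as_.
Qed.

Definition setrow (S : Type) m n (A : 'M[S]_(m, n)) i (v : 'rV[S]_n) : 'M[S]_(m, n) :=
  \matrix_(k, j) if k == i then v 0 j else A k j.

Lemma deriv_det n (A : 'M[{poly R}]_n) :
  (\det A)^`() = \sum_i \det (setrow A i (row i (derivMx A))).
Proof.
rewrite /determinant raddf_sum /= exchange_big /=; apply: eq_bigr => s _.
rewrite derivM deriv_prod ?index_enum_uniq //.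
have -> : ((-1) ^+ odd_perm s : {poly R})^`() = 0.
  by case: (odd_perm s); rewrite ?expr1 ?expr0 ?derivN derivC ?oppr0.
rewrite mul0r add0r mulr_sumr; apply: eq_bigr => j _.
congr (_ * _); apply: eq_bigr => i _; rewrite /setrow mxE.
by case: eqP => // ->; rewrite !mxE.
Qed.

End DerivMatrix.

Section Char0.
Variable R : numFieldType.

Lemma deriv_eq0 (p : {poly R}) : p^`() = 0 -> p = (p.[0])%:P.
Proof.
move=> p'0; apply/polyP => i; rewrite horner_coef0 coefC.
case: i => //= i; have := congr1 (fun q : {poly R} => q`_i) p'0.
by rewrite coef_deriv coef0 => /eqP; rewrite mulrn_eq0 /= => /eqP.
Qed.

Lemma derivMx_eq0 m n (A : 'M[{poly R}]_(m, n)) : derivMx A = 0 ->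
  A = polyMx (map_mx (horner_eval 0) A).
Proof.
move=> A'0; apply/matrixP => i j; rewrite !mxE; apply: deriv_eq0.
by have := congr1 (fun B : 'M__ => B i j) A'0; rewrite !mxE.
Qed.

Lemma poly_ext_horner (p q : {poly R}) : (forall t, p.[t] = q.[t]) -> p = q.
Proof.
move=> pq; apply/eqP; rewrite -subr_eq0; apply/eqP.
apply: (@roots_geq_poly_eq0 _ _ [seq i%:R | i <- iota 0 (size (p - q))]).
- by apply/allP => x _; rewrite /root hornerD hornerN pq subrr.
- by rewrite map_inj_uniq ?iota_uniq // => i j /eqP; rewrite eqr_nat => /eqP.
- by rewrite size_map size_iota.
Qed.

End Char0.

Section ExpMx.
Variables (R : numFieldType) (n M : nat).
Implicit Types D J : 'M[R]_n.

(** When [D ^+ M = 0] the truncated series is exactly exp(tD), with ['X] in the role of t. *)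
Definition expX D : 'M[{poly R}]_n :=
  \sum_(a < M) (a`!%:R^-1 *: 'X^a) *: polyMx (D ^+ a).

Lemma derivMx_expX D : D ^+ M = 0 -> derivMx (expX D) = polyMx D *m expX D.
Proof.
move=> D0; rewrite /expX mulmx_sumr.
have -> : derivMx (\sum_(a < M) (a`!%:R^-1 *: 'X^a) *: polyMx (D ^+ a)) =
   \sum_(a < M) ((a`!%:R^-1 *: 'X^a)^`() *: polyMx (D ^+ a)) :> 'M[{poly R}]_n.
  apply/matrixP => i j; rewrite mxE !summxE raddf_sum; apply: eq_bigr => a _.
  by rewrite /= !mxE derivM derivC mulr0 addr0.
case: M D0 => [|m] D0; first by rewrite !big_ord0.
rewrite big_ord_recl [in RHS]big_ord_recr /= derivZ expr0 derivC.
rewrite scaler0 scale0r add0r -scalemxAr -map_mxM -[D *m _]exprS D0 map_mx0.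
rewrite scaler0 addr0; apply: eq_bigr => a _.
rewrite -scalemxAr -map_mxM -[D *m _]exprS /bump /= add1n; congr (_ *: _).
rewrite derivZ derivXn /= -scaler_nat scalerA factS natrM invfM.
by rewrite mulrAC mulVf ?mul1r // pnatr_eq0.
Qed.

Lemma expX_comm D : polyMx D *m expX D = expX D *m polyMx D.
Proof.
rewrite /expX mulmx_sumr mulmx_suml; apply: eq_bigr => a _.
by rewrite -scalemxAr -scalemxAl -!map_mxM -[D *m _]exprS exprSr.
Qed.

Lemma expX_at0 D : (0 < M)%N -> map_mx (horner_eval 0) (expX D) = 1%:M.
Proof.
rewrite /expX; case: M => // m _; rewrite raddf_sum big_ord_recl big1 /=.
  rewrite addr0 expr0 fact0 invr1 scale1r scale1r expr0 -map_mx_comp.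
  by apply/matrixP => i j; rewrite !mxE /= /horner_eval hornerC.
move=> i _; apply/matrixP => a b.
by rewrite !mxE /horner_eval !hornerE expr0n /= mulr0 mul0r.
Qed.

(** [J] intertwines [- D] with [D^T], hence every power of one with the same power of the other. *)
Lemma expXN_mulJ D J : D *m J = - (J *m D^T) ->
  expX (- D) *m polyMx J = polyMx J *m (expX D)^T.
Proof.
move=> DJ; rewrite /expX raddf_sum mulmx_sumr mulmx_suml.
apply: eq_bigr => a _; rewrite /= linearZ /= -scalemxAl -scalemxAr; congr (_ *: _).
rewrite map_trmx -!map_mxM; congr (polyMx _).
elim: (nat_of_ord a) => [|b IH]; first by rewrite !expr0 mul1mx trmx1 mulmx1.
have expS (B : 'M[R]_n) : B ^+ b.+1 = B ^+ b *m B by rewrite exprSr.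
by rewrite !expS -mulmxA mulNmx DJ opprK mulmxA IH -mulmxA -trmx_mul -expS exprS.
Qed.

(** The derivative in t is exp(tD) (D J + J D^T) exp(tD)^T = 0, so the product keeps its value at t
    = 0. *)
Lemma expX_mulJ D J : D ^+ M = 0 -> (0 < M)%N -> D *m J = - (J *m D^T) ->
  expX D *m polyMx J *m (expX D)^T = polyMx J.
Proof.
move=> D0 M0 DJ; set G := expX D.
have dG : derivMx G = G *m polyMx D by rewrite derivMx_expX // expX_comm.
have dGT : derivMx G^T = (polyMx D)^T *m G^T by rewrite -trmx_mul -dG map_trmx.
have /derivMx_eq0 -> : derivMx (G *m polyMx J *m G^T) = 0.
  rewrite derivMxM derivMxM derivMxC mulmx0 addr0 dG dGT.
  rewrite -(mulmxA G) -map_mxM DJ mulmxA map_mxN mulmxN map_mxM map_trmx.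
  by rewrite !mulNmx -!mulmxA /= addNr.
congr (polyMx _); rewrite !map_mxM -map_trmx expX_at0 // -map_mx_comp.
rewrite trmx1 mul1mx mulmx1; apply/matrixP => i j.
by rewrite !mxE /= /horner_eval hornerC.
Qed.

Lemma size_expX_row p (K : 'M[R]_(p, n)) (b : 'M[R]_(n, p)) D r : K *m D ^+ r = 0 ->
  forall i j, (size ((polyMx K *m expX D *m polyMx b) i j) <= r)%N.
Proof.
move=> KD i j; rewrite /expX mulmx_sumr mulmx_suml summxE.
apply: (leq_trans (size_sum _ _ _)); apply/bigmax_leqP => a _.
rewrite -scalemxAr -scalemxAl -!map_mxM.
have [ra|ar] := leqP r a.
  have -> : K *m D ^+ a = 0.
    by rewrite -(subnKC ra) exprD -[_ * _]/(_ *m _) mulmxA KD mul0mx.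
  by rewrite mul0mx map_mx0 scaler0 mxE size_poly0.
rewrite mxE [(polyMx _ : 'M__) i j]mxE -scalerAl mulrC mul_polyC.
by rewrite !(leq_trans (size_scale_leq _ _)) // size_polyXn.
Qed.

End ExpMx.

(** * Top coefficients of polynomial matrices, Cramer's rule and bordered determinants *)

Section Coef.
Variable R : idomainType.

Definition coefMx N m n (A : 'M[{poly R}]_(m, n)) : 'M[R]_(m, n) :=
  map_mx (fun p : {poly R} => p`_N) A.

Definition sizeMx_le N m n (A : 'M[{poly R}]_(m, n)) :=
  forall i j, (size (A i j) <= N.+1)%N.

Lemma coefM_top N N' (a b : {poly R}) : (size a <= N.+1)%N -> (size b <= N'.+1)%N ->
  (a * b)`_(N + N') = a`_N * b`_N'.
Proof.
move=> sa sb; rewrite coefM.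
have lt : (N < (N + N').+1)%N by lia.
rewrite (bigD1 (Ordinal lt)) //= addKn big1 ?addr0 // => i iN.
have {}iN : nat_of_ord i <> N by move=> e; case/eqP: iN; apply: val_inj.
have [Ni|] := ltnP N i; first by rewrite [a`_i]nth_default ?mul0r // (leq_trans sa).
by move=> iN'; rewrite [b`__]nth_default ?mulr0 // (leq_trans sb) //; lia.
Qed.

Lemma coefMxM_top N N' m n p (A : 'M_(m, n)) (B : 'M_(n, p)) :
  sizeMx_le N A -> sizeMx_le N' B -> coefMx (N + N') (A *m B) = coefMx N A *m coefMx N' B.
Proof.
move=> sA sB; apply/matrixP => i j; rewrite !mxE coef_sum; apply: eq_bigr => k _.
by rewrite coefM_top // !mxE.
Qed.

Lemma coefMxMC N m n p (A : 'M_(m, n)) (B : 'M_(n, p)) :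
  coefMx N (A *m polyMx B) = coefMx N A *m B.
Proof.
apply/matrixP => i j; rewrite !mxE coef_sum; apply: eq_bigr => k _.
by rewrite !mxE coefMC.
Qed.

Lemma sizeMx_leMC N m n p (A : 'M_(m, n)) (B : 'M_(n, p)) :
  sizeMx_le N A -> sizeMx_le N (A *m polyMx B).
Proof.
move=> sA i j; rewrite mxE; apply: (leq_trans (size_sum _ _ _)).
apply/bigmax_leqP => k _; rewrite mxE mulrC mul_polyC.
exact: leq_trans (size_scale_leq _ _) _.
Qed.

Lemma prod_top (I : finType) N (F : I -> {poly R}) : (forall i, (size (F i) <= N.+1)%N) ->
  (size (\prod_i F i)%R <= (N * #|I|).+1)%N /\
  (\prod_i F i)`_(N * #|I|) = \prod_i (F i)`_N.
Proof.
move=> sF; rewrite cardE -big_enum -[\prod_(_ : I) _]big_enum /=; elim: (enum I) => [|x s [IH1 IH2]].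
  by rewrite !big_nil muln0 size_polyC oner_eq0 coefC.
rewrite !big_cons /= mulnS; split; last by rewrite coefM_top // IH2.
apply: (leq_trans (size_polyMleq _ _)); rewrite -subn1 leq_subLR add1n.
by apply: leq_trans (leq_add (sF x) IH1) _; rewrite addnS addSn.
Qed.

Lemma det_top N n (A : 'M_n) : sizeMx_le N A ->
  (size (\det A) <= (N * n).+1)%N /\ (\det A)`_(N * n) = \det (coefMx N A).
Proof.
move=> sA; split.
  apply: (leq_trans (size_sum _ _ _)); apply/bigmax_leqP => s _.
  have [+ _] := prod_top (fun i => sA i (s i)); rewrite card_ord.
  by case: (s : bool); rewrite ?expr1 ?expr0 ?mulN1r ?mul1r ?size_polyN.
rewrite coef_sum; apply: eq_bigr => s _.
have [_] := prod_top (fun i => sA i (s i)); rewrite card_ord => E.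
rewrite -[RHS](_ : (-1) ^+ (s : bool) * (\prod_i A i (s i))`_(N * n) = _).
  by case: (s : bool); rewrite ?expr1 ?expr0 ?mulN1r ?mul1r ?coefN ?mulN1r ?mul1r.
by rewrite E; congr (_ * _); apply: eq_bigr => i _; rewrite mxE.
Qed.

End Coef.

Definition setcol (S : Type) m n (A : 'M[S]_(m, n)) j (v : 'cV[S]_m) : 'M[S]_(m, n) :=
  \matrix_(i, k) if k == j then v i 0 else A i k.

Lemma mul_setcol (S : pzSemiRingType) m n p (A : 'M[S]_(m, n)) (B : 'M_(n, p)) j v :
  A *m setcol B j v = setcol (A *m B) j (A *m v).
Proof.
apply/matrixP => a b; rewrite /setcol !mxE; case: eqP => [->|/eqP/negbTE bj].
  by apply: eq_bigr => k _; rewrite mxE eqxx.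
by apply: eq_bigr => k _; rewrite mxE bj.
Qed.

Lemma map_setcol (S T : Type) (f : S -> T) m n (B : 'M[S]_(m, n)) j v :
  map_mx f (setcol B j v) = setcol (map_mx f B) j (map_mx f v).
Proof. by apply/matrixP => a b; rewrite /setcol !mxE; case: eqP. Qed.

(** Cramer's rule without division. It turns entries of [\adj X *m y] into minors, whose degrees are
    under control. *)
Lemma adj_mul_col (S : comNzRingType) n (X : 'M[S]_n) (y : 'cV[S]_n) i :
  (\adj X *m y) i 0 = \det (setcol X i y).
Proof.
rewrite (expand_det_col _ i) mxE; apply: eq_bigr => j _.
rewrite !mxE eqxx mulrC; congr (_ * _); rewrite /cofactor; congr (_ * \det _).
apply/matrixP => a b; rewrite !mxE.
by rewrite eq_sym (negbTE (neq_lift _ _)).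
Qed.

(** The Schur complement with denominators cleared. Multiplication by a block matrix built on
    [\adj X] makes the bordered matrix triangular; the determinant of that factor is a power of
    [\det X] and cancels in a domain. *)
Lemma det_border (S : idomainType) p (X : 'M[S]_p) (y : 'cV_p) (z : 'rV_p) (w : 'M[S]_1) :
  \det X != 0 ->
  \det (block_mx X y z w) = (\det X *: w - z *m \adj X *m y) 0 0.
Proof.
move=> X0; have adj0 : \det (\adj X) * \det X = \det X ^+ p.
  by rewrite mulrC -det_mulmx mul_mx_adj det_scalar.
have a0 : \det (\adj X) * \det X != 0 by rewrite adj0 expf_neq0.
apply: (mulIf a0); rewrite [in RHS]adj0.
transitivity (\det (block_mx X y z w *m block_mx (\adj X) (- (\adj X *m y)) 0 (\det X)%:M)).
  by rewrite det_mulmx det_ublock det_scalar1.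
rewrite mulmx_block !mulmx0 !addr0 mul_mx_adj mulmxN mulmxA mul_mx_adj mul_scalar_mx.
rewrite mul_mx_scalar addNr det_lblock det_scalar mulrC det_mx11; congr (_ * _).
by rewrite mulmxN mulmxA mul_mx_scalar addrC.
Qed.

Lemma submx_ker (F : fieldType) m1 m2 n (A : 'M[F]_(m1, n)) (B : 'M[F]_(m2, n)) :
  (forall c : 'M_(n, n), A *m c = 0 -> B *m c = 0) -> (B <= A)%MS.
Proof. by move=> AB; rewrite submxE AB ?mulmx_coker. Qed.

(** * Isotropic subspaces of a skew form *)

Section NilStable.
Variables (F : fieldType) (n M : nat) (D : 'M[F]_n).

(** The subspaces [K *m D ^+ a] decrease. Once two consecutive ones agree they agree forever, hence
    are zero by nilpotency; until then the rank drops at each step. *)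
Lemma nilp_stable_rank m (K : 'M[F]_(m, n)) : D ^+ M = 0 -> (K *m D <= K)%MS ->
  K *m D ^+ (\rank K) = 0.
Proof.
move=> D0 KD; have expS a : D ^+ a.+1 = D ^+ a *m D by rewrite exprSr.
have expS' a : D ^+ a.+1 = D *m D ^+ a by rewrite exprS.
have dec a : (K *m D ^+ a.+1 <= K *m D ^+ a)%MS.
  by rewrite expS' mulmxA submxMr.
have step a : K *m D ^+ a = 0 \/ (a + \rank (K *m D ^+ a) <= \rank K)%N.
  elim: a => [|a [IH|IH]]; first by right; rewrite mulmx1.
    by left; rewrite expS mulmxA IH mul0mx.
  have [lt|ge] := ltnP (\rank (K *m D ^+ a.+1)) (\rank (K *m D ^+ a)).
    by right; apply: leq_trans IH; rewrite addSnnS leq_add2l.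
  left; have eqm : (K *m D ^+ a <= K *m D ^+ a.+1)%MS.
    by rewrite -(geq_leqif (mxrank_leqif_sup (dec a))).
  have iter b : (K *m D ^+ a <= K *m D ^+ (a + b))%MS.
    elim: b => [|b IHb]; first by rewrite addn0.
    by apply: submx_trans eqm _; rewrite addnS !expS !mulmxA submxMr.
  apply/eqP; rewrite expS mulmxA.
  have /eqP -> : K *m D ^+ a == 0; last by rewrite mul0mx.
  rewrite -submx0; apply: submx_trans (iter M) _.
  by rewrite addnC exprD D0 mul0r mulmx0 sub0mx.
have [//|h] := step (\rank K).
by apply/eqP; rewrite -mxrank_eq0; lia.
Qed.

End NilStable.

Section Skew.
Variables (R : numFieldType) (n : nat).
Implicit Type J : 'M[R]_n.

Lemma skew11 (c : 'M[R]_1) : c^T = - c -> c = 0.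
Proof.
move=> cT; apply/matrixP => i j; rewrite !ord1 [RHS]mxE.
have /matrixP/(_ 0 0) := cT; rewrite !mxE => /eqP.
by rewrite -subr_eq0 opprK -mulr2n mulrn_eq0 /= => /eqP.
Qed.

Lemma skew_conj J m (A : 'M_(m, n)) : J^T = - J -> (A *m J *m A^T)^T = - (A *m J *m A^T).
Proof. by move=> JT; rewrite !trmx_mul trmxK JT mulNmx mulmxN mulmxA. Qed.

Lemma skew_row J (b : 'rV_n) : J^T = - J -> b *m J *m b^T = 0.
Proof.
by move=> JT; apply/skew11/skew_conj.
Qed.

Lemma skew_swap J m p (A : 'M_(m, n)) (B : 'M_(p, n)) : J^T = - J ->
  A *m J *m B^T = 0 -> B *m J *m A^T = 0.
Proof.
move=> JT e; apply: trmx_inj; rewrite !trmx_mul trmxK JT mulNmx mulmxN mulmxA.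
by rewrite e oppr0 trmx0.
Qed.

(** [X] lies in its own orthogonal, of dimension n - rank (X J), and passing from [X] to [X *m J]
    loses at most the dimension of ker J. *)
Lemma isotropic_rank J m (X : 'M_(m, n)) : J^T = - J -> X *m J *m X^T = 0 ->
  (\rank X + \rank X <= n + \rank (kermx J))%N.
Proof.
move=> JT iso; have h1 := mxrank_mul_ker X J.
have h2 : (\rank (X :&: kermx J) <= \rank (kermx J))%N by rewrite mxrankS ?capmxSr.
have h3 : (X <= kermx (J *m X^T))%MS by apply/sub_kermxP; rewrite mulmxA.
have := mxrankS h3; rewrite mxrank_ker.
have -> : \rank (J *m X^T) = \rank (X *m J).
  by rewrite -mxrank_tr trmx_mul trmxK JT mulmxN mxrank_opp.
have := rank_leq_col (X *m J).
move: h1 h2; set i := \rank (X :&: kermx J); set k := \rank (kermx J); set x := \rank X; set y := \rank (X *m J); move: i k x y => i k x y; lia.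
Qed.

Lemma rank_perp J m (X : 'M_(m, n)) : J^T = - J -> \rank (J *m X^T) = \rank (X *m J).
Proof. by move=> JT; rewrite -mxrank_tr trmx_mul trmxK JT mulmxN mxrank_opp. Qed.

(* For [J] skew with [S] isotropic, [1 - e0 *m S] projects along [S]; splitting
   the remaining part of [J] in two halves makes the complement isotropic. *)
Lemma isotropic_split J k (S : 'M_(k, n)) (e0 : 'M_(n, k)) :
  J^T = - J -> S *m J *m S^T = 0 -> S *m e0 = 1%:M ->
  let R0 := (1%:M - e0 *m S) *m J *m (1%:M - e0 *m S)^T in
  (R0 <= S *m J)%MS ->
  exists e : 'M_(n, k), [/\ S *m e = 1%:M, J = e *m (S *m J) - (e *m (S *m J))^T
    & forall m (a : 'M_(m, n)), a *m e0 = 0 -> a *m R0 = 0 -> a *m e = 0].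
Proof.
move=> JT iso Se0 R0 R0S; pose Z := R0 *m pinvmx (S *m J).
have ZE : Z *m (S *m J) = R0 by rewrite mulmxKpV.
have SP : S *m (1%:M - e0 *m S) = 0 by rewrite mulmxBr mulmx1 mulmxA Se0 mul1mx subrr.
have SR0 : S *m R0 = 0 by rewrite /R0 !mulmxA SP !mul0mx.
have JE : J *m (e0 *m S)^T = - (e0 *m (S *m J))^T.
  by rewrite !trmx_mul JT mulNmx mulNmx opprK mulmxA.
have EJE : e0 *m S *m J *m (e0 *m S)^T = 0.
  by rewrite trmx_mul -!mulmxA (mulmxA J) (mulmxA S) (mulmxA S) iso mul0mx mulmx0.
have R0E : R0 = J - e0 *m (S *m J) + (e0 *m (S *m J))^T.
  rewrite /R0 linearB /= trmx1 mulmxBr mulmx1 mulmxBl mul1mx mulmxBl JE EJE.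
  by rewrite subr0 opprK mulmxA.
have R0T : R0^T = - R0.
  by apply: skew_conj.
exists (e0 + 2^-1 *: Z); split.
- rewrite mulmxDr Se0 -scalemxAr /Z mulmxA SR0 mul0mx scaler0 addr0.
  by [].
- have half : 2^-1 *: R0 + 2^-1 *: R0 = R0.
    by rewrite -scalerDl (_ : 2^-1 + 2^-1 = 1 :> R) ?scale1r; last by field.
  rewrite mulmxDl -scalemxAl ZE linearD /= linearZ /= R0T scalerN opprD opprK.
  by rewrite addrACA half R0E addrACA addNr addr0 addrC subrK.
- move=> m a ae0 aR0; rewrite mulmxDr ae0 add0r -scalemxAr /Z mulmxA aR0.
  by rewrite mul0mx scaler0.
Qed.

End Skew.

(** * Minors of the exponential *)

Section Minors.
Variables (R : numFieldType) (n M : nat) (D J : 'M[R]_n).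
Hypotheses (D0 : D ^+ M = 0) (M0 : (0 < M)%N).
Hypotheses (DJ : D *m J = - (J *m D^T)) (JT : J^T = - J).

Let G := expX M D.
Let r : nat := \rank (kermx J).

Definition exp_minor p (U : 'M[R]_(p, n)) (Phi : 'M[R]_(n, p)) : {poly R} :=
  \det (polyMx U *m G *m polyMx Phi).

Definition isotropic m (U : 'M[R]_(m, n)) := U *m J *m U^T = 0.

Lemma GJGT : G *m polyMx J *m G^T = polyMx J.
Proof. exact: expX_mulJ. Qed.

Lemma exp_minor_size p (U : 'M_(p, n)) (Phi : 'M_(n, p)) : (size (exp_minor U Phi) <= (M * p).+1)%N.
Proof.
have s : sizeMx_le M (polyMx U *m G *m polyMx Phi).
  move=> i j; apply: leqW; apply: size_expX_row.
  by rewrite D0 mulmx0.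
by case: (det_top s).
Qed.

Lemma exp_minor_free p (U : 'M_(p, n)) (Phi : 'M_(n, p)) : exp_minor U Phi != 0 -> row_free U.
Proof.
apply: contraNT; rewrite -kermx_eq0 => /rowV0Pn[v /sub_kermxP vU v0].
apply/det0P; exists (polyMx v); last by rewrite mulmxA mulmxA -map_mxM vU map_mx0 !mul0mx.
apply: contraNneq v0 => /matrixP v0; apply/eqP/matrixP => i j.
by have := v0 i j; rewrite !mxE => /eqP; rewrite polyC_eq0 => /eqP.
Qed.

(* [bh] is [det X] times the reduction of [b G] modulo the rows of [U G], whose
   entries are the bordered minors; symplectic reduction preserves the form. *)
Lemma ext_minor p (U : 'M_(p, n)) (Phi : 'M_(n, p)) (b1 b2 : 'rV_n) :
  isotropic U -> U *m J *m b1^T = 0 -> U *m J *m b2^T = 0 ->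
  b1 *m J *m b2^T != 0 -> exp_minor U Phi != 0 ->
  exists (b : 'rV_n) (psi : 'cV_n), U *m J *m b^T = 0 /\
    (size (exp_minor U Phi) <= size (exp_minor (col_mx U b) (row_mx Phi psi)))%N.
Proof.
move=> Uiso Ub1 Ub2 b12 X0; set X := polyMx U *m G *m polyMx Phi.
pose bh (b : 'rV_n) : 'rV[{poly R}]_n := \det X *: (polyMx b *m G)
  - polyMx b *m G *m polyMx Phi *m \adj X *m (polyMx U *m G).
have bhE (b : 'rV_n) j : bh b 0 j = exp_minor (col_mx U b) (row_mx Phi (delta_mx j 0)).
  rewrite /exp_minor map_col_mx map_row_mx mul_col_mx mul_col_row.
  rewrite det_border // -/X.
  transitivity ((bh b *m polyMx (delta_mx j 0 : 'cV_n)) 0 0).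
    by rewrite map_delta_mx -colE [RHS]mxE.
  by rewrite mulmxBl -scalemxAl !mulmxA.
have bhJ (b b' : 'rV_n) : U *m J *m b^T = 0 -> U *m J *m b'^T = 0 ->
    bh b *m polyMx J *m (bh b')^T = (\det X) ^+ 2 *: polyMx (b *m J *m b'^T).
  move=> Ub Ub'.
  have red (c : 'rV_n) : exists w : 'rV_p, bh c = (\det X *: polyMx c - w *m polyMx U) *m G.
    exists (polyMx c *m G *m polyMx Phi *m \adj X).
    by rewrite /bh mulmxBl -scalemxAl !mulmxA.
  have [w ->] := red b; have [w' ->] := red b'.
  rewrite trmx_mul mulmxA -(mulmxA _ G) -(mulmxA _ (G *m _)) GJGT.
  have pM (q q' : nat) (A : 'M_(q, n)) (B : 'M_(q', n)) :
     polyMx A *m polyMx J *m (polyMx B)^T = polyMx (A *m J *m B^T).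
    by rewrite !map_mxM map_trmx.
  have AU (c : 'rV_n) (v : 'rV_p) : U *m J *m c^T = 0 ->
      (\det X *: polyMx c - v *m polyMx U) *m polyMx J *m (polyMx U)^T = 0.
    move=> Uc; rewrite !mulmxBl -!scalemxAl pM (skew_swap JT Uc) map_mx0 scaler0.
    by rewrite -!mulmxA (mulmxA (polyMx U)) pM Uiso map_mx0 mulmx0 subrr.
  rewrite linearB /= mulmxBr trmx_mul !mulmxA AU // mul0mx subr0 linearZ /=.
  rewrite -scalemxAr !mulmxBl -!scalemxAl pM -!mulmxA (mulmxA (polyMx U)) pM Ub'.
  by rewrite map_mx0 mulmx0 subr0 scalerA expr2.
clearbody bh.
have [[j h]|no1] := pselect (exists j, size (\det X) <= size (bh b1 ord0 j))%N.
  by exists b1, (delta_mx j 0); rewrite -bhE.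
have [[j h]|no2] := pselect (exists j, size (\det X) <= size (bh b2 ord0 j))%N.
  by exists b2, (delta_mx j 0); rewrite -bhE.
(* If all entries of both reductions had degree below that of [\det X], their pairing would have
   degree below twice that degree; but it is [\det X ^+ 2] times a nonzero constant. *)
exfalso; have := congr1 (fun A : 'M[{poly R}]_1 => size (A 0 0)) (bhJ _ _ Ub1 Ub2).
have c0 : (b1 *m J *m b2^T) 0 0 != 0.
  apply: contraNneq b12 => e; apply/eqP/matrixP => i j; rewrite !ord1 e.
  by rewrite mxE.
have sX : (0 < size (\det X))%N by rewrite size_poly_gt0.
rewrite [in RHS]mxE [in X in _ * X]mxE mulrC mul_polyC size_scale // expr2.
rewrite size_mul //; move=> e.
have : (size ((bh b1 *m polyMx J *m (bh b2)^T) ord0 ord0) < (size (\det X) + size (\det X)).-1)%N.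
  rewrite -mulmxA mxE.
  suff : (size (\sum_j bh b1 ord0 j * (polyMx J *m (bh b2)^T) j ord0)%R <= (size (\det X) + size (\det X)).-2)%N.
    by case: (size (\det X)) sX => // s _; rewrite addSn addnS /= ltnS.
  apply: (leq_trans (size_sum _ _ _)); apply/bigmax_leqP => j _.
  have l1 : (size (bh b1 ord0 j) < size (\det X))%N.
    by rewrite ltnNge; apply/negP => h; apply: no1; exists j.
  have l2 : (size ((polyMx J *m (bh b2)^T) j ord0) < size (\det X))%N.
    rewrite mxE -(prednK sX) ltnS; apply: (leq_trans (size_sum _ _ _)).
    apply/bigmax_leqP => k _; rewrite !mxE mul_polyC.
    apply: (leq_trans (size_scale_leq _ _)); rewrite -ltnS prednK //.
    by rewrite ltnNge; apply/negP => h; apply: no2; exists k.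
  apply: (leq_trans (size_polyMleq _ _)).
  by move: l1 l2; set a := size _; set b := size _; set c := size _; lia.
by rewrite e ltnn.
Qed.

End Minors.

(** * Lagrangian subspaces realising a minor of large degree *)

Section Lagrangian.
Variables (R : numFieldType) (n M : nat) (D J : 'M[R]_n).
Hypotheses (D0 : D ^+ M = 0) (M0 : (0 < M)%N).
Hypotheses (DJ : D *m J = - (J *m D^T)) (JT : J^T = - J).

Local Notation G := (expX M D).
Let r : nat := \rank (kermx J).
Local Notation isotropic := (isotropic J).
Local Notation exp_minor := (exp_minor M D).

Lemma mul_row_tr m m' (A : 'M[R]_(m, n)) (B : 'M[R]_(m', n)) i j :
  row i A *m (row j B)^T = ((A *m B^T) i j)%:M.
Proof.
apply/matrixP => a b; rewrite !ord1 !mxE eqxx mulr1n.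
by apply: eq_bigr => k _; rewrite !mxE.
Qed.

Lemma perp_row m m' (A : 'M[R]_(m, n)) (B : 'M[R]_(m', n)) k :
  A *m B^T = 0 -> A *m (row k B)^T = 0.
Proof. by move=> AB; rewrite tr_row colE mulmxA AB mul0mx. Qed.

(** While the orthogonal of [U] is not isotropic, it contains two vectors with nonzero pairing, and
    [ext_minor] adjoins one vector without lowering the degree. The nonzero minor keeps the rows
    independent, so [q] bounds the number of steps. *)
Lemma isotropic_extend q p (U : 'M_(p, n)) (Phi : 'M_(n, p)) :
  (n - p <= q)%N -> isotropic U -> (kermx J <= U)%MS -> (r < size (exp_minor U Phi))%N ->
  exists p' (V : 'M_(p', n)) (Psi : 'M_(n, p')), [/\ isotropic V, (kermx J <= V)%MS,
    (r < size (exp_minor V Psi))%N & isotropic (kermx (J *m V^T))].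
Proof.
elim: q p U Phi => [|q IH] p U Phi pq Uiso KU szU.
all: have [B0|/eqP B0] := eqVneq (kermx (J *m U^T) *m J *m (kermx (J *m U^T))^T) 0;
  first by exists p, U, Phi.
all: have X0 : exp_minor U Phi != 0 by rewrite -size_poly_gt0; apply: leq_ltn_trans szU.
all: set B := kermx (J *m U^T) in B0; have UB : U *m J *m B^T = 0
  by apply: (skew_swap JT); rewrite -mulmxA; apply: mulmx_ker.
all: have [i [j bij]] : exists i j, row i B *m J *m (row j B)^T != 0.
1, 3: apply: contrapT => no; apply: B0; apply/matrixP => i j; rewrite [RHS]mxE;
  apply: contrapT => nz; apply: no; exists i, j; apply: contra_notN nz => /eqP;
  by rewrite -row_mul mul_row_tr => /matrixP/(_ 0 0); rewrite !mxE eqxx mulr1n.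
all: have rB k : U *m J *m (row k B)^T = 0 by apply: perp_row.
all: have [b [psi [Ub szb]]] := ext_minor D0 M0 DJ JT Uiso (rB i) (rB j) bij X0.
all: have szb' := leq_trans szU szb.
all: have fr : row_free (col_mx U b)
  by apply: (@exp_minor_free _ _ M D _ _ (row_mx Phi psi)); rewrite -size_poly_gt0; apply: leq_ltn_trans szb'.
all: have := rank_leq_col (col_mx U b); rewrite (eqP fr) => pn.
- by exfalso; move: pn pq; rewrite addn1; lia.
- apply: (IH _ (col_mx U b) (row_mx Phi psi)) => //.
  + by move: pn pq; rewrite addn1; lia.
  + rewrite /isotropic mul_col_mx tr_col_mx mul_col_row Uiso Ub.
    by rewrite (skew_swap JT Ub) (skew_row _ JT) block_mx0.
  + by rewrite -addsmxE (submx_trans KU) ?addsmxSl.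
Qed.

(** [isotropic_rank] for [U] gives one inequality, and for its orthogonal, of dimension n - p + r,
    the other. *)
Lemma lagrangian_dim p (U : 'M_(p, n)) : row_free U -> isotropic U -> (kermx J <= U)%MS ->
  isotropic (kermx (J *m U^T)) -> (p + p = n + r)%N.
Proof.
move=> fU isoU KU isoB.
have h1 := isotropic_rank JT isoU; have h2 := isotropic_rank JT isoB.
have h3 := mxrank_mul_ker U J; have h4 := rank_perp U JT.
have h5 := mxrank_ker (J *m U^T).
have h6 : \rank (U :&: kermx J) = r by rewrite (capmx_idPr KU).
have h7 := rank_leq_row (J *m U^T).
move: h1 h2 h3 h4 h5 h6 h7; rewrite (eqP fU).
set a := \rank (kermx (J *m U^T)); set b := \rank (J *m U^T); set c := \rank (U *m J).
set d := \rank (_ :&: _); rewrite -/r; move: a b c d r => a b c d r0; lia.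
Qed.

(** The rows of [V] exp(tD), suitably normalised, tend to a subspace [Q] as t goes to infinity. [Q]
    is again Lagrangian, and columns dual to it both split [J] and see the full growth of the minors
    of [V]. *)
Lemma exp_minor_lagrangian p (U : 'M_(p, n)) (Phi : 'M_(n, p)) :
  isotropic U -> (kermx J <= U)%MS -> (r < size (exp_minor U Phi))%N ->
  exists p' (V : 'M_(p', n)) (e : 'M_(n, p')) (H : 'M_(p', n)),
  [/\ isotropic V, J = e *m H - (e *m H)^T, (r < size (exp_minor V e))%N &
     forall Psi, (size (exp_minor V Psi) <= size (exp_minor V e))%N].
Proof.
move=> Uiso KU szU.
have [{Uiso KU szU}p' [V [Psi0 [Viso KV szV isoB]]]] :=
  isotropic_extend (leqnn _) Uiso KU szU.
have exP : exists s, `[< exists Psi, size (exp_minor V Psi) = s >].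
  by exists (size (exp_minor V Psi0)); apply/asboolP; exists Psi0.
have bdP s : `[< exists Psi, size (exp_minor V Psi) = s >] -> (s <= (M * p').+1)%N.
  by move=> /asboolP[Psi <-]; apply: exp_minor_size.
have [s /asboolP[Psi sPsi] smax] := ex_maxnP exP bdP.
have {}smax Psi' : (size (exp_minor V Psi') <= s)%N.
  by apply: smax; apply/asboolP; exists Psi'.
have rs : (r < s)%N by apply: leq_trans szV (smax _).
case: s sPsi smax rs => // N sPsi smax rs.
have X0 : exp_minor V Psi != 0 by rewrite -size_poly_gt0 sPsi.
have fV := exp_minor_free X0; have dimV := lagrangian_dim fV Viso KV isoB.
set X := polyMx V *m G *m polyMx Psi; have sX : size (\det X) = N.+1 := sPsi.
(* Over the rational functions [Vh] spans the same rows as [V] exp(tD). Its entries are minors by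
   Cramer's rule, so the maximality of [s] bounds their degrees by [N]. *)
pose Vh := \adj X *m (polyMx V *m G).
have VhPsi : Vh *m polyMx Psi = (\det X)%:M by rewrite /Vh -mulmxA mul_adj_mx.
have sVh : sizeMx_le N Vh.
  move=> i j; have := smax (setcol Psi i (delta_mx j ord0)); apply: leq_trans.
  suff -> : Vh i j = exp_minor V (setcol Psi i (delta_mx j ord0)) by [].
  transitivity ((Vh *m (delta_mx j ord0 : 'cV_n)) i ord0); first by rewrite -colE [RHS]mxE.
  by rewrite /Vh -mulmxA adj_mul_col /exp_minor map_setcol mul_setcol map_delta_mx.
(* The limit at infinity. The equation [Q *m Psi] = (leading coefficient) shows that no rank is lost
   in it. *)
pose Q := coefMx N Vh.
have cX0 : (\det X)`_N != 0 by rewrite -[N]/(N.+1.-1) -sX -lead_coefE lead_coef_eq0.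
have QPsi : Q *m Psi = ((\det X)`_N)%:M.
  rewrite -coefMxMC VhPsi; apply/matrixP => i j; rewrite !mxE.
  by case: eqP; rewrite ?mulr1n ?mulr0n ?coef0.
have Qiso : isotropic Q.
  have h : Vh *m polyMx J *m Vh^T = 0.
    rewrite /Vh !trmx_mul map_trmx -!mulmxA (mulmxA G) (mulmxA (G *m _)) GJGT //.
    rewrite (mulmxA (polyMx J)) (mulmxA (polyMx V)) -!map_mxM mulmxA Viso.
    by rewrite map_mx0 mul0mx mulmx0.
  have sT : sizeMx_le N Vh^T by move=> i j; rewrite mxE.
  have := coefMxM_top (sizeMx_leMC J sVh) sT; rewrite h coefMxMC => e.
  rewrite /isotropic -[Q^T]/(trmx (coefMx N Vh)) [trmx (coefMx N Vh)]map_trmx -e.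
  by apply/matrixP => i j; rewrite !mxE coef0.
have fQ : row_free Q.
  apply/row_freeP; exists (((\det X)`_N)^-1 *: Psi); rewrite -scalemxAr QPsi.
  by rewrite scale_scalar_mx mulVf.
have Qperp m (a : 'M_(m, n)) : Q *m J *m a^T = 0 -> (a <= Q)%MS.
  move=> Qa; have QB : (Q <= kermx (J *m Q^T))%MS by apply/sub_kermxP; rewrite mulmxA.
  have aB : (a <= kermx (J *m Q^T))%MS.
    by apply/sub_kermxP; rewrite mulmxA; apply: skew_swap.
  apply: submx_trans aB _; rewrite -(geq_leqif (mxrank_leqif_sup QB)).
  have h2 : (\rank (Q :&: kermx J) <= \rank (kermx J))%N by rewrite mxrankS ?capmxSr.
  have h3 := mxrank_mul_ker Q J; have h4 := rank_perp Q JT.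
  have h5 := mxrank_ker (J *m Q^T); have h7 := rank_leq_row (J *m Q^T).
  rewrite (eqP fQ) in h3 *; move: h2 h3 h4 h5 h7 dimV; rewrite -/r.
  set c1 := \rank (kermx (J *m Q^T)); set c2 := \rank (J *m Q^T); set c3 := \rank (Q *m J).
  by set c4 := \rank (_ :&: _); move: c1 c2 c3 c4 r => c1 c2 c3 c4 r0; lia.
pose e0 := ((\det X)`_N)^-1 *: Psi.
have Qe0 : Q *m e0 = 1%:M by rewrite -scalemxAr QPsi scale_scalar_mx mulVf.
have [|e [Qe JE _]] := isotropic_split JT Qiso Qe0.
  apply: submx_ker => c Qc; have /submxP[d cT] : (c^T <= Q)%MS.
    by apply: Qperp; rewrite trmxK.
  rewrite -[c]trmxK cT trmx_mul mulmxA.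
  rewrite -(mulmxA _ _ Q^T) -trmx_mul mulmxBr mulmx1 mulmxA Qe0 mul1mx subrr.
  by rewrite trmx0 mulmx0 mul0mx.
(* Since [Q *m e] = 1, the determinant of [Vh *m polyMx e] has degree exactly N p'. Comparing
   degrees in \det X \det (Vh e) = (\det X)^p' \det (V exp(tD) e), where \det X has degree N, leaves
   N for the last factor. *)
have sz : size (exp_minor V e) = N.+1.
  have [d1 d2] := det_top (sizeMx_leMC e sVh).
  rewrite coefMxMC -/Q Qe det1 in d2.
  have sd : size (\det (Vh *m polyMx e)) = (N * p').+1.
    apply/eqP; rewrite eqn_leq d1 /= ltnNge; apply/negP => le.
    by move: d2; rewrite nth_default // => /esym/eqP; rewrite oner_eq0.
  have : \det X * \det (Vh *m polyMx e) = \det X ^+ p' * exp_minor V e.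
    rewrite /Vh -mulmxA det_mulmx mulrA -det_mulmx mul_mx_adj det_scalar.
    by [].
  have Vh0 : \det (Vh *m polyMx e) != 0 by rewrite -size_poly_gt0 sd.
  move=> E; have e0' : exp_minor V e != 0.
    apply: contraNneq (mulf_neq0 X0 Vh0) => z; rewrite -[X in X * _]/(\det X) E z mulr0.
    by [].
  have sXp : size (\det X ^+ p') = (N * p').+1.
    by rewrite polySpred ?expf_neq0 // size_exp sX.
  have := congr1 (fun q : {poly R} => size q) E.
  rewrite !size_mul ?expf_neq0 // sd sX sXp /=.
  by set y := size _; move: y => y; lia.
exists p', V, e, (Q *m J); split => //; first by rewrite sz.
by move=> Psi'; rewrite sz.
Qed.

End Lagrangian.

(** * Maximal stable isotropic subspaces and the functionals D^j beta *)

Section MaximalIsotropic.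
Variables (R : numFieldType) (n M : nat) (D J : 'M[R]_n) (beta : 'cV[R]_n).
Hypotheses (D0 : D ^+ M = 0) (M0 : (0 < M)%N).
Hypotheses (DJ : D *m J = - (J *m D^T)) (JT : J^T = - J).

Local Notation G := (expX M D).
Let r : nat := \rank (kermx J).
Local Notation isotropic := (isotropic J).
Local Notation exp_minor := (exp_minor M D).
Local Notation K := (kermx J).

Let expS a : D ^+ a.+1 = D *m D ^+ a. Proof. exact: exprS. Qed.
Let expSr a : D ^+ a.+1 = D ^+ a *m D. Proof. exact: exprSr. Qed.

Lemma kermx_stable m (k : 'M_(m, n)) : k *m J = 0 -> k *m D *m J = 0.
Proof. by move=> kJ; rewrite -mulmxA DJ mulmxN mulmxA kJ mul0mx oppr0. Qed.

Lemma kermx_stableX m (k : 'M_(m, n)) a : k *m J = 0 -> k *m D ^+ a *m J = 0.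
Proof.
by elim: a => [|a IH] kJ; rewrite ?mulmx1 // expSr mulmxA kermx_stable // IH.
Qed.

(** ker J is [D]-stable of dimension [r], so [nilp_stable_rank] gives this exponent. *)
Lemma kermx_nil m (k : 'M_(m, n)) : k *m J = 0 -> k *m D ^+ r = 0.
Proof.
move=> /eqP; rewrite -sub_kermx => /submxP[d ->]; rewrite -mulmxA.
rewrite (nilp_stable_rank D0) ?mulmx0 //.
by apply/sub_kermxP/kermx_stable/mulmx_ker.
Qed.

Lemma kermx_perp m m' (k : 'M_(m, n)) (a : 'M_(m', n)) : k *m J = 0 -> a *m J *m k^T = 0.
Proof. by move=> kJ; apply: skew_swap; rewrite // kJ mul0mx. Qed.

(* The row kernel of [obs] is the largest [D]-stable subspace killed by [beta]. *)
Definition obs : 'M[R]_(n, M) := \matrix_(i, j) (D ^+ j *m beta) i 0.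

Lemma mul_obsE m (a : 'M_(m, n)) i (j : 'I_M) : (a *m obs) i j = (a *m D ^+ j *m beta) i 0.
Proof.
rewrite -mulmxA !mxE; apply: eq_bigr => k _; rewrite mxE; congr (_ * _).
Qed.

Lemma obs_eq0 m (a : 'M_(m, n)) : a *m obs = 0 -> forall j, a *m D ^+ j *m beta = 0.
Proof.
move=> /matrixP aO j; apply/matrixP => i x; rewrite ord1 [RHS]mxE.
have [jM|Mj] := ltnP j M.
  by have := aO i (Ordinal jM); rewrite mul_obsE [RHS]mxE.
by rewrite -(subnKC Mj) exprD D0 mul0r mulmx0 mul0mx mxE.
Qed.

Lemma eq0_obs m (a : 'M_(m, n)) : (forall j, a *m D ^+ j *m beta = 0) -> a *m obs = 0.
Proof. by move=> h; apply/matrixP => i j; rewrite mul_obsE h !mxE. Qed.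

Lemma obs_stable m (a : 'M_(m, n)) : a *m obs = 0 -> a *m D *m obs = 0.
Proof.
by move=> aO; apply: eq0_obs => j; rewrite -(mulmxA a) -expS; apply: obs_eq0.
Qed.

Lemma obs_stableX m (a : 'M_(m, n)) b : a *m obs = 0 -> a *m D ^+ b *m obs = 0.
Proof.
by elim: b => [|b IH] aO; rewrite ?mulmx1 // expSr mulmxA obs_stable // IH.
Qed.

Lemma obs_beta m (a : 'M_(m, n)) : a *m obs = 0 -> a *m beta = 0.
Proof. by move=> aO; have := obs_eq0 aO 0; rewrite mulmx1. Qed.

Lemma row_free_border k (S : 'M[R]_(k, n)) (a : 'rV_n) :
  row_free S -> ~~ (a <= S)%MS -> row_free (col_mx S a).
Proof.
move=> fS aS; rewrite -kermx_eq0; apply/rowV0P => v /sub_kermxP.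
rewrite -[v]hsubmxK mul_row_col; set v1 := lsubmx v; set v2 := rsubmx v.
have [-> |v2n0] := eqVneq v2 0.
  rewrite mul0mx addr0 => e; rewrite (_ : v1 = 0) ?row_mx0 //.
  by apply: (row_free_inj fS); rewrite e mul0mx.
move=> e; case/negP: aS.
have v20 : v2 0 0 != 0.
  by apply: contraNneq v2n0 => e0; apply/eqP/matrixP => i j; rewrite !ord1 e0 mxE.
have v2a : v2 *m a = - (v1 *m S) by apply/eqP; rewrite -addr_eq0 addrC e.
rewrite -[a]scale1r -(mulVf v20) -scalerA -mul_scalar_mx -mul_scalar_mx -mx11_scalar v2a.
by rewrite mulmxN eqmx_opp mulmxA submxMl.
Qed.

(** If [a] violates maximality, so do its iterates under [D] as long as they stay outside [S]. The
    last such iterate is sent into [S] by [D]; adjoined as a last row it keeps [S] stable and [T]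
    strictly lower triangular. *)
Lemma maximal_isotropic q k (S : 'M_(k, n)) (T : 'M_k) : (n - k <= q)%N ->
  row_free S -> isotropic S -> S *m obs = 0 -> S *m D = T *m S ->
  (forall i j : 'I_k, (i <= j)%N -> T i j = 0) ->
  exists k' (S : 'M_(k', n)) (T : 'M_k'),
  [/\ isotropic S, S *m obs = 0, S *m D = T *m S,
     (forall i j : 'I_k', (i <= j)%N -> T i j = 0) /\ row_free S &
     forall a : 'rV_n, a *m obs = 0 -> S *m J *m a^T = 0 -> (a <= S)%MS].
Proof.
elim: q k S T => [|q IH] k S T kq fS Siso SO SD Tlow.
all: have [h|] := pselect (forall a : 'rV_n, a *m obs = 0 -> S *m J *m a^T = 0 -> (a <= S)%MS);
  first by exists k, S, T.
all: move=> /existsNP[a /not_implyP[aO /not_implyP[Sa /negP aS]]].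
all: have aDX b : (a *m D ^+ b) *m obs = 0 /\ S *m J *m (a *m D ^+ b)^T = 0.
1, 3: elim: b => [|b [IH1 IH2]]; rewrite ?mulmx1 // expSr mulmxA;
  split; rewrite ?obs_stable // trmx_mul mulmxA -(mulmxA S) -[J *m D^T]opprK -DJ;
  by rewrite mulmxN mulNmx mulmxA SD -!mulmxA (mulmxA S) IH2 mulmx0 oppr0.
all: have exb : exists b, (a *m D ^+ b <= S)%MS by exists M; rewrite D0 mulmx0 sub0mx.
all: have [[|b] aDb minb] := ex_minnP exb; first by rewrite mulmx1 (negbTE aS) in aDb.
all: have {minb} naDb : ~~ (a *m D ^+ b <= S)%MS by apply/negP => /minb; rewrite ltnn.
all: have {Sa aO aS} [aO Sa] := aDX b; move: aDb naDb aO Sa; rewrite expSr mulmxA;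
  move: (a *m D ^+ b) => {exb aDX} {}a /submxP[t aD] aS aO Sa.
all: have fS' : row_free (col_mx S a) by apply: row_free_border.
all: have := rank_leq_col (col_mx S a); rewrite (eqP fS') => kn.
- by exfalso; move: kn kq; rewrite addn1; lia.
- apply: (IH _ (col_mx S a) (block_mx T 0 t 0)) => //.
  + by move: kn kq; rewrite addn1; lia.
  + rewrite /isotropic mul_col_mx tr_col_mx mul_col_row Siso Sa.
    by rewrite (skew_swap JT Sa) (skew_row _ JT) block_mx0.
  + by rewrite mul_col_mx SO aO col_mx0.
  + by rewrite mul_col_mx SD aD mul_block_col !mul0mx !addr0.
  + move=> i j; rewrite -[i]fintype.splitK -[j]fintype.splitK.
    case: (fintype.split i) => i'; case: (fintype.split j) => j' /= ij.
    * by rewrite block_mxEul Tlow.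
    * by rewrite block_mxEur mxE.
    * by have := ltn_ord j'; rewrite ltnNge; move: ij; lia.
    * by rewrite block_mxEdr mxE.
Qed.

Hypothesis no_centre : forall k : 'rV_n, k *m J = 0 -> k *m D = 0 -> k *m beta = 0 -> k = 0.

(** The last nonzero iterate under [D] of a nonzero row would be killed by [J], [D] and [beta],
    against [no_centre]. *)
Lemma kermx_obs m (k : 'M_(m, n)) : k *m J = 0 -> k *m obs = 0 -> k = 0.
Proof.
move=> kJ kO; apply/row_matrixP => i; rewrite row0.
have {kJ} aJ : row i k *m J = 0 by rewrite -row_mul kJ row0.
have {kO} aO : row i k *m obs = 0 by rewrite -row_mul kO row0.
move: (row i k) aJ aO => a aJ aO.
have exb : exists b, a *m D ^+ b == 0 by exists M; rewrite D0 mulmx0.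
have [[|b] /eqP ab minb] := ex_minnP exb; first by rewrite mulmx1 in ab.
have : a *m D ^+ b = 0.
  apply: no_centre; first exact: kermx_stableX.
    by rewrite -mulmxA -expSr.
  exact: obs_eq0.
by move=> /eqP /minb; rewrite ltnn.
Qed.

Lemma kermx_basis : exists Kb : 'M_(r, n), [/\ Kb *m J = 0, row_free Kb & (K <= Kb)%MS].
Proof.
exists (row_base K); split; rewrite ?row_base_free ?eq_row_base //.
by apply/sub_kermxP; rewrite eq_row_base.
Qed.

(** The functionals D^j beta with j < r are coordinates on ker J: they separate it by [kermx_obs]
    and [kermx_nil], and there are r of them. So some [k] in ker J has the same first r values as
    [a]; the later values vanish for both. *)
Lemma kermx_shift m (a : 'M_(m, n)) : a *m D ^+ r *m obs = 0 ->
  exists k : 'M_(m, n), k *m J = 0 /\ (a - k) *m obs = 0.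
Proof.
move=> aO; pose Or : 'M_(n, r) := \matrix_(i, j) (D ^+ j *m beta) i 0.
have OrE m' (b : 'M_(m', n)) i (j : 'I_r) : (b *m Or) i j = (b *m D ^+ j *m beta) i 0.
  by rewrite -mulmxA !mxE; apply: eq_bigr => k _; rewrite mxE.
have [Kb [KbJ fKb _]] := kermx_basis.
have obsr m' (b : 'M_(m', n)) : b *m Or = 0 -> b *m D ^+ r *m obs = 0 -> b *m obs = 0.
  move=> /matrixP bOr bO; apply: eq0_obs => j; have [jr|rj] := ltnP j r.
    apply/matrixP => i x; rewrite ord1.
    by have := bOr i (Ordinal jr); rewrite OrE /= => ->; rewrite !mxE.
  by rewrite -(subnKC rj) exprD mulmxA; apply: obs_eq0.
have unit : Kb *m Or \in unitmx.
  rewrite -row_free_unit -kermx_eq0; apply/rowV0P => v /sub_kermxP.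
  rewrite mulmxA => vO; apply: (row_free_inj fKb); rewrite mul0mx.
  have vJ : v *m Kb *m J = 0 by rewrite -mulmxA KbJ mulmx0.
  by apply: kermx_obs => //; apply: obsr => //; rewrite kermx_nil ?mul0mx.
exists (a *m Or *m invmx (Kb *m Or) *m Kb).
have kJ : a *m Or *m invmx (Kb *m Or) *m Kb *m J = 0 by rewrite -mulmxA KbJ mulmx0.
split => //; apply: obsr; last by rewrite !mulmxBl aO kermx_nil // mul0mx subr0.
by rewrite mulmxBl -[X in _ - X]mulmxA mulmxKV ?subrr.
Qed.

(** Moving exp(-tD) across [J] and transposing gives, up to sign, a minor of exp(tD) on the
    isotropic frame [T]. The degree bound applies after enlarging [T] by ker J. *)
Lemma coef_exp_minor p (T : 'M_(p, n)) (E : 'M_(p, n)) : isotropic T ->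
  (forall p (U : 'M_(p, n)) (Phi : 'M_(n, p)), isotropic U -> (K <= U)%MS ->
     (size (exp_minor U Phi) <= r)%N) ->
  (\det (polyMx E *m expX M (- D) *m polyMx (J *m T^T)))`_r = 0.
Proof.
move=> Tiso small; apply: nth_default.
have [Kb [KbJ fKb KKb]] := kermx_basis.
have GJ : G *m polyMx J = polyMx J *m (expX M (- D))^T.
  by rewrite -[in LHS](opprK D) expXN_mulJ // linearN /= mulmxN mulNmx DJ.
have /row_freeP[k0 Kbk0] := fKb.
have big : (size (exp_minor (col_mx T Kb) (row_mx (J *m E^T) k0)) <= r)%N.
  apply: small; last first.
    by rewrite -addsmxE; apply: submx_trans KKb (addsmxSr _ _).
  rewrite /isotropic mul_col_mx tr_col_mx mul_col_row Tiso KbJ !mul0mx.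
  by rewrite kermx_perp // block_mx0.
have K0 : \det (polyMx Kb *m G *m polyMx k0) != 0.
  apply/eqP => /(congr1 (horner_eval 0)); rewrite -det_map_mx !map_mxM expX_at0 //.
  rewrite mulmx1 -!map_mxM Kbk0 -map_mx_comp.
  rewrite -(_ : 1%:M = map_mx (horner_eval 0 \o polyC) 1%:M).
    by rewrite det1 /horner_eval horner0 => /eqP; rewrite oner_eq0.
  by apply/matrixP => i j; rewrite !mxE /= /horner_eval hornerC.
(* [Kb] exp(tD) [J] = 0 makes the matrix block triangular, and the factor coming from [Kb] equals 1
   at t = 0. Hence the enlargement cannot lower the degree. *)
have bigE : exp_minor (col_mx T Kb) (row_mx (J *m E^T) k0) =
    \det (polyMx T *m G *m polyMx (J *m E^T)) * \det (polyMx Kb *m G *m polyMx k0).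
  rewrite /exp_minor map_col_mx map_row_mx mul_col_mx mul_col_row.
  rewrite [X in block_mx _ _ X _](_ : _ = 0) ?det_ublock //.
  by rewrite map_mxM mulmxA -(mulmxA (polyMx Kb)) GJ mulmxA -map_mxM KbJ map_mx0 !mul0mx.
have sz : (size (\det (polyMx T *m G *m polyMx (J *m E^T))) <= r)%N.
  have [->|T0] := eqVneq (\det (polyMx T *m G *m polyMx (J *m E^T))) 0.
    by rewrite size_poly0.
  apply: leq_trans big; rewrite bigE size_mul //.
  by rewrite -(prednK (_ : 0 < size (\det (polyMx Kb *m G *m polyMx k0)))%N) ?size_poly_gt0 //
     addnS leq_addr.
suff -> : \det (polyMx E *m expX M (- D) *m polyMx (J *m T^T)) =
    (-1) ^+ p * \det (polyMx T *m G *m polyMx (J *m E^T)).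
  by rewrite -signr_odd mulr_sign; case: ifP; rewrite ?size_polyN.
rewrite map_mxM mulmxA -(mulmxA (polyMx E)) expXN_mulJ // -detZ scaleN1r -[LHS]det_tr.
congr (\det _); rewrite !trmx_mul !trmxK map_mxM !map_trmx JT.
by rewrite trmxK map_mxN mulmxN mulNmx mulmxN !mulmxA.
Qed.

End MaximalIsotropic.

(** * Decomposition of J when all minors have small degree *)

Section SmallMinors.
Variables (R : numFieldType) (n M : nat) (D J : 'M[R]_n) (beta : 'cV[R]_n).
Hypotheses (D0 : D ^+ M = 0) (M0 : (0 < M)%N).
Hypotheses (DJ : D *m J = - (J *m D^T)) (JT : J^T = - J).
Hypothesis no_centre : forall k : 'rV_n, k *m J = 0 -> k *m D = 0 -> k *m beta = 0 -> k = 0.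

Local Notation G := (expX M D).
Let r : nat := \rank (kermx J).
Local Notation isotropic := (isotropic J).
Local Notation exp_minor := (exp_minor M D).
Local Notation K := (kermx J).
Local Notation obs := (obs M D beta).

Lemma factor_skew q (V : 'M_(n, q)) : K *m V = 0 -> exists Sg : 'M_(n, q), V = J *m Sg.
Proof.
move=> KV; have /submxP[d VT] : (V^T <= J^T)%MS.
  apply: submx_ker => c Jc; apply: trmx_inj; rewrite trmx_mul trmxK trmx0.
  have : (c^T <= K)%MS by apply/sub_kermxP; rewrite -[J]trmxK -trmx_mul Jc trmx0.
  by case/submxP=> e ->; rewrite -mulmxA KV mulmx0.
by exists d^T; rewrite -[V]trmxK VT trmx_mul trmxK.
Qed.

(** For the maximal [S], the orthogonal of [S] is S + ker J + Y with [J] nondegenerate on [Y]. Once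
    the part of [J] carried by [Y] is removed, [S] is Lagrangian up to the radical and
    [isotropic_split] yields [e]; the removed part is expressed by functionals in the image of
    D^r. *)
Lemma small_minors_split :
  (forall p (U : 'M_(p, n)) (Phi : 'M_(n, p)), isotropic U -> (K <= U)%MS ->
     (size (exp_minor U Phi) <= r)%N) ->
  exists k (S : 'M_(k, n)) (T : 'M_k) (e : 'M_(n, k)) (H : 'M_(k, n))
    q (mu nu : 'M_(n, q)),
  [/\ S *m e = 1%:M, isotropic S /\ S *m beta = 0,
      S *m D = T *m S /\ (forall i j : 'I_k, (i <= j)%N -> T i j = 0),
      J = e *m H - (e *m H)^T
          + (D ^+ r *m mu *m nu^T - nu *m (D ^+ r *m mu)^T) &
      forall i (E : 'M_(1 + k, n)),
      (\det (polyMx E *m expX M (- D) *m polyMx (row_mx (col i nu) e)))`_r = 0].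
Proof.
move=> small.
have [||||||k [S [T [Siso SO SD [Tlow fS] Smax]]]] :=
  @maximal_isotropic _ n M D J beta D0 M0 DJ JT (n - 0)%N 0 0 0.
- by [].
- by rewrite -row_leq_rank.
- by rewrite /isotropic !mul0mx.
- by rewrite mul0mx.
- by rewrite !mul0mx.
- by case.
have [Kb [KbJ fKb KKb]] := kermx_basis J.
(* A vector killed by [V] falls into the kernel of [obs] after a shift along ker J ([kermx_shift]),
   so these functionals measure what separates [S] from being Lagrangian. *)
pose V := D ^+ r *m obs.
have KV : K *m V = 0.
  by rewrite mulmxA (kermx_nil D0 DJ) ?mul0mx ?mulmx_ker.
have SV : S *m V = 0 by rewrite mulmxA; apply: obs_stableX.
have [Sg VE] := factor_skew KV.
pose Gam := Sg^T *m J *m Sg.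
have GamE : Gam = Sg^T *m V by rewrite VE mulmxA.
have GamT : Gam^T = - Gam.
  by have := skew_conj Sg^T JT; rewrite trmxK.
have GamC m (A : 'M_(m, M)) : A *m Sg^T *m J *m (A *m Sg^T)^T = A *m Gam *m A^T.
  by rewrite trmx_mul trmxK /Gam !mulmxA.
clearbody Gam.
have c0 m (a : 'M_(m, n)) : a *m V = 0 -> S *m J *m a^T = 0 ->
    exists (s : 'M_(m, k)) (x : 'M_(m, n)), a = s *m S + x /\ x *m J = 0.
  move=> aV Sa; have [|x [xJ axO]] := @kermx_shift _ n M D J beta D0 DJ no_centre m a.
    by rewrite -mulmxA.
  have /submxP[s axS] : (a - x <= S)%MS.
    apply/row_subP => i; apply: Smax; first by rewrite -row_mul axO row0.
    apply: perp_row; rewrite linearB /= mulmxBr Sa sub0r.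
    by rewrite (kermx_perp JT _ xJ) oppr0.
  by exists s, x; rewrite -axS subrK.
(* [Gam] is the Gram matrix of the rows of [Sg^T]. A complement of its kernel selects combinations
   [Y] on which [J] is nondegenerate. *)
pose C := row_base (kermx Gam)^C%MS.
have C0 m (v : 'M_(m, \rank (kermx Gam)^C%MS)) : v *m C *m Gam = 0 -> v = 0.
  move=> vC; apply: (row_free_inj (row_base_free (kermx Gam)^C%MS)); rewrite mul0mx.
  apply/eqP; rewrite -submx0 -(capmx_compl (kermx Gam)) sub_capmx.
  apply/andP; split; first by apply/sub_kermxP.
  by rewrite -(eq_row_base (kermx Gam)^C%MS) submxMl.
have [u [w uw]] : exists u w, 1%:M = u *m C + w *m kermx Gam.
  have : (1%:M <= C + kermx Gam)%MS.
    rewrite (adds_eqmx (eq_row_base _) (eqmx_refl _)) addsmxC.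
    by rewrite sub1mx addsmx_compl_full.
  by case/sub_addsmxP => -[u w] /= ->; exists u, w.
move: (\rank _) C C0 u uw => d C C0 u uw.
pose Y := C *m Sg^T; pose g := Y *m J *m Y^T.
have gE : g = C *m Gam *m C^T by apply: GamC.
have gT : g^T = - g by apply: skew_conj.
have gU : g \in unitmx.
  rewrite -row_free_unit -kermx_eq0; apply/rowV0P => v /sub_kermxP vg.
  have vC : v *m C *m Gam *m C^T = 0 by move: vg; rewrite gE !mulmxA.
  have vK : v *m C *m Gam *m (kermx Gam)^T = 0.
    rewrite -mulmxA (_ : Gam *m _ = 0) ?mulmx0 //.
    by rewrite -[in LHS](opprK Gam) -{1}GamT mulNmx -trmx_mul opprK mulmx_ker trmx0 oppr0.
  apply: C0; rewrite -[LHS]mulmx1 -[1%:M]trmx1 uw linearD /= (trmx_mul u) (trmx_mul w) mulmxDr (mulmxA _ C^T) (mulmxA _ (kermx Gam)^T).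
  by rewrite vC vK !mul0mx addr0.
pose N := J *m Y^T.
have NE : N = D ^+ r *m (obs *m C^T).
  by rewrite /N /Y trmx_mul trmxK (mulmxA J) -VE mulmxA.
have NT : N^T = - (Y *m J) by rewrite trmx_mul trmxK JT mulmxN.
have SN : S *m N = 0 by rewrite NE !mulmxA -(mulmxA S) SV mul0mx.
have YN : Y *m N = g by rewrite mulmxA.
have KN m (x : 'M_(m, n)) : x *m J = 0 -> x *m N = 0 by move=> xJ; rewrite mulmxA xJ mul0mx.
(* Symplectic reduction by [Y]: this form has [Y] in its radical and coincides with [J] on vectors
   orthogonal to [Y]. *)
pose JC := J + N *m invmx g *m N^T.
have giT : (invmx g)^T = - invmx g.
  have gi : g *m - (invmx g)^T = 1%:M.
    by rewrite mulmxN -mulNmx -gT -trmx_mul mulVmx // trmx1.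
  by rewrite -[in RHS](mulmx1 (invmx g)) -gi mulKmx // opprK.
have JCT : JC^T = - JC.
  by rewrite linearD /= JT skew_conj // opprD.
have NdE : J *m Y^T = N by [].
clearbody N.
have SJC : S *m JC = S *m J.
  by rewrite mulmxDr !mulmxA SN !mul0mx addr0.
have JCS : JC *m S^T = J *m S^T.
  by apply: trmx_inj; rewrite !trmx_mul !trmxK JCT JT !mulmxN SJC.
have KJC m (x : 'M_(m, n)) : x *m J = 0 -> x *m JC = 0.
  by move=> xJ; rewrite mulmxDr !mulmxA KN // xJ !mul0mx addr0.
have YJC : Y *m JC = 0.
  by rewrite mulmxDr !mulmxA YN mulmxV // mul1mx NT subrr.
(* After subtraction of its [Y] component, [a] is orthogonal to [Y], and also to the rows of
   [kermx Gam *m Sg^T], which lie in S + ker J by [c0]. Together these span the rows of [Sg^T], so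
   [V] kills the difference and [c0] applies to it. *)
have c1 m (a : 'M_(m, n)) : S *m J *m a^T = 0 ->
    exists (s : 'M_(m, k)) (x : 'M_(m, n)) (y : 'M_(m, d)), a = s *m S + x + y *m Y /\ x *m J = 0.
  move=> Sa; pose y := a *m N *m invmx g; pose a1 := a - y *m Y.
  have a1N : a1 *m N = 0 by rewrite mulmxBl -(mulmxA y) YN mulmxKV ?subrr.
  have Sa1 : S *m J *m a1^T = 0.
    by rewrite linearB /= (trmx_mul y) mulmxBr Sa sub0r mulmxA -(mulmxA S) NdE SN mul0mx oppr0.
  pose rho := kermx Gam *m Sg^T.
  have [s' [x' [rhoE x'J]]] : exists s' x', rho = s' *m S + x' /\ x' *m J = 0.
    apply: c0; first by rewrite -mulmxA -GamE mulmx_ker.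
    by rewrite (trmx_mul (kermx Gam)) trmxK mulmxA -(mulmxA S) -VE SV mul0mx.
  have a1V : a1 *m V = 0.
    have SgE : Sg = Y^T *m u^T + rho^T *m w^T.
      rewrite -!trmx_mul -linearD /= /Y /rho (mulmxA u) (mulmxA w) -mulmxDl -uw.
      by rewrite mul1mx trmxK.
    have a1rho : a1 *m J *m rho^T = 0.
      rewrite rhoE linearD /= mulmxDr (trmx_mul s') mulmxA (skew_swap JT Sa1).
      by rewrite mul0mx (kermx_perp JT _ x'J) addr0.
    rewrite VE SgE mulmxA mulmxDr (mulmxA _ Y^T) (mulmxA _ rho^T) a1rho.
    by rewrite -(mulmxA a1) NdE a1N !mul0mx addr0.
  have [s [x [a1E xJ]]] := c0 _ _ a1V Sa1.
  by exists s, x, y; rewrite -a1E subrK.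
have JCdE : JC = J + N *m invmx g *m N^T by [].
clearbody g; clearbody Y; clearbody JC V.
have fB : row_free (col_mx S (col_mx Kb Y)).
  rewrite -kermx_eq0; apply/rowV0P => v /sub_kermxP.
  rewrite -[v]hsubmxK; move: (lsubmx v) (rsubmx v) => v1 v23.
  rewrite -[v23]hsubmxK; move: (lsubmx v23) (rsubmx v23) => v2 v3.
  rewrite !mul_row_col => e.
  have v30 : v3 = 0.
    have := congr1 (mulmx^~ N) e; rewrite !mulmxDl mul0mx -!mulmxA SN KN // YN !mulmx0 !add0r.
    by move=> h; rewrite -[v3](mulmxK gU) h mul0mx.
  have v2K : v2 *m Kb = 0.
    apply: (@kermx_obs _ n M D J beta D0 DJ no_centre); first by rewrite -mulmxA KbJ mulmx0.
    have := congr1 (mulmx^~ obs) e; rewrite v30 mul0mx addr0 mulmxDl -(mulmxA v1) SO mulmx0.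
    by rewrite add0r mul0mx.
  have v20 : v2 = 0 by apply: (row_free_inj fKb); rewrite v2K mul0mx.
  have v10 : v1 = 0.
    by apply: (row_free_inj fS); move: e; rewrite v20 v30 !mul0mx !addr0.
  by rewrite v10 v20 v30 !row_mx0.
(* Independence of [S], [Kb] and [Y] allows columns dual to [S] that vanish on ker J and on [Y];
   [isotropic_split] preserves this vanishing. *)
pose e0 := pinvmx (col_mx S (col_mx Kb Y)) *m col_mx (1%:M : 'M_k) 0.
have [Se0 [Ke0 Ye0]] : S *m e0 = 1%:M /\ Kb *m e0 = 0 /\ Y *m e0 = 0.
  have : col_mx S (col_mx Kb Y) *m e0 = col_mx 1%:M 0 by rewrite mulmxA mulmxVp // mul1mx.
  by rewrite !mul_col_mx -[X in _ = col_mx _ X]vsubmxK => /eq_col_mx[-> /eq_col_mx[-> ->]];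
     rewrite linear0 linear0.
have {}Ke0 m (x : 'M_(m, n)) : x *m J = 0 -> x *m e0 = 0.
  move=> /eqP; rewrite -sub_kermx => xK; have /submxP[c ->] := submx_trans xK KKb.
  by rewrite -mulmxA Ke0 mulmx0.
have SJCS : S *m JC *m S^T = 0 by rewrite SJC.
have R0K m (x : 'M_(m, n)) : x *m e0 = 0 -> x *m JC = 0 ->
    x *m ((1%:M - e0 *m S) *m JC *m (1%:M - e0 *m S)^T) = 0.
  by move=> xe xJ; rewrite !mulmxA mulmxBr mulmx1 mulmxA xe mul0mx subr0 xJ mul0mx.
have R0T m (x : 'M_(m, n)) : x *m ((1%:M - e0 *m S) *m JC *m (1%:M - e0 *m S)^T) = 0 ->
    ((1%:M - e0 *m S) *m JC *m (1%:M - e0 *m S)^T) *m x^T = 0.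
  have := skew_conj (1%:M - e0 *m S) JCT; move: (_ *m _) => R0 R0T h.
  by apply: trmx_inj; rewrite trmx_mul trmxK R0T mulmxN h oppr0 trmx0.
have [|e [Se JCE eK]] := isotropic_split JCT SJCS Se0.
  apply: submx_ker => c; rewrite SJC => Sc.
  have [|s [x [y [cE xJ]]]] := c1 _ c^T; first by rewrite trmxK.
  have {}cE : c = S^T *m s^T + x^T + Y^T *m y^T.
    by rewrite -!trmx_mul -!linearD /= -cE trmxK.
  rewrite cE !mulmxDr (mulmxA _ S^T) (mulmxA _ Y^T).
  rewrite (R0T _ x) ?(R0T _ Y) ?(R0T _ S) ?mul0mx ?addr0 //.
  - by rewrite !mulmxA mulmxBr mulmx1 mulmxA Se0 mul1mx subrr !mul0mx.
  - by apply: R0K.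
  - by apply: R0K; [apply: Ke0|apply: KJC].
have Ke m (x : 'M_(m, n)) : x *m J = 0 -> x *m e = 0.
  by move=> xJ; apply: eK; [apply: Ke0|apply: R0K; [apply: Ke0|apply: KJC]].
have Ye : Y *m e = 0 by apply: eK => //; apply: R0K.
have [W eE] := factor_skew (Ke _ _ (mulmx_ker J)).
have WN : W^T *m N = 0.
  by rewrite -NdE mulmxA; apply: (skew_swap JT); rewrite trmxK -mulmxA -eE.
(* Put X = W^T J W. Evaluating the splitting of [JC] on [W], with S JC W = 1, gives X = 2 X. *)
have W0 : W^T *m J *m W = 0.
  have WJC : W^T *m JC *m W = W^T *m J *m W.
    by rewrite JCdE mulmxDr !mulmxA WN !mul0mx addr0.
  have SJW : S *m JC *m W = 1%:M by rewrite SJC -mulmxA -eE.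
  have skx : (W^T *m J *m W)^T = - (W^T *m J *m W).
    by have := skew_conj W^T JT; rewrite trmxK.
  have WH : W^T *m (e *m (S *m JC)) *m W = W^T *m J *m W.
    by rewrite -!mulmxA (mulmxA S) SJW mulmx1 eE.
  have WHT : W^T *m (e *m (S *m JC))^T *m W = - (W^T *m J *m W).
    by move: (e *m (S *m JC)) WH => X WH; rewrite -skx -WH !trmx_mul trmxK mulmxA.
  have : W^T *m J *m W + W^T *m J *m W = W^T *m J *m W.
    by rewrite -[RHS]WJC [in RHS]JCE mulmxBr mulmxBl WH WHT opprK.
  by move=> /eqP; rewrite -subr_eq0 addrK => /eqP.
(* The half compensates for the skew matrix N g^-1 N^T occurring twice in the antisymmetrised
   product of [N] and [nu]. *)
pose nu := 2^-1 *: (N *m invmx g); pose y := 2^-1 *: ((invmx g)^T *m Y).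
have nuE : nu = J *m y^T.
  by rewrite /y linearZ /= trmx_mul trmxK -scalemxAr mulmxA NdE.
exists k, S, T, e, (S *m JC), d, (obs *m C^T), nu; split => //.
- by split; last apply: (obs_beta D0 SO).
- rewrite -JCE -NE JCdE /nu -scalemxAl linearZ /= trmx_mul giT mulNmx scalerN.
  rewrite mulmxN -scalemxAr mulmxA -opprD -scalerDl (_ : 2^-1 + 2^-1 = 1 :> R); last by field.
  by rewrite scale1r addrK.
- move=> i E.
  (* All columns have the form [J] times a frame. The frame is isotropic: [W] is so by [W0], and [y]
     is orthogonal to [W] because [e] = J W vanishes on [Y]. *)
  have -> : row_mx (col i nu) e = J *m (col_mx (row i y) W^T)^T.
    by rewrite tr_col_mx mul_mx_row trmxK -eE tr_row nuE !colE mulmxA.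
  apply: (coef_exp_minor M0 DJ JT) => //.
  have yW : row i y *m J *m W = 0.
    rewrite -mulmxA -eE /y -row_mul -scalemxAl -mulmxA Ye mulmx0 scaler0.
    by rewrite row0.
  rewrite /isotropic mul_col_mx tr_col_mx mul_col_row trmxK W0 yW.
  rewrite (skew_row _ JT) (skew_swap JT) ?block_mx0 //.
  by rewrite trmxK.
Qed.
End SmallMinors.

(** * Determinantal cochains *)

Section Laplace.
Variable S : comNzRingType.

Lemma col'0_row_mx m k (v : 'cV[S]_m) (B : 'M[S]_(m, k)) :
  col' ord0 (row_mx v B : 'M_(m, 1 + k)) = B.
Proof.
apply/matrixP => i j; rewrite mxE.
have -> : lift ord0 j = rshift 1 j by apply: val_inj.
exact: row_mxEr.
Qed.

Lemma row_mx00 m k (v : 'cV[S]_m) (B : 'M[S]_(m, k)) i :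
  (row_mx v B : 'M_(m, 1 + k)) i ord0 = v i 0.
Proof.
have -> : ord0 = lshift k (0 : 'I_1) by apply: val_inj.
exact: row_mxEl.
Qed.

Definition del2 (T : Type) k (f : 'I_k.+2 -> T) (i j : 'I_k.+2) (m : 'I_k) : T :=
  f (inord (bump j (bump i m))).

Lemma del2_lift k (i j : 'I_k.+2) (m : 'I_k) (j' : 'I_k.+1) : (i < j)%N ->
  j = lift i j' -> del2 id i j m = lift i (lift j' m).
Proof.
move=> + e; rewrite e => ij; apply: val_inj => /=; rewrite inordK.
  by move: (ltn_ord m); rewrite /bump; move: ij => /=; rewrite /bump; lia.
by move: (ltn_ord m) (ltn_ord i); rewrite /bump; lia.
Qed.

Lemma del2_lift' k (i j : 'I_k.+2) (m : 'I_k) (i' : 'I_k.+1) : (i < j)%N ->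
  i = lift j i' -> del2 id i j m = lift j (lift i' m).
Proof.
move=> ij e; have e' : i = i' :> nat by move: ij; rewrite e /= /bump; lia.
apply: val_inj => /=; rewrite inordK ?e' //.
by move: (ltn_ord m) (ltn_ord j); rewrite /bump; lia.
Qed.

Lemma lift_gt k (i : 'I_k.+1) (j : 'I_k) : (i < lift i j)%N -> lift i j = j.+1 :> nat.
Proof. by rewrite /= /bump; lia. Qed.

Lemma lift_lt k (i : 'I_k.+1) (j : 'I_k) : (i < lift i j)%N = false ->
  lift i j = j :> nat /\ (lift i j < i)%N.
Proof. by rewrite /= /bump; lia. Qed.

Lemma sum_neq_lift (V : zmodType) k (i : 'I_k.+1) (F : 'I_k.+1 -> V) :
  \sum_(j | j != i) F j = \sum_j F (lift i j).
Proof.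
by apply: (addrI (F i)); rewrite -[RHS](bigD1_ord i (P := xpredT)) // [RHS](bigD1 i).
Qed.

(** Laplace expansion along the first two columns, arranged with the row deletions of [ce_args].
    Those columns have indices 0 and 1, which accounts for the global sign. *)
Lemma laplace2 k (a g : 'cV[S]_k.+2) (A : 'M[S]_(k.+2, k)) :
  \sum_(i < k.+2) \sum_(j < k.+2 | (i < j)%N) (-1) ^+ (i + j) *
    (a i 0 * g j 0 - a j 0 * g i 0) * \det (\matrix_(m, q) A (del2 id i j m) q)
  = - \det (row_mx a (row_mx g A) : 'M_(1 + (1 + k))).
Proof.
pose d i j := \det (\matrix_(m, q) A (del2 id i j m) q).
pose h (i j : 'I_k.+2) := (-1) ^+ (i + j) * (a i 0 * g j 0) *
  (if (i < j)%N then - d i j else d j i).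
have -> : \det (row_mx a (row_mx g A) : 'M_(1 + (1 + k))) =
    \sum_i \sum_(j | j != i) h i j.
  rewrite (expand_det_col _ ord0); apply: eq_bigr => i _.
  rewrite row_mx00 /cofactor /= addn0 mulrA.
  have -> : row' i (col' ord0 (row_mx a (row_mx g A) : 'M_(1 + (1 + k)))) =
     row_mx (row' i g) (row' i A) :> 'M_(1 + k).
    by rewrite col'0_row_mx -[LHS]/(row' i (row_mx g A)) row'_row_mx.
  rewrite (expand_det_col _ ord0) mulr_sumr.
  rewrite sum_neq_lift.
  apply: eq_bigr => j _; rewrite row_mx00 mxE /cofactor col'0_row_mx addn0 /h.
  case: ifP => ij.
    rewrite /d (_ : \matrix_(m, q) A (del2 id i (lift i j) m) q = row' j (row' i A)).
      rewrite (lift_gt ij).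
      rewrite addnS exprS exprD; ring.
    by apply/matrixP => m q; rewrite !mxE (del2_lift _ ij erefl).
  have [ej {}ij] := lift_lt ij.
  rewrite /d (_ : \matrix_(m, q) A (del2 id (lift i j) i m) q = row' j (row' i A)).
    rewrite ej exprD; ring.
  by apply/matrixP => m q; rewrite !mxE (del2_lift' _ ij erefl).
have -> : \sum_i \sum_(j | j != i) h i j =
    \sum_(i < k.+2) \sum_(j < k.+2 | (i < j)%N) (h i j + h j i).
  under [RHS]eq_bigr do rewrite big_split /=.
  rewrite big_split /= [X in _ = _ + X](exchange_big_dep xpredT) //= -big_split /=.
  apply: eq_bigr => i _; rewrite (bigID (fun j : 'I_k.+2 => (i < j)%N)) /=; congr (_ + _).
    by apply: eq_bigl => j; rewrite neq_ltn; case: (ltngtP i j).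
  by apply: eq_bigl => j; rewrite -(inj_eq val_inj) /=; case: (ltngtP i j).
rewrite -sumrN; apply: eq_bigr => i _; rewrite -sumrN; apply: eq_bigr => j ij.
rewrite /h ij [(j < i)%N]ltnNge (ltnW ij) /= [(j + i)%N]addnC -/(d i j); ring.
Qed.

End Laplace.

Section DetForms.
Variables (R : numFieldType) (L : lieAlgType R) (N : nat) (c : {linear L -> 'rV[R]_N}).

Definition cmx k (X : {ffun 'I_k -> L}) : 'M[R]_(k, N) := \matrix_i c (X i).

Lemma row_cmx k (X : {ffun 'I_k -> L}) i : row i (cmx X) = c (X i).
Proof. exact: rowK. Qed.

Lemma cmx_fcons k v (X : {ffun 'I_k -> L}) :
  cmx (fcons v X) = col_mx (c v) (cmx X) :> 'M_(1 + k, N).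
Proof.
apply/row_matrixP => i; rewrite row_cmx -[i]fintype.splitK; case: (fintype.split i) => j /=.
  rewrite rowKu (_ : lshift k j = ord0); last by apply: val_inj; rewrite /= ord1.
  by rewrite fcons0; apply/matrixP => a b; rewrite mxE !ord1.
by rewrite rowKd row_cmx (_ : rshift 1 j = lift ord0 j) ?fconsS //; apply: val_inj.
Qed.

(* The [l]-th coefficient of the wedge of the polynomial families of linear
   functionals given by the columns of [A]. *)
Definition detform k (A : 'M[{poly R}]_(N, k)) l (X : {ffun 'I_k -> L}) : R :=
  (\det (polyMx (cmx X) *m A))`_l.

Lemma detform_altform k (A : 'M_(N, k)) l : detform A l \in is_altform L k.
Proof.
apply/asboolP; split.
  move=> X i a u v; rewrite /detform.
  have E b : row i (polyMx (cmx (upd X i b)) *m A) = polyMx (c b) *m A.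
    by rewrite row_mul -map_row row_cmx ffunE eqxx.
  have E' b b' : row' i (polyMx (cmx (upd X i b)) *m A) = row' i (polyMx (cmx (upd X i b')) *m A).
    apply/matrixP => p q; rewrite !mxE; apply: eq_bigr => x _; rewrite !mxE !ffunE.
    by rewrite eq_sym (negbTE (neq_lift _ _)).
  rewrite (@determinant_multilinear _ _ _ (polyMx (cmx (upd X i u)) *m A)
     (polyMx (cmx (upd X i v)) *m A) i a%:P 1) ?mul1r.
  - by rewrite coefD coefCM.
  - rewrite !E scale1r linearP /= map_mxD map_mxZ mulmxDl scalemxAl.
    by [].
  - exact: E'.
  - exact: E'.
move=> X i j ij Xij; rewrite /detform (determinant_alternate ij) ?coef0 //.
by move=> q; rewrite !mxE; apply: eq_bigr => x _; rewrite !mxE Xij.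
Qed.

Lemma ce_args_fcons k (X : {ffun 'I_k.+2 -> L}) i j :
  ce_args X i j = fcons (lie (X i) (X j)) [ffun m => del2 X i j m].
Proof.
apply/ffunP => m; rewrite ffunE; case: (unliftP ord0 m) => [m' ->|->].
  by rewrite fconsS ffunE.
by rewrite fcons0.
Qed.

Definition ce_det k (A : 'M[{poly R}]_(N, k)) (X : {ffun 'I_k.+1 -> L}) : {poly R} :=
  \sum_(i < k.+1) \sum_(j < k.+1 | (i < j)%N) (-1) ^+ (i + j) *
    \det (polyMx (cmx (ce_args X i j)) *m A).

Lemma ce_diff_detform k (A : 'M_(N, k)) l X : ce_diff (detform A l) X = (ce_det A X)`_l.
Proof.
rewrite /ce_det coef_sum; apply: eq_bigr => i _; rewrite coef_sum.
apply: eq_bigr => j _; rewrite /detform -[in RHS]signr_odd mulr_sign -signr_odd mulr_sign.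
by case: odd; rewrite ?coefN.
Qed.

Lemma det_polyMx_row k (v : 'rV[R]_N) (Y : 'M[R]_(k, N)) (A : 'M[{poly R}]_(N, k.+1)) :
  \det (polyMx (col_mx v Y : 'M_(1 + k, N)) *m A) =
  \sum_(p < k.+1) (-1) ^+ p * (polyMx v *m A) 0 p * \det (polyMx Y *m col' p A).
Proof.
rewrite (expand_det_row _ ord0); apply: eq_bigr => p _.
rewrite map_col_mx /cofactor /= add0n mulrCA mulrA; congr (_ * _ * _); last apply: (congr1 (@determinant _ k)).
  rewrite !mxE; apply: eq_bigr => x _; congr (_ * _).
  have -> : ord0 = lshift k (0 : 'I_1) by apply: val_inj.
  exact: col_mxEu.
apply/matrixP => i j; rewrite !mxE; apply: eq_bigr => x _; rewrite [in RHS]mxE; congr (_ * _); last by rewrite mxE.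
rewrite (_ : lift ord0 i = rshift 1 i); last exact: val_inj.
by rewrite [LHS]col_mxEd mxE.
Qed.

(** The Leibniz rule for a wedge of functionals. The minus sign reflects that [ce_diff] of a
    functional f is -f([l, l']), so that column [p] has differential minus the sum of B /\ C. *)
Lemma ce_detE k (Q : finType) (A : 'M_(N, k.+1)) (B C : 'I_k.+1 -> Q -> 'cV[{poly R}]_N)
    (X : {ffun 'I_k.+2 -> L}) :
  (forall p l l', (polyMx (c (lie l l')) *m A) 0 p =
     \sum_q ((polyMx (c l) *m B p q) 0 0 * (polyMx (c l') *m C p q) 0 0 -
             (polyMx (c l') *m B p q) 0 0 * (polyMx (c l) *m C p q) 0 0)) ->
  ce_det A X = - \sum_(p < k.+1) \sum_q (-1) ^+ p *
    \det (polyMx (cmx X) *m row_mx (B p q) (row_mx (C p q) (col' p A)) : 'M_(1 + (1 + k))).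
Proof.
move=> dA; rewrite -sumrN.
transitivity (\sum_(p < k.+1) \sum_q \sum_(i < k.+2) \sum_(j < k.+2 | (i < j)%N)
   (-1) ^+ p * ((-1) ^+ (i + j) * ((polyMx (c (X i)) *m B p q) 0 0 * (polyMx (c (X j)) *m C p q) 0 0 -
     (polyMx (c (X j)) *m B p q) 0 0 * (polyMx (c (X i)) *m C p q) 0 0) *
   \det (\matrix_(m, x) (polyMx (cmx X) *m col' p A) (del2 id i j m) x))).
  rewrite /ce_det; under [RHS]eq_bigr => p _ do rewrite exchange_big /=.
  rewrite [RHS]exchange_big /=; apply: eq_bigr => i _.
  under [RHS]eq_bigr => p _ do rewrite exchange_big /=.
  rewrite [RHS]exchange_big /=; apply: eq_bigr => j ij.
  rewrite ce_args_fcons cmx_fcons det_polyMx_row mulr_sumr; apply: eq_bigr => p _.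
  rewrite dA (_ : polyMx (cmx [ffun m => del2 X i j m]) *m col' p A =
    \matrix_(m, x) (polyMx (cmx X) *m col' p A) (del2 id i j m) x); last first.
    by apply/matrixP => m x; rewrite !mxE; apply: eq_bigr => y _; rewrite !mxE ffunE.
  move: (\det _) => dd; rewrite mulr_sumr mulr_suml mulr_sumr.
  by apply: eq_bigr => q _; ring.
apply: eq_bigr => p _; rewrite -sumrN; apply: eq_bigr => q _.
under eq_bigr => i _ do rewrite -mulr_sumr.
rewrite -mulr_sumr -mulrN; congr (_ * _).
rewrite !mul_mx_row -laplace2; apply: eq_bigr => i _; apply: eq_bigr => j ij.
congr (_ * (_ * _ - _ * _) * _).
all: by rewrite -row_cmx map_row -row_mul mxE.
Qed.

End DetForms.

(** * Alternating forms as combinations of determinants *)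

Section AltForms.
Variables (R : numFieldType) (L : lieAlgType R) (N : nat) (c : {linear L -> 'rV[R]_N}).
Variable b : 'I_N -> L.
Hypothesis cb : forall l, l = \sum_i c l 0 i *: b i.

Lemma upd_same k (X : {ffun 'I_k -> L}) i u v : upd (upd X i u) i v = upd X i v.
Proof. by apply/ffunP => j; rewrite !ffunE; case: eqP. Qed.

Lemma upd_comm k (X : {ffun 'I_k -> L}) i j u v : i != j ->
  upd (upd X i u) j v = upd (upd X j v) i u.
Proof.
move=> ij; apply/ffunP => x; rewrite !ffunE; case: (eqVneq x j) => // ->.
by rewrite eq_sym (negbTE ij).
Qed.

Lemma updE k (X : {ffun 'I_k -> L}) i : upd X i (X i) = X.
Proof. by apply/ffunP => j; rewrite ffunE; case: eqP => // ->. Qed.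

Section Fixed.
Variables (k : nat) (w : altform L k).

Lemma altform_upd0r X i : w (upd X i 0) = 0.
Proof. by apply: (@altform_upd0 _ _ _ w _ i); rewrite ffunE eqxx. Qed.

Lemma altform_updD X i u v : w (upd X i (u + v)) = w (upd X i u) + w (upd X i v).
Proof.
case: (w) => f /= /asboolP[fl _].
by have := fl X i 1 u v; rewrite scale1r mul1r.
Qed.

Lemma altform_updZ X i a u : w (upd X i (a *: u)) = a * w (upd X i u).
Proof.
have z := altform_upd0r X i; move: z; case: (w) => f /= /asboolP[fl _] z.
by have := fl X i a u 0; rewrite addr0 z addr0.
Qed.

Lemma altform_upd_sum (I : Type) (s : seq I) X i (F : I -> L) :
  w (upd X i (\sum_(x <- s) F x)) = \sum_(x <- s) w (upd X i (F x)).
Proof.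
elim: s => [|x s IH]; first by rewrite !big_nil altform_upd0r.
by rewrite !big_cons altform_updD IH.
Qed.

Lemma altform_eq0 (X : {ffun 'I_k -> L}) i j : i != j -> X i = X j -> w X = 0.
Proof. by case: (w) => f /= /asboolP[_]; apply. Qed.

Lemma altform_tperm (X : {ffun 'I_k -> L}) i j : i != j ->
  w [ffun x => X (tperm i j x)] = - w X.
Proof.
move=> ij; pose Y u v := upd (upd X i u) j v.
have Yuu u : w (Y u u) = 0.
  by apply: (altform_eq0 ij); rewrite !ffunE eqxx (negbTE ij) eqxx.
have -> : [ffun x => X (tperm i j x)] = Y (X j) (X i).
  apply/ffunP => x; rewrite !ffunE; case: tpermP => [->|->|/eqP/negbTE -> /eqP/negbTE ->] //.
    by rewrite (negbTE ij) eqxx.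
  by rewrite eqxx.
have -> : w X = w (Y (X i) (X j)) by rewrite /Y !(updE, upd_comm _ _ _ ij).
apply/eqP; rewrite -addr_eq0; have := Yuu (X i + X j).
rewrite {1}/Y altform_updD !(upd_comm _ _ _ ij) !altform_updD.
rewrite -!(upd_comm _ _ _ ij) -/(Y _ _) -/(Y _ _) -/(Y _ _) -/(Y _ _) !Yuu.
by rewrite add0r addr0 addrC => ->.
Qed.

Lemma altform_perm (X : {ffun 'I_k -> L}) (s : {perm 'I_k}) :
  w [ffun x => X (s x)] = (-1) ^+ s * w X.
Proof.
have [ts -> {s} dts] := prod_tpermP s; elim: ts X dts => [|t ts IH] X /=.
  rewrite big_nil odd_perm1 mul1r => _; congr (w _).
  by apply/ffunP => x; rewrite ffunE perm1.
case/andP=> t12 dts; rewrite big_cons odd_mul_tperm t12.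
have -> : [ffun x => X ((tperm t.1 t.2 * \prod_(t0 <- ts) tperm t0.1 t0.2)%g x)] =
   [ffun x => [ffun y => X ((\prod_(t0 <- ts) tperm t0.1 t0.2)%g y)] (tperm t.1 t.2 x)].
  by apply/ffunP => x; rewrite !ffunE permM.
rewrite altform_tperm // IH // -mulNr; congr (_ * _).
by case: odd_perm; rewrite /= ?expr0 ?expr1 ?opprK.
Qed.

End Fixed.

Lemma altform_expand k (w : altform L k) :
  exists s : seq (R * {ffun 'I_k -> 'I_N}), forall X,
    w X = \sum_(p <- s) p.1 * \prod_j c (X j) 0 (p.2 j).
Proof.
elim: k w => [|k IH] w.
  pose X0 : {ffun 'I_0 -> L} := [ffun i => 0].
  exists [:: (w X0, [ffun i : 'I_0 => False_rect _ (notF (ltn_ord i))])] => X.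
  rewrite big_seq1 big_ord0 mulr1; congr (w _); apply/ffunP; by case.
pose ws i := interior_form (b i) w.
have [s sE] := choice (fun i => IH (ws i)).
exists (flatten [seq [seq (p.1, [ffun j : 'I_k.+1 => oapp (fun x : 'I_k => (p.2 : {ffun 'I_k -> 'I_N}) x) i (unlift ord0 j)]) | p <- s i]
   | i <- enum 'I_N]) => X.
rewrite big_flatten big_map big_enum /=.
pose X' : {ffun 'I_k -> L} := [ffun j => X (lift ord0 j)].
have {1}-> : X = fcons (X ord0) X'.
  apply/ffunP => j; case: (unliftP ord0 j) => [j' ->|->]; last by rewrite fcons0.
  by rewrite fconsS ffunE.
have fu u : fcons u X' = upd (fcons 0 X') ord0 u.
  apply/ffunP => j; rewrite [RHS]ffunE; case: (unliftP ord0 j) => [j' ->|->].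
    by rewrite !fconsS eq_sym (negbTE (neq_lift _ _)).
  by rewrite eqxx fcons0.
rewrite fu [X in upd _ _ X](cb (X ord0)) altform_upd_sum; apply: eq_bigr => i _.
rewrite altform_updZ -fu -[w _]/(ws i X') sE big_map mulr_sumr.
apply: eq_bigr => p _; rewrite mulrCA; congr (_ * _).
rewrite big_ord_recl /= ffunE unlift_none /=; congr (_ * _).
by apply: eq_bigr => j _; rewrite !ffunE liftK.
Qed.

(** Averaging the multilinear expansion over all permutations of the arguments turns its monomials
    into determinants; characteristic zero permits the division by k!. *)
Lemma altform_det k (w : altform L k) :
  exists s : seq (R * {ffun 'I_k -> 'I_N}), forall X,
    w X = \sum_(p <- s) p.1 * \det (colsub p.2 (cmx c X)).
Proof.
have [s sE] := altform_expand w.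
exists [seq (k`!%:R^-1 * p.1, p.2) | p <- s] => X; rewrite big_map /=.
have fk : (k`!%:R : R) != 0 by rewrite pnatr_eq0 -lt0n fact_gt0.
apply: (mulfI fk); rewrite mulr_sumr.
transitivity (\sum_(u : {perm 'I_k}) (-1) ^+ u * w [ffun x => X (u x)]).
  rewrite (eq_bigr (fun _ => w X)); first by rewrite sumr_const card_Sn mulr_natl.
  by move=> u _; rewrite altform_perm mulrA -expr2 sqrr_sign mul1r.
under eq_bigr do rewrite sE mulr_sumr.
rewrite exchange_big /=; apply: eq_bigr => p _.
rewrite !mulrA divff // mul1r -det_tr /determinant mulr_sumr; apply: eq_bigr => u _.
rewrite mulrCA; congr (_ * (_ * _)); apply: eq_bigr => j _.
by rewrite !mxE ffunE.
Qed.

(** For determinants this compares the expansions along row 0 and along row [j]; [altform_det]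
    extends it to all forms. *)
Lemma altform_fcons_upd k (w : altform L k.+1) u (X : {ffun 'I_k.+1 -> L}) j :
  w (fcons u [ffun m => X (lift j m)]) = (-1) ^+ j * w (upd X j u).
Proof.
have [s sE] := altform_det w; rewrite !sE mulr_sumr; apply: eq_bigr => p _.
rewrite mulrCA; congr (_ * _).
rewrite (expand_det_row _ ord0) (expand_det_row _ j) mulr_sumr; apply: eq_bigr => q _.
rewrite [RHS]mulrCA !mxE fcons0 ffunE eqxx; congr (_ * _).
rewrite /cofactor /= add0n exprD mulrA mulrA -expr2 sqrr_sign mul1r; congr (_ * \det _).
apply/matrixP => x y; rewrite !mxE fconsS !ffunE.
by rewrite eq_sym (negbTE (neq_lift _ _)).
Qed.

(** Only brackets with [v] survive, and moving each one back to its own slot absorbs the sign. Up to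
    sign this is the derivation action of [v], which later becomes a derivative in t. *)
Lemma ce_diff_commuting k (g : altform L k) v (Y : {ffun 'I_k -> L}) :
  (forall i j, lie (Y i) (Y j) = 0) ->
  ce_diff g (fcons v Y) = - \sum_j g (upd Y j (lie v (Y j))).
Proof.
move=> Yc; rewrite /ce_diff big_ord_recl /= [X in _ + X]big1 ?addr0; last first.
  move=> i _; apply: big1 => j /(leq_ltn_trans (leq0n _)) ij.
  case: k g Y Yc i j ij => [|k] g Y Yc i j ij; first by case: i.
  have [j' ->] : exists j', j = lift ord0 j'.
    by case: (unliftP ord0 j) ij => [j' ->|->] //; exists j'.
  rewrite (@altform_upd0 _ _ _ g _ ord0) ?mulr0 // ffunE /= !fconsS.
  exact: Yc.
rewrite big_mkcond big_ord_recl /= add0r -sumrN; apply: eq_bigr => j _.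
rewrite [bump 0 j]/bump /= add1n.
case: k g Y Yc j => [|k] g Y Yc j; first by case: j.
rewrite ce_args_fcons fcons0 fconsS.
rewrite (_ : [ffun m => _] = [ffun m => Y (lift j m)]).
  by rewrite altform_fcons_upd exprS mulN1r mulNr mulrA -expr2 sqrr_sign mul1r.
apply/ffunP => m; rewrite !ffunE /del2.
rewrite (_ : inord _ = lift ord0 (lift j m)) ?fconsS //; apply: val_inj => /=.
have e : bump (bump 0 j) (bump 0 m) = (lift j m).+1 by rewrite /= /bump /= !add1n ltnS addnS.
by rewrite e inordK // ltnS ltn_ord.
Qed.

End AltForms.

Section DetCols.
Variable S : comNzRingType.

Lemma det_col0 k (A : 'M[S]_k) j : (forall i, A i j = 0) -> \det A = 0.
Proof.
move=> A0; rewrite (expand_det_col _ j) big1 // => i _.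
by rewrite A0 mul0r.
Qed.

Lemma det_eqcol k (A : 'M[S]_k) j j' : j != j' -> (forall i, A i j = A i j') -> \det A = 0.
Proof.
move=> jj' AE; rewrite -det_tr; apply: (determinant_alternate jj') => i.
by rewrite !mxE.
Qed.

Lemma det_move_col k (A : 'M[S]_(k.+1, k.+1)) (w : 'cV[S]_k.+1) (p : 'I_k.+1) :
  (-1) ^+ p * \det (row_mx w (col' p A) : 'M_(1 + k)) = \det (setcol A p w).
Proof.
rewrite (expand_det_col _ ord0) (expand_det_col _ p) mulr_sumr; apply: eq_bigr => i _.
rewrite row_mx00 [in RHS]mxE eqxx mulrCA; congr (_ * _).
rewrite /cofactor /= addn0 exprD mulrCA mulrA; congr (_ * _ * \det _).
rewrite col'0_row_mx; apply/matrixP => a b; rewrite !mxE.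
by rewrite eq_sym (negbTE (neq_lift _ _)).
Qed.

Lemma det_move_col2 k (A : 'M[S]_(k.+2, k.+1)) (u w : 'cV[S]_k.+2) (p : 'I_k.+1) :
  (-1) ^+ p * \det (row_mx u (row_mx w (col' p A)) : 'M_(1 + (1 + k))) =
  \det (row_mx u (setcol A p w) : 'M_(1 + k.+1)).
Proof.
rewrite (expand_det_col _ ord0) [RHS](expand_det_col _ ord0) mulr_sumr; apply: eq_bigr => i _.
rewrite !row_mx00 mulrCA; congr (_ * _); rewrite /cofactor !col'0_row_mx mulrCA; congr (_ * _).
rewrite (_ : row' i (row_mx w (col' p A) : 'M_(_, 1 + k)) = row_mx (row' i w) (col' p (row' i A)) :> 'M_(1 + k)).
  rewrite det_move_col; congr (\det _); apply/matrixP => a b; rewrite !mxE.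
  by case: eqP => // _; rewrite mxE.
by rewrite -[LHS]/(row' i (row_mx w (col' p A))) row'_row_mx; congr row_mx; apply/matrixP => a b; rewrite !mxE.
Qed.

End DetCols.

Lemma deriv_det_col (R : comNzRingType) k (A : 'M[{poly R}]_k) :
  (\det A)^`() = \sum_j \det (setcol A j (col j (derivMx A))).
Proof.
rewrite -det_tr deriv_det; apply: eq_bigr => j _; rewrite -det_tr; congr (\det _).
by apply/matrixP => a b; rewrite /setrow /setcol !mxE; case: eqP.
Qed.

(** * The Lie algebra in coordinates *)

Section Model.
Variables (R : numFieldType) (n : nat) (D J : 'M[R]_n) (beta : 'cV[R]_n).
Variables (L : lieAlgType R) (c : {linear L -> 'rV[R]_(1 + (1 + n))}).

Definition crd_a l : 'rV[R]_n := rsubmx (rsubmx (c l)).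
Definition crd_x l : R := c l 0 (rshift 1 (lshift n ord0)).

Hypothesis cE : forall l l', c (lie l l') =
  row_mx (crd_a l *m J *m (crd_a l')^T + crd_x l *: (crd_a l' *m beta) - crd_x l' *: (crd_a l *m beta))
    (row_mx 0 (crd_x l *: (crd_a l' *m D) - crd_x l' *: (crd_a l *m D))).

(** Columns stand for functionals on [L]. Those of [lift_a] vanish on z and x, while [col_x] and
    [col_z] are the xi and zeta of the overview. *)
Definition lift_a (S : pzRingType) m (w : 'M[S]_(n, m)) : 'M[S]_(1 + (1 + n), m) :=
  col_mx 0 (col_mx 0 w).
Definition col_x (S : pzRingType) : 'cV[S]_(1 + (1 + n)) := col_mx 0 (col_mx 1%:M 0).
Definition col_z (S : pzRingType) : 'cV[S]_(1 + (1 + n)) := col_mx 1%:M 0.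

Lemma mul_lift_a m (l : L) (w : 'M[{poly R}]_(n, m)) :
  polyMx (c l) *m lift_a w = polyMx (crd_a l) *m w.
Proof.
rewrite -[c l in LHS]hsubmxK map_row_mx mul_row_col mulmx0 add0r.
by rewrite -[rsubmx (c l)]hsubmxK map_row_mx mul_row_col mulmx0 add0r.
Qed.

Lemma mul_col_x (l : L) : (polyMx (c l) *m col_x _) 0 0 = (crd_x l)%:P.
Proof.
rewrite -[c l in LHS]hsubmxK map_row_mx mul_row_col mulmx0 add0r.
rewrite -[rsubmx (c l)]hsubmxK map_row_mx mul_row_col mulmx0 addr0 mulmx1.
by rewrite !mxE /crd_x; congr (c l _ _)%:P; apply: val_inj.
Qed.

Section CeDet.
Variables (s q k : nat) (e : 'M[R]_(n, s)) (H : 'M[R]_(s, n)) (V nu : 'M[R]_(n, q)).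
Hypothesis JE : J = e *m H - (e *m H)^T + (V *m nu^T - nu *m V^T).
Variables (Az : 'rV[{poly R}]_k.+1) (Ax : 'rV[{poly R}]_k.+1) (Ap : 'M[{poly R}]_(n, k.+1)).

Let A : 'M_(1 + (1 + n), k.+1) := col_mx Az (col_mx Ax Ap).

Lemma mul_col_entry (S : pzSemiRingType) p m (x : 'rV[S]_p) (u : 'M[S]_(p, m)) i :
  (x *m col i u) 0 0 = (x *m u) 0 i.
Proof. by rewrite !mxE; apply: eq_bigr => j _; rewrite mxE. Qed.

Lemma formE (a b : 'rV[R]_n) : (a *m J *m b^T) 0 0 =
  \sum_(i < s) ((a *m col i e) 0 0 * (b *m (row i H)^T) 0 0 -
                (b *m col i e) 0 0 * (a *m (row i H)^T) 0 0) +
  \sum_(i < q) ((a *m col i V) 0 0 * (b *m col i nu) 0 0 -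
                (b *m col i V) 0 0 * (a *m col i nu) 0 0).
Proof.
have pair m (u v : 'M[R]_(n, m)) (x y : 'rV[R]_n) : (x *m (u *m v^T) *m y^T) 0 0 =
    \sum_(i < m) (x *m col i u) 0 0 * (y *m col i v) 0 0.
  rewrite mulmxA -mulmxA -trmx_mul mxE; apply: eq_bigr => i _.
  by rewrite !mul_col_entry [_^T i 0]mxE.
have sw (B : 'M[R]_n) : (a *m B^T *m b^T) 0 0 = (b *m B *m a^T) 0 0.
  by rewrite -[in RHS](trmxK (_ *m a^T)) [RHS]mxE !trmx_mul trmxK mulmxA.
have addE (B C : 'M[R]_n) : (a *m (B + C) *m b^T) 0 0 = (a *m B *m b^T) 0 0 + (a *m C *m b^T) 0 0.
  by rewrite mulmxDr mulmxDl mxE.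
have oppE (B : 'M[R]_n) : (a *m (- B) *m b^T) 0 0 = - (a *m B *m b^T) 0 0.
  by rewrite mulmxN mulNmx mxE.
have nuV : nu *m V^T = (V *m nu^T)^T by rewrite trmx_mul trmxK.
rewrite [J in LHS]JE nuV !addE !oppE !sw -[H]trmxK !pair !trmxK -!sumrB.
by congr (_ + _); apply: eq_bigr => i _; rewrite tr_row.
Qed.

(** With [fam2], the list of wedge products whose sum is column [p] evaluated on a bracket: the e_i
    /\ h_i, the V_i /\ nu_i, and one product with xi that gathers [beta] and the action of [D]. No
    bracket has an x component, so [Ax] does not enter. *)
Definition fam1 (p : 'I_k.+1) (x : 'I_s + 'I_q + unit) : 'cV[{poly R}]_(1 + (1 + n)) :=
  match x with
  | inl (inl i) => lift_a (polyMx (col i e))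
  | inl (inr i) => lift_a (polyMx (col i V))
  | inr _ => col_x _
  end.

Definition fam2 (p : 'I_k.+1) (x : 'I_s + 'I_q + unit) : 'cV[{poly R}]_(1 + (1 + n)) :=
  match x with
  | inl (inl i) => Az 0 p *: lift_a (polyMx (row i H)^T)
  | inl (inr i) => Az 0 p *: lift_a (polyMx (col i nu))
  | inr _ => lift_a (Az 0 p *: polyMx beta + polyMx D *m col p Ap)
  end.

Lemma lie_famE p l l' : (polyMx (c (lie l l')) *m A) 0 p =
  \sum_x ((polyMx (c l) *m fam1 p x) 0 0 * (polyMx (c l') *m fam2 p x) 0 0 -
          (polyMx (c l') *m fam1 p x) 0 0 * (polyMx (c l) *m fam2 p x) 0 0).
Proof.
have pE (u : 'rV[R]_n) (v : 'cV[R]_n) : (polyMx u *m polyMx v) 0 0 = ((u *m v) 0 0)%:P.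
  by rewrite -map_mxM mxE.
have addE m (B C : 'M[{poly R}]_(1, m)) i : (B + C) 0 i = B 0 i + C 0 i by rewrite mxE.
have scE m x (B : 'M[{poly R}]_(1, m)) i : (x *: B) 0 i = x * B 0 i by rewrite mxE.
have oppE m (B : 'M[{poly R}]_(1, m)) i : (- B) 0 i = - B 0 i by rewrite mxE.
pose fam x := (polyMx (c l) *m fam1 p x) 0 0 * (polyMx (c l') *m fam2 p x) 0 0 -
          (polyMx (c l') *m fam1 p x) 0 0 * (polyMx (c l) *m fam2 p x) 0 0.
rewrite [RHS](_ : _ = \sum_x fam x) // !big_sumType /=.
set a := crd_a l; set b := crd_a l'.
have t1 i : fam (inl (inl i)) = Az 0 p * ((a *m col i e) 0 0 * (b *m (row i H)^T) 0 0 -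
                (b *m col i e) 0 0 * (a *m (row i H)^T) 0 0)%:P.
  rewrite /fam /fam1 /fam2 -!scalemxAr !mul_lift_a !scE !pE.
  by rewrite rmorphB !rmorphM /=; ring.
have t2 i : fam (inl (inr i)) = Az 0 p * ((a *m col i V) 0 0 * (b *m col i nu) 0 0 -
                (b *m col i V) 0 0 * (a *m col i nu) 0 0)%:P.
  rewrite /fam /fam1 /fam2 -!scalemxAr !mul_lift_a !scE !pE.
  by rewrite rmorphB !rmorphM /=; ring.
rewrite (eq_bigr _ (fun i _ => t1 i)) (eq_bigr _ (fun i _ => t2 i)).
rewrite -!mulr_sumr -!rmorph_sum -mulrDr -rmorphD /= -formE.
rewrite (big_pred1 tt) /=; last by case.
rewrite /fam /fam1 /fam2 !mul_lift_a !mul_col_x -/a -/b !mulmxDr -!scalemxAr.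
rewrite cE map_row_mx mul_row_col map_row_mx mul_row_col map_mx0 mul0mx add0r.
rewrite -/a -/b; have DE (u : 'rV[R]_n) : (polyMx u *m (polyMx D *m col p Ap)) 0 0 = (polyMx (u *m D) *m Ap) 0 p.
  by rewrite mulmxA -map_mxM mul_col_entry.
rewrite !addE !scE !DE !pE.
rewrite [(polyMx _ *m Az) 0 p]mxE big_ord1 mxE.
have -> : (polyMx (crd_x l *: (b *m D) - crd_x l' *: (a *m D)) *m Ap) 0 p =
    (crd_x l)%:P * (polyMx (b *m D) *m Ap) 0 p - (crd_x l')%:P * (polyMx (a *m D) *m Ap) 0 p.
  rewrite map_mxB !map_mxZ mulmxBl -!scalemxAl.
  by rewrite addE oppE !scE.
have -> : (a *m J *m b^T + crd_x l *: (b *m beta) - crd_x l' *: (a *m beta)) 0 0 =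
   (a *m J *m b^T) 0 0 + crd_x l * (b *m beta) 0 0 - crd_x l' * (a *m beta) 0 0.
  by rewrite !mxE.
by rewrite !(rmorphD, rmorphN, rmorphM) /=; ring.
Qed.

End CeDet.
End Model.

Lemma det_mul_eqcol (S : comNzRingType) k m (M : 'M[S]_(k, m)) (B : 'M[S]_(m, k)) j j' :
  j != j' -> (forall i, B i j = B i j') -> \det (M *m B) = 0.
Proof.
move=> jj' BE; apply: (det_eqcol jj') => i.
by rewrite !mxE; apply: eq_bigr => x _; rewrite BE.
Qed.

Lemma det_mul_col0 (S : comNzRingType) k m (M : 'M[S]_(k, m)) (B : 'M[S]_(m, k)) j :
  (forall i, B i j = 0) -> \det (M *m B) = 0.
Proof.
move=> B0; apply: (@det_col0 _ _ _ j) => i.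
by rewrite mxE big1 // => x _; rewrite B0 mulr0.
Qed.

Lemma deriv_det_border (R : comNzRingType) k (u w : 'cV[{poly R}]_(1 + (1 + k)))
    (T : 'M[{poly R}]_(1 + (1 + k), k)) : derivMx u = 0 -> derivMx w = 0 ->
  (\det (row_mx u (row_mx w T)))^`() =
  \sum_j \det (row_mx u (row_mx w (setcol T j (col j (derivMx T))))).
Proof.
move=> u0 w0; rewrite deriv_det_col big_split_ord big_ord1 /= big_split_ord big_ord1 /=.
rewrite (@det_col0 _ _ _ (lshift _ ord0)) ?add0r; last first.
  move=> i; rewrite /setcol mxE eqxx !mxE.
  case: (fintype.splitP _) => // j _; rewrite ord1.
  by have /matrixP/(_ i 0) := u0; rewrite !mxE.
rewrite (@det_col0 _ _ _ (rshift 1 (lshift k ord0))) ?add0r; last first.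
  move=> i; rewrite /setcol mxE eqxx mxE map_row_mx row_mxEr map_row_mx row_mxEl w0.
  by rewrite mxE.
apply: eq_bigr => j _; congr (\det _); apply/matrixP => i x; rewrite /setcol mxE.
rewrite -[x]fintype.splitK; case: (fintype.split x) => y /=.
  by rewrite !row_mxEl eq_sym eq_rlshift.
rewrite !row_mxEr eq_rshift -[y]fintype.splitK; case: (fintype.split y) => y' /=.
  by rewrite !row_mxEl eq_sym eq_rlshift.
rewrite !row_mxEr eq_rshift [RHS]mxE; case: eqP => // _.
by rewrite [LHS]mxE [RHS]mxE map_row_mx row_mxEr map_row_mx row_mxEr.
Qed.

Lemma setcol_row_mxl (S : Type) m k (w v : 'cV[S]_m) (T : 'M[S]_(m, k)) :
  setcol (row_mx w T) (lshift k ord0) v = row_mx v T.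
Proof.
apply/matrixP => i x; rewrite /setcol mxE -[x]fintype.splitK.
case: (fintype.split x) => y /=; first by rewrite !row_mxEl ord1 eqxx.
by rewrite !row_mxEr.
Qed.

Lemma setcol_row_mxr (S : Type) m p k (w : 'M[S]_(m, p)) (v : 'cV[S]_m) (T : 'M[S]_(m, k)) j :
  setcol (row_mx w T) (rshift p j) v = row_mx w (setcol T j v).
Proof.
apply/matrixP => i x; rewrite /setcol mxE -[x]fintype.splitK.
case: (fintype.split x) => y /=; first by rewrite !row_mxEl eq_lrshift.
by rewrite !row_mxEr eq_rshift mxE.
Qed.

Lemma det_setcolN (S : comNzRingType) k (A : 'M[S]_k) j v :
  \det (setcol A j (- v)) = - \det (setcol A j v).
Proof.
rewrite (expand_det_col _ j) [in RHS](expand_det_col _ j) -sumrN; apply: eq_bigr => i _.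
rewrite [setcol A j (- v) i j]mxE [setcol A j v i j]mxE eqxx mxE mulNr; congr (- (_ * _)).
rewrite /cofactor; congr (_ * \det _); apply/matrixP => a b.
by rewrite !mxE eq_sym (negbTE (neq_lift _ _)).
Qed.

Lemma mul_col' (S : pzSemiRingType) m p k (A : 'M[S]_(m, p)) (B : 'M[S]_(p, k)) j :
  A *m col' j B = col' j (A *m B).
Proof. by apply/matrixP => x y; rewrite !mxE; apply: eq_bigr => z _; rewrite mxE. Qed.

Lemma det_swap2 (S : comNzRingType) k (a b : 'cV[S]_(1 + (1 + k))) (A : 'M[S]_(_, k)) :
  \det (row_mx a (row_mx b A)) = - \det (row_mx b (row_mx a A)).
Proof.
apply: oppr_inj; rewrite opprK -laplace2 -[RHS]opprK -(laplace2 b a A) -sumrN.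
apply: eq_bigr => i _; rewrite -sumrN; apply: eq_bigr => j _.
by move: (\det _) => d; ring.
Qed.

Lemma det_rot3 (S : comNzRingType) k (a b x : 'cV[S]_(1 + (1 + (1 + k)))) (A : 'M[S]_(_, k)) :
  \det (row_mx a (row_mx b (row_mx x A))) = \det (row_mx x (row_mx a (row_mx b A))).
Proof.
rewrite [RHS]det_swap2 (expand_det_col _ ord0) [in RHS](expand_det_col _ ord0) -sumrN.
apply: eq_bigr => i _; rewrite !row_mx00 -mulrN; congr (_ * _).
rewrite /cofactor -mulrN !col'0_row_mx; congr (_ * _).
by rewrite !row'_row_mx det_swap2.
Qed.

(** * The closed form and its correction terms *)

Section Cocycle.
Variables (R : numFieldType) (n : nat) (D J : 'M[R]_n) (beta : 'cV[R]_n).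
Variables (L : lieAlgType R) (c : {linear L -> 'rV[R]_(1 + (1 + n))}).

Hypothesis cE : forall l l', c (lie l l') =
  row_mx (crd_a c l *m J *m (crd_a c l')^T + crd_x c l *: (crd_a c l' *m beta)
          - crd_x c l' *: (crd_a c l *m beta))
    (row_mx 0 (crd_x c l *: (crd_a c l' *m D) - crd_x c l' *: (crd_a c l *m D))).

Variables (q M r k : nat) (e : 'M[R]_(n, k)) (H : 'M[R]_(k, n)) (mu nu : 'M[R]_(n, q)).
Hypothesis JE : J = e *m H - (e *m H)^T + (D ^+ r *m mu *m nu^T - nu *m (D ^+ r *m mu)^T).
Hypothesis D0 : D ^+ M = 0.
Hypothesis M0 : (0 < M)%N.
Hypothesis small : forall i (E : 'M_(1 + k, n)),
  (\det (polyMx E *m expX M (- D) *m polyMx (row_mx (col i nu) e)))`_r = 0.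

Let V := D ^+ r *m mu.
Local Notation cX X := (polyMx (cmx c X)).

Lemma ce_det_model m (A : 'M[{poly R}]_(1 + (1 + n), m.+1)) (X : {ffun 'I_m.+2 -> L}) :
  ce_det c A X = - \sum_(p < m.+1) \sum_x (-1) ^+ p *
    \det (cX X *m row_mx (fam1 e V p x)
      (row_mx (fam2 D beta H nu (usubmx A) (dsubmx (dsubmx A)) p x) (col' p A))
      : 'M_(1 + (1 + m))).
Proof.
apply: ce_detE => p l l'.
rewrite -[A in LHS]vsubmxK -[dsubmx A in LHS]vsubmxK.
exact: (lie_famE cE JE).
Qed.

Definition top_cols : 'M[{poly R}]_(1 + (1 + n), 1 + (1 + k)) :=
  block_mx 1%:M 0 0 (block_mx 1%:M 0 0 (polyMx e)).

Lemma top_colsE :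
  top_cols = row_mx (col_z n _) (row_mx (col_x n _) (lift_a (polyMx e))).
Proof.
rewrite /top_cols block_mxEh; congr row_mx.
rewrite /lift_a /col_x -[RHS]block_mxEh [RHS]block_mxEv row_mx0.
by rewrite block_mxEh.
Qed.

Lemma usub_top : usubmx top_cols = row_mx 1%:M 0.
Proof. by rewrite /top_cols block_mxEv col_mxKu. Qed.

Lemma dsub_top : dsubmx (dsubmx top_cols) = row_mx 0 (row_mx 0 (polyMx e)).
Proof.
rewrite /top_cols block_mxEv col_mxKd block_mxEv.
by rewrite -[0 in LHS]vsubmxK -block_mxEh block_mxEv col_mxKd linear0.
Qed.

Lemma lift_a_mul (S : pzRingType) m p (w : 'M[S]_(n, m)) (u : 'M_(m, p)) :
  lift_a w *m u = lift_a (w *m u).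
Proof. by rewrite /lift_a !mul_col_mx !mul0mx. Qed.

Lemma lift_aN (S : pzRingType) m (w : 'M[S]_(n, m)) : lift_a (- w) = - lift_a w.
Proof. by rewrite /lift_a !opp_col_mx !oppr0. Qed.

Lemma lift_a0 (S : pzRingType) m : lift_a 0 = 0 :> 'M[S]_(1 + (1 + n), m).
Proof. by rewrite /lift_a !col_mx0. Qed.

Lemma lift_a_row (S : pzRingType) m p (a : 'M[S]_(n, m)) (b : 'M_(n, p)) :
  lift_a (row_mx a b) = row_mx (lift_a a) (lift_a b).
Proof.
rewrite /lift_a -[RHS]block_mxEh [RHS]block_mxEv row_mx0; congr col_mx.
by rewrite -[RHS]block_mxEh [RHS]block_mxEv row_mx0.
Qed.

Lemma lift_a_col (S : pzRingType) m (w : 'M[S]_(n, m)) i a :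
  lift_a (col i w) a 0 = lift_a w a i.
Proof. by rewrite colE -lift_a_mul -colE mxE. Qed.

(** Every other term of the Leibniz sum is zero or repeats a column: e_i /\ h_i repeats e_i, while
    xi /\ beta and the differentials of the e_j repeat xi. *)
Lemma ce_det_top (X : {ffun 'I_(1 + (1 + (1 + k))) -> L}) :
  ce_det c top_cols X = - \sum_i \det (cX X *m row_mx (lift_a (polyMx (col i V)))
    (row_mx (lift_a (polyMx (col i nu))) (row_mx (col_x n _) (lift_a (polyMx e))))).
Proof.
rewrite (@ce_det_model (1 + k) top_cols X); congr (- _).
rewrite big_ord_recl big_sumType /= big_sumType /= (big_pred1 tt) //=.
have c'0 : col' ord0 top_cols = row_mx (col_x n _) (lift_a (polyMx e)).
  by rewrite top_colsE; apply: col'0_row_mx.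
have tz0 p : usubmx top_cols 0 (lift ord0 p) = 0.
  rewrite usub_top (_ : lift ord0 p = rshift 1 p); last exact: val_inj.
  by rewrite row_mxEr mxE.
have tz1 : usubmx top_cols 0 ord0 = 1.
  rewrite usub_top (_ : ord0 = lshift (1 + k) (ord0 : 'I_1)); last exact: val_inj.
  by rewrite row_mxEl mxE.
rewrite tz1 c'0 expr0 big1 ?add0r; last first.
  move=> i _; rewrite mul1r scale1r.
  apply: (@det_mul_eqcol _ _ _ _ _ (lshift _ ord0) (rshift 1 (rshift 1 (rshift 1 i)))).
    by rewrite eq_lrshift.
  by move=> a; rewrite row_mxEl !row_mxEr map_col lift_a_col.
rewrite [X in _ + X + _](_ : _ = 0) ?addr0; last first.
  rewrite mul1r.
  apply: (@det_mul_eqcol _ _ _ _ _ (lshift _ ord0) (rshift 1 (rshift 1 (lshift _ ord0)))).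
    by rewrite eq_lrshift.
  by move=> a; rewrite row_mxEl !row_mxEr row_mxEl.
rewrite [X in _ + X](_ : _ = 0) ?addr0; last first.
  apply: big1 => p _; apply: big1 => x _.
  have fam0 : (forall a, fam2 D beta H nu (usubmx top_cols) (dsubmx (dsubmx top_cols)) (lift ord0 p) x a 0 = 0) ->
      \det (cX X *m row_mx (fam1 e V (lift ord0 p) x)
        (row_mx (fam2 D beta H nu (usubmx top_cols) (dsubmx (dsubmx top_cols)) (lift ord0 p) x)
        (col' (lift ord0 p) top_cols))) = 0.
    move=> h; apply: (@det_mul_col0 _ _ _ _ _ (rshift 1 (lshift _ ord0))) => a.
    by rewrite row_mxEr row_mxEl h.
  case: x fam0 => [[x|x]|[]] fam0; try by
    rewrite fam0 ?mulr0 //= => a; rewrite tz0 scale0r mxE.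
  rewrite dsub_top /= tz0 scale0r add0r in fam0 *.
  rewrite (_ : lift ord0 p = rshift 1 p) in fam0 *; last exact: val_inj.
  move: fam0; rewrite -[p]fintype.splitK; case: (fintype.split p) => y /= fam0.
    rewrite fam0 ?mulr0 // => a.
    rewrite (_ : col _ _ = 0) ?mulmx0 ?lift_a0 ?mxE //.
    apply/matrixP => u v; rewrite [LHS]mxE [RHS]mxE.
    transitivity ((row_mx 0 (polyMx e) : 'M_(n, 1 + k)) u (lshift k y)); first exact: row_mxEr.
    by rewrite row_mxEl mxE.
  have k1 : (1 < 1 + k)%N by rewrite add1n ltnS (leq_ltn_trans _ (ltn_ord y)).
  rewrite (@det_mul_eqcol _ _ _ _ _ (lshift _ ord0) (rshift 1 (rshift 1 (Ordinal k1)))) ?mulr0 //.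
  move=> a; rewrite row_mxEl !row_mxEr [RHS]mxE.
  transitivity (top_cols a (rshift 1 (lshift k ord0))).
    by rewrite top_colsE row_mxEr row_mxEl.
  by congr (top_cols a _); apply: val_inj.
by apply: eq_bigr => i _; rewrite mul1r scale1r.
Qed.

(** The family m /\ exp(-tD)(nu_i /\ e_1 /\ ... /\ e_k), in which [m] is not moved by the flow. *)
Definition low_cols (m : 'cV[R]_n) i : 'M[{poly R}]_(1 + (1 + n), 1 + (1 + k)) :=
  row_mx (lift_a (polyMx m)) (lift_a (expX M (- D) *m polyMx (row_mx (col i nu) e))).

Definition low_det (m : 'cV[R]_n) i (X : {ffun 'I_(1 + (1 + (1 + k))) -> L}) : {poly R} :=
  \det (cX X *m row_mx (col_x n _) (low_cols m i)).

Lemma derivMx_col_x : derivMx (col_x n {poly R}) = 0.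
Proof.
rewrite -(_ : polyMx (col_x n R) = col_x n _) ?derivMxC //.
by rewrite /col_x !map_col_mx map_mx1 !map_mx0.
Qed.

Lemma derivMx_lift_a p (T : 'M[{poly R}]_(n, p)) : derivMx (lift_a T) = lift_a (derivMx T).
Proof.
have d0 m : derivMx (0 : 'M[{poly R}]_(m, p)) = 0.
  by apply/matrixP => i j; rewrite !mxE derivC.
by rewrite /lift_a !map_col_mx !d0.
Qed.

Lemma low_det_deriv m i X : (low_det m i X)^`() = - \sum_j
  \det (row_mx (cX X *m col_x n _) (setcol (cX X *m low_cols m i) (rshift 1 j)
    (cX X *m lift_a (polyMx D *m col j (expX M (- D) *m polyMx (row_mx (col i nu) e)))))).
Proof.
set T := expX M (- D) *m polyMx (row_mx (col i nu) e).
rewrite /low_det /low_cols -/T !mul_mx_row deriv_det_border; last 2 first.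
- by rewrite derivMxM derivMxC mul0mx add0r derivMx_col_x mulmx0.
- by rewrite derivMxM derivMxC mul0mx add0r derivMx_lift_a derivMxC lift_a0 mulmx0.
rewrite -sumrN; apply: eq_bigr => j _; rewrite -!setcol_row_mxr -det_setcolN.
congr (\det (setcol _ _ _)).
rewrite derivMxM derivMxC mul0mx add0r derivMx_lift_a /T derivMxM derivMxC mulmx0 addr0.
rewrite derivMx_expX; last by rewrite exprNn D0 mulr0.
rewrite map_mxN !mulNmx -mulmxA -/T lift_aN mulmxN !colE mulNmx.
by rewrite -mulmxA lift_a_mul -mulmxA.
Qed.

(** The differential is, up to sign, xi wedged with the derivation induced by [D]. On [m] it gives
    [D *m m]; on the other factors, which move along exp(-tD), it is minus the derivative in t. *)
Lemma ce_det_low m i X : ce_det c (low_cols m i) X =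
  - (low_det (D *m m) i X - (low_det m i X)^`()).
Proof.
set T := expX M (- D) *m polyMx (row_mx (col i nu) e).
have u0 : usubmx (low_cols m i) = 0.
  by rewrite /low_cols -block_mxEh block_mxEv col_mxKu row_mx0.
have d0 : dsubmx (dsubmx (low_cols m i)) = row_mx (polyMx m) T.
  by rewrite /low_cols -block_mxEh block_mxEv col_mxKd -block_mxEh block_mxEv col_mxKd.
rewrite (@ce_det_model (1 + k) (low_cols m i) X); congr (- _).
transitivity (\sum_(p < (1 + k).+1) \det (row_mx (cX X *m col_x n _)
   (setcol (cX X *m low_cols m i) p (cX X *m lift_a (polyMx D *m col p (row_mx (polyMx m) T)))))).
  apply: eq_bigr => p _; rewrite u0 d0 !big_sumType /= (big_pred1 tt) //=.
  rewrite !big1 ?add0r; first last.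
  - move=> x _; rewrite (@det_mul_col0 _ _ _ _ _ (rshift 1 (lshift _ ord0))) ?mulr0 // => a.
    by rewrite row_mxEr row_mxEl mxE mxE mul0r.
  - move=> x _; rewrite (@det_mul_col0 _ _ _ _ _ (rshift 1 (lshift _ ord0))) ?mulr0 // => a.
    by rewrite row_mxEr row_mxEl mxE mxE mul0r.
  rewrite mxE scale0r add0r !mul_mx_row -det_move_col2; congr (_ * \det (row_mx _ (row_mx _ _))).
  transitivity (col' p (cX X *m low_cols m i)); first exact: (@mul_col' _ _ _ (1 + k).+1 (cX X) (low_cols m i) p).
  by rewrite /low_cols mul_mx_row.
rewrite -[(1 + k).+1]/(1 + (1 + k))%N big_split_ord big_ord1; congr (_ + _).
  have cE0 : col (lshift (1 + k) ord0) (row_mx (polyMx m) T) = polyMx m.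
    by apply/matrixP => x y; rewrite mxE row_mxEl (ord1 y).
  rewrite /low_det /low_cols -/T !mul_mx_row map_mxM.
  by rewrite [col _ _]cE0 setcol_row_mxl.
rewrite low_det_deriv opprK; apply: eq_bigr => j _.
have cEj : col (rshift 1 j) (row_mx (polyMx m) T) = col j T.
  by apply/matrixP => x y; rewrite [LHS]mxE row_mxEr [RHS]mxE.
by rewrite [col (rshift 1 j) _]cEj.
Qed.

(** The columns xi and [m] are constant in t; expanding along both leaves scalar multiples of the
    minors in [small]. *)
Lemma coef_low_det i X (m : 'cV_n) : (low_det m i X)`_r = 0.
Proof.
rewrite /low_det /low_cols !mul_mx_row.
have -> : cX X *m lift_a (expX M (- D) *m polyMx (row_mx (col i nu) e)) =
    polyMx (\matrix_j crd_a c (X j)) *m (expX M (- D) *m polyMx (row_mx (col i nu) e)).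
  apply/row_matrixP => j; rewrite !row_mul -!map_row row_cmx rowK.
  exact: mul_lift_a.
set B := _ *m (expX _ _ *m _); apply: oppr_inj; rewrite oppr0 -coefN.
rewrite -[- _](laplace2 (cX X *m col_x n _) (cX X *m lift_a (polyMx m)) B).
rewrite coef_sum big1 // => x _; rewrite coef_sum big1 // => y _.
have cx (z : 'I_(1 + (1 + (1 + k)))) : (cX X *m col_x n _) z 0 = (crd_x c (X z))%:P.
  transitivity ((polyMx (c (X z)) *m col_x n _) 0 0); last exact: mul_col_x.
  by rewrite -row_cmx map_row -row_mul [RHS]mxE.
have cm (z : 'I_(1 + (1 + (1 + k)))) : (cX X *m lift_a (polyMx m)) z 0 = ((crd_a c (X z) *m m) 0 0)%:P.
  transitivity ((polyMx (c (X z)) *m lift_a (polyMx m)) 0 0).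
    by rewrite -row_cmx map_row -row_mul [RHS]mxE.
  by rewrite mul_lift_a -map_mxM mxE.
rewrite !cx !cm -!rmorphM -rmorphB /= -mulrA -signr_odd.
rewrite (_ : \matrix_(_, _) _ = polyMx (\matrix_(j < 1 + k) crd_a c (X (del2 id x y j)))
   *m expX M (- D) *m polyMx (row_mx (col i nu) e)).
  rewrite mulr_sign; case: odd; rewrite ?coefN coefCM small mulr0 ?oppr0 //.
by rewrite -mulmxA; apply/matrixP => a b; rewrite mxE !mxE; apply: eq_bigr => z _; rewrite !mxE.
Qed.

(* The telescoping sum below is the formal primitive of
   [(D^r mu_i) /\ nu_i /\ e]: its boundary terms are the value at [0] and a
   coefficient of index [r], which vanishes. *)
Definition primitive_form : {ffun 'I_(1 + (1 + k)) -> L} -> R :=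
  detform c top_cols 0 -
  \sum_(i < q) \sum_(l < r) detform c (low_cols (D ^+ (r - l.+1) *m col i mu) i) l *+ l`!.

Lemma primitive_form_alt : primitive_form \in is_altform L (1 + (1 + k)).
Proof.
apply: rpredB; first exact: detform_altform.
apply: rpred_sum => i _; apply: rpred_sum => l _; apply: rpredMn.
exact: detform_altform.
Qed.

Lemma primitive_form_closed : ce_diff primitive_form = 0.
Proof.
apply/funext => X; rewrite /primitive_form raddfB raddf_sum /= !fctE ce_diff_detform ce_det_top.
rewrite fct_sumE coefN coef_sum -opprD; apply/eqP; rewrite oppr_eq0 -big_split big1 //= => i _.
rewrite raddf_sum /= fct_sumE.
pose P j := low_det (D ^+ j *m col i mu) i X.
(* The coefficient of index l of the derivative is l + 1 times that of index l + 1. The weight l!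
   turns this factor into (l + 1)!, and one more [D] on [m] raises the exponent to r - l, so
   consecutive terms cancel. *)
have -> : \sum_(l < r) ce_diff (detform c (low_cols (D ^+ (r - l.+1) *m col i mu) i) l *+ l`!) X =
    \sum_(l < r) ((P (r - l.+1)%N)`_l.+1 *+ l.+1`! - (P (r - l)%N)`_l *+ l`!).
  apply: eq_bigr => l _; rewrite raddfMn /=.
  rewrite (_ : forall (f : {ffun 'I_(1 + (1 + (1 + k))) -> L} -> R) m Y, (f *+ m) Y = f Y *+ m); last first.
    by move=> f m Y; elim: m => [|m IHm]; rewrite ?mulr0n // !mulrS !fctE IHm.
  rewrite ce_diff_detform ce_det_low -/(P _) mulmxA -[D *m _]exprS subnSK // -/(P _).
  rewrite coefN coefB coef_deriv opprB mulrnBl -mulrnA factS.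
  by [].
rewrite -(big_mkord xpredT (fun l => (P (r - l.+1)%N)`_l.+1 *+ l.+1`! - (P (r - l)%N)`_l *+ l`!)).
rewrite (telescope_sumr (fun l => (P (r - l)%N)`_l *+ l`!)) // subnn subn0 coef_low_det.
rewrite mul0rn sub0r mulr1n; apply/eqP; rewrite subr_eq0; apply/eqP.
(* At t = 0 the flow is the identity; the surviving boundary term is the determinant of [ce_det_top]
   with its first three columns rotated, an even permutation. *)
rewrite -!horner_coef0 -![_.[0]]/(horner_eval 0 _) /P /low_det -!det_map_mx !map_mxM.
have hl p (B : 'M[{poly R}]_(n, p)) :
    map_mx (horner_eval 0) (lift_a B) = lift_a (map_mx (horner_eval 0) B).
  by rewrite /lift_a !map_col_mx !map_mx0.
have hx : map_mx (horner_eval 0) (col_x n {poly R}) = col_x n R.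
  by rewrite /col_x !map_col_mx map_mx1 !map_mx0.
rewrite /low_cols !map_row_mx !hl !hx.
rewrite [map_mx _ (expX _ _ *m _)]map_mxM /= expX_at0 // mul1mx map_row_mx !horner_polyMx.
rewrite (_ : col i V = D ^+ r *m col i mu); last by rewrite !colE mulmxA.
by rewrite lift_a_row !mul_mx_row det_rot3.
Qed.
End Cocycle.

Lemma central_rep_nontrivial (F : fieldType) (L : lieAlgType F) (z : centre L) k
    (w : {ffun 'I_k.+1 -> L} -> F) :
  w \in is_altform L k.+1 -> ce_diff w = 0 -> ~ exact (interior z w) ->
  exists (z : centre L) (k : nat) (c : cohomology L k.+1), central_act z c <> 0.
Proof.
move=> walt wcl wex.
have acl : AltForm walt \in is_closed L k.+1 by apply/eqP.
exists z, k, (\pi_(cohomology L k.+1)%qT (Cocycle acl)).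
by rewrite central_act_pi => /eqP; rewrite pi_eq0 => /asboolP.
Qed.

(** * Non-exactness of the contracted form *)

Section NotExact.
Variables (R : numFieldType) (n : nat) (D J : 'M[R]_n) (beta : 'cV[R]_n).
Variables (L : lieAlgType R) (c : {linear L -> 'rV[R]_(1 + (1 + n))}).
Variable bb : {linear 'rV[R]_(1 + (1 + n)) -> L}.
Hypotheses (cK : cancel c bb) (bbK : cancel bb c).

Hypothesis cE : forall l l', c (lie l l') =
  row_mx (crd_a c l *m J *m (crd_a c l')^T + crd_x c l *: (crd_a c l' *m beta)
          - crd_x c l' *: (crd_a c l *m beta))
    (row_mx 0 (crd_x c l *: (crd_a c l' *m D) - crd_x c l' *: (crd_a c l *m D))).

Definition vec_a (a : 'rV[R]_n) : L := bb (row_mx 0 (row_mx 0 a)).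
Definition vec_x : L := bb (row_mx 0 (row_mx 1%:M 0)).
Definition vec_z : L := bb (row_mx 1%:M 0).

Let bbD u v : bb u + bb v = bb (u + v). Proof. by rewrite linearD. Qed.
Let bbZ t v : t *: bb v = bb (t *: v). Proof. by rewrite linearZ. Qed.

Let cb l : l = \sum_i c l 0 i *: bb (delta_mx 0 i).
Proof.
rewrite -{1}(cK l) {1}[c l]row_sum_delta linear_sum /=; apply: eq_bigr => i _.
by rewrite linearZ.
Qed.

Lemma crd_aE t x a : crd_a c (bb (row_mx t (row_mx x a))) = a.
Proof. by rewrite /crd_a bbK !row_mxKr. Qed.

Lemma crd_xE t x a : crd_x c (bb (row_mx t (row_mx x a))) = x 0 0.
Proof. by rewrite /crd_x bbK row_mxEr row_mxEl. Qed.

Lemma vec_zE : vec_z = bb (row_mx 1%:M (row_mx 0 0)).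
Proof. by rewrite row_mx0. Qed.

Lemma lie_bbE t x a t' x' a' :
  lie (bb (row_mx t (row_mx x a))) (bb (row_mx t' (row_mx x' a'))) =
  bb (row_mx (a *m J *m a'^T + x 0 0 *: (a' *m beta) - x' 0 0 *: (a *m beta))
       (row_mx 0 (x 0 0 *: (a' *m D) - x' 0 0 *: (a *m D)))).
Proof. by apply: (can_inj cK); rewrite cE !crd_aE !crd_xE bbK. Qed.

Lemma lie_xa a : lie vec_x (vec_a a) = vec_a (a *m D) + (a *m beta) 0 0 *: vec_z.
Proof.
rewrite /vec_x /vec_a /vec_z lie_bbE !(bbZ, bbD) scale_row_mx add_row_mx.
rewrite !mul0mx !mxE !scale0r !subr0 eqxx !scale1r add0r scaler0 addr0 add0r.
by congr (bb (row_mx _ _)); apply/matrixP => i j; rewrite !ord1 !mxE mulr1.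
Qed.

Lemma lie_aa a a' : lie (vec_a a) (vec_a a') = (a *m J *m a'^T) 0 0 *: vec_z.
Proof.
rewrite /vec_a /vec_z lie_bbE bbZ scale_row_mx !mxE !scale0r !subr0 addr0.
rewrite row_mx0 scaler0; congr (bb (row_mx _ _)); apply/matrixP => i j.
by rewrite !ord1 !mxE mulr1.
Qed.

Lemma lie_az a : lie (vec_a a) vec_z = 0.
Proof.
rewrite vec_zE lie_bbE trmx0 mulmx0 !mul0mx !mxE !scale0r !subr0 addr0.
by rewrite !row_mx0 linear0.
Qed.

Lemma lie_zE l : lie vec_z l = 0.
Proof.
rewrite -(cK l) -[c l]hsubmxK -[rsubmx (c l)]hsubmxK vec_zE lie_bbE.
by rewrite !mul0mx mxE !scale0r !scaler0 !subr0 addr0 !row_mx0 linear0.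
Qed.

Lemma lie_xz : lie vec_x vec_z = 0.
Proof.
by rewrite vec_zE lie_bbE trmx0 mulmx0 !mul0mx !scaler0 !subr0 addr0 !row_mx0 linear0.
Qed.

Lemma vec_aZ t a : vec_a (t *: a) = t *: vec_a a.
Proof. by rewrite /vec_a bbZ !scale_row_mx !scaler0. Qed.

Lemma vec_aD a a' : vec_a (a + a') = vec_a a + vec_a a'.
Proof. by rewrite /vec_a bbD !add_row_mx !addr0. Qed.

Lemma vec_a_sum (I : finType) (F : I -> 'rV_n) : vec_a (\sum_i F i) = \sum_i vec_a (F i).
Proof.
apply: (big_morph vec_a vec_aD).
by rewrite /vec_a !row_mx0 linear0.
Qed.

Definition tup_a k (U : 'M[R]_(k, n)) : {ffun 'I_k -> L} := [ffun j => vec_a (row j U)].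

Lemma cmx_tup_a k (U : 'M_(k, n)) : cmx c (tup_a U) = row_mx 0 (row_mx 0 U).
Proof.
apply/row_matrixP => j; rewrite row_cmx ffunE bbK.
by rewrite !row_row_mx !row0.
Qed.

Lemma tup_a_commute k (U : 'M_(k, n)) i j : U *m J *m U^T = 0 ->
  lie (tup_a U i) (tup_a U j) = 0.
Proof.
move=> Uiso; rewrite !ffunE lie_aa.
suff -> : row i U *m J *m (row j U)^T = 0 by rewrite mxE scale0r.
by rewrite -row_mul tr_row colE mulmxA -row_mul Uiso row0 mul0mx.
Qed.

Section Basic.
Variables (k : nat) (e : 'M[R]_(n, k)).

(** This is xi /\ e_1 /\ ... /\ e_k, which vanishes as soon as an argument is z. *)
Definition basic_form (Y : {ffun 'I_(1 + k) -> L}) : R :=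
  \det (cmx c Y *m row_mx (col_x n _) (lift_a e)).

Lemma basic_form_x (U : 'M_(k, n)) : basic_form (fcons vec_x (tup_a U)) = \det (U *m e).
Proof.
rewrite /basic_form cmx_fcons cmx_tup_a bbK mul_col_row !mul_row_col.
rewrite !mul0mx !mulmx1 !add0r !mulmx0 !addr0.
by rewrite det_lblock det1 mul1r.
Qed.

Lemma basic_form_col0 (Y : {ffun 'I_(1 + k) -> L}) :
  (forall j, crd_x c (Y j) = 0) -> basic_form Y = 0.
Proof.
move=> Y0; rewrite /basic_form mul_mx_row; apply: (@det_col0 _ _ _ (lshift _ ord0)) => i.
rewrite row_mxEl -[cmx c Y]hsubmxK mul_row_col mulmx0 add0r.
rewrite -[rsubmx (cmx c Y)]hsubmxK mul_row_col mulmx0 addr0 mulmx1 !mxE.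
by have := Y0 i; rewrite /crd_x /cmx; congr (_ = 0); congr (c _ _ _); apply: val_inj.
Qed.

Lemma basic_form_row0 (Y : {ffun 'I_(1 + k) -> L}) j : Y j = vec_z -> basic_form Y = 0.
Proof.
move=> Yz; rewrite /basic_form -det_tr; apply: (@det_col0 _ _ _ j) => i; rewrite mxE.
transitivity ((c (Y j) *m row_mx (col_x n _) (lift_a e)) 0 i).
  by rewrite -row_cmx -row_mul [RHS]mxE.
by rewrite Yz vec_zE bbK mul_mx_row !mul_row_col !mulmx0 !mul0mx !addr0 row_mx0 mxE.
Qed.

(** On x followed by the rows of [S] the form equals 1. An exact form vanishes there:
    [S *m beta = 0] removes the z component of each bracket, the diagonal of [T] is zero, and
    off-diagonal entries repeat an argument. *)
Lemma basic_form_not_exact_triangular (S : 'M_(k, n)) (T : 'M_k) (g : altform L k) :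
  S *m J *m S^T = 0 -> S *m beta = 0 -> S *m D = T *m S ->
  (forall i j : 'I_k, (i <= j)%N -> T i j = 0) -> S *m e = 1%:M ->
  basic_form <> ce_diff g.
Proof.
move=> Siso Sb SD Tlow Se /(congr1 (fun f => f (fcons vec_x (tup_a S)))).
rewrite basic_form_x Se det1 (ce_diff_commuting cb) //; last first.
  by move=> i j; apply: tup_a_commute.
rewrite big1 ?oppr0 => [/eqP|j _]; first by rewrite oner_eq0.
have -> : lie vec_x (tup_a S j) = \sum_i T j i *: tup_a S i.
  rewrite ffunE lie_xa -!row_mul Sb SD row0 mxE scale0r addr0 row_mul mulmx_sum_row.
  by rewrite vec_a_sum; apply: eq_bigr => i _; rewrite vec_aZ ffunE !mxE.
rewrite altform_upd_sum big1 // => i _; rewrite altform_updZ.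
have [->|ij] := eqVneq i j; first by rewrite Tlow ?mul0r.
rewrite (@altform_eq0 _ _ _ g _ i j) ?mulr0 // !ffunE eqxx (negbTE ij).
by [].
Qed.

End Basic.

Section AltPoly.
Variables (k : nat) (g : altform L k) (s : seq (R * {ffun 'I_k -> 'I_(1 + (1 + n))})).
Hypothesis gE : forall X, g X = \sum_(p <- s) p.1 * \det (colsub p.2 (cmx c X)).

(** The expansion of [g] into determinants makes its values along a polynomial curve of tuples a
    polynomial in t, so that degrees can be compared. *)
Definition alt_poly (P : 'M[{poly R}]_(k, 1 + (1 + n))) : {poly R} :=
  \sum_(p <- s) p.1%:P * \det (colsub p.2 P).

Definition tup_at (P : 'M[{poly R}]_(k, 1 + (1 + n))) (t : R) : {ffun 'I_k -> L} :=
  [ffun j => bb (row j (map_mx (horner_eval t) P))].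

Lemma cmx_tup_at P t : cmx c (tup_at P t) = map_mx (horner_eval t) P.
Proof. by apply/row_matrixP => j; rewrite row_cmx ffunE bbK. Qed.

Lemma alt_polyE P t : (alt_poly P).[t] = g (tup_at P t).
Proof.
rewrite gE horner_sum; apply: eq_bigr => p _; rewrite hornerM hornerC cmx_tup_at.
by rewrite -[(\det _).[t]]/(horner_eval t _) -det_map_mx map_mxsub.
Qed.

Lemma deriv_alt_poly P t : (alt_poly P)^`().[t] =
  \sum_i g (upd (tup_at P t) i (bb (row i (map_mx (horner_eval t) (derivMx P))))).
Proof.
rewrite raddf_sum horner_sum.
under [RHS]eq_bigr => i _ do rewrite gE.
rewrite exchange_big; apply: eq_bigr => p _ /=.
rewrite derivM derivC mul0r add0r hornerM hornerC deriv_det horner_sum mulr_sumr.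
apply: eq_bigr => i _; congr (_ * _).
rewrite -[(\det _).[t]]/(horner_eval t _) -det_map_mx; congr (\det _).
apply/matrixP => a b; rewrite /setrow !mxE ffunE.
by case: ifP => _; rewrite ?ffunE bbK !mxE.
Qed.

End AltPoly.

Lemma row_setrow (S : Type) m p (A : 'M[S]_(m, p)) i v : row i (setrow A i v) = v.
Proof. by apply/matrixP => a b; rewrite /setrow !mxE eqxx ord1. Qed.

Lemma row_setrow_neq (S : Type) m p (A : 'M[S]_(m, p)) i j v : i != j ->
  row j (setrow A i v) = row j A.
Proof.
by move=> ij; apply/matrixP => a b; rewrite /setrow !mxE eq_sym (negbTE ij).
Qed.

Section NotExactMinor.
Variables (M k : nat) (V : 'M[R]_(k, n)) (e : 'M[R]_(n, k)).
Hypotheses (D0 : D ^+ M = 0) (M0 : (0 < M)%N).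
Hypotheses (DJ : D *m J = - (J *m D^T)) (JT : J^T = - J).
Hypothesis Viso : V *m J *m V^T = 0.
Local Notation ev t := (map_mx (horner_eval t)).
Local Notation G := (expX M D).

Let VGiso t : V *m ev t G *m J *m (V *m ev t G)^T = 0.
Proof.
have /(congr1 (ev t)) := expX_mulJ D0 M0 DJ.
rewrite !map_mxM /= -map_trmx !horner_polyMx => GJG.
by rewrite trmx_mul mulmxA -(mulmxA V) -(mulmxA V) GJG.
Qed.

Let ev_deriv t : ev t (derivMx (polyMx V *m G)) = V *m ev t G *m D.
Proof.
rewrite derivMxM derivMxC mul0mx add0r derivMx_expX // expX_comm mulmxA.
by rewrite !map_mxM /= !horner_polyMx.
Qed.

(* Both sides of [basic_form e = ce_diff g] are evaluated on
   [(x, v_1 exp(tD), .., v_k exp(tD))], where [v_1, .., v_k] are the rows of [V];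
   this gives two polynomials in [t] which are compared by degree. *)
Lemma basic_form_not_exact_minor (g : altform L k) :
  (\rank (kermx J) < size (exp_minor M D V e))%N ->
  (forall Psi, size (exp_minor M D V Psi) <= size (exp_minor M D V e))%N ->
  basic_form e <> ce_diff g.
Proof.
move=> szr szmax Eg.
have [s sE] := altform_det cb g.
pose P : 'M[{poly R}]_(k, 1 + (1 + n)) := row_mx 0 (row_mx 0 (polyMx V *m G)).
have PE t : tup_at P t = tup_a (V *m ev t G).
  apply/ffunP => j; rewrite !ffunE /P !map_row_mx !map_mx0 map_mxM /= horner_polyMx.
  by rewrite !row_row_mx !row0.
have dP t : ev t (derivMx P) = row_mx 0 (row_mx 0 (V *m ev t G *m D)).
  rewrite /P !map_row_mx /= ev_deriv; congr row_mx; last congr row_mx.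
    by apply/matrixP => i j; rewrite !mxE derivC /horner_eval hornerC.
  by apply/matrixP => i j; rewrite !mxE derivC /horner_eval hornerC.
pose Pz j := setrow P j (row_mx 1%:M 0).
have PzE j t : tup_at (Pz j) t = upd (tup_a (V *m ev t G)) j vec_z.
  rewrite -PE; apply/ffunP => i; rewrite !ffunE -map_row.
  have [->|ij] := eqVneq i j; first by rewrite row_setrow map_row_mx map_mx1 map_mx0.
  by rewrite row_setrow_neq 1?eq_sym // map_row.
(* With z in slot [j], the value of [g] does not depend on t: its derivative is, up to sign, d g on
   x and that tuple, hence a value of [basic_form] with z among the arguments. *)
pose kap : 'rV[R]_k := \row_j (alt_poly s (Pz j)).[0].
have kapE j t : g (upd (tup_a (V *m ev t G)) j vec_z) = kap 0 j.
  rewrite -PzE -(alt_polyE sE) mxE.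
  suff /deriv_eq0 -> : (alt_poly s (Pz j))^`() = 0 by rewrite !hornerC.
  apply: poly_ext_horner => {}t; rewrite (deriv_alt_poly sE) PzE horner0.
  pose X := upd (tup_a (V *m ev t G)) j vec_z.
  have Xc i i' : lie (X i) (X i') = 0.
    rewrite /X !ffunE; case: eqP => _; first by rewrite lie_zE.
    case: eqP => _; first by rewrite lie_az.
    have := tup_a_commute i i' (VGiso t).
    by rewrite !ffunE.
  have := congr1 (fun f => f (fcons vec_x X)) Eg.
  rewrite (basic_form_row0 _ (j := lift ord0 j)); last by rewrite fconsS ffunE eqxx.
  rewrite (ce_diff_commuting cb) // => /esym/eqP; rewrite oppr_eq0 => /eqP {2}<-.
  apply: eq_bigr => i _; rewrite -/X -map_row.
  have [->|ij] := eqVneq i j.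
    rewrite ffunE eqxx lie_xz; congr (g (upd _ _ _)).
    rewrite /Pz (_ : row j _ = 0) ?map_mx0 ?linear0 //.
    rewrite -map_row row_setrow -[row_mx _ _](_ : polyMx (row_mx 1%:M 0) = _) ?derivMxC //.
    by rewrite map_row_mx map_mx1 map_mx0.
  rewrite [X i]ffunE (negbTE ij) ffunE lie_xa altform_updD altform_updZ.
  rewrite [g (upd _ _ vec_z)](@altform_eq0 _ _ _ g _ i j ij); last first.
    by rewrite !ffunE !eqxx; case: eqP.
  rewrite mulr0 addr0 -map_row row_setrow_neq 1?eq_sym // map_row.
  congr (g (upd _ _ _)); rewrite /vec_a; congr (bb _).
  by rewrite map_row dP !row_row_mx !row0 row_mul.
have G0 : ev 0 G = 1%:M by apply: expX_at0.
(* Evaluation on an arbitrary vector of A and the rows of [V]: [basic_form] vanishes without an x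
   component, and every bracket is a multiple of z. *)
have kapJ : kap *m V *m J = 0.
  apply: trmx_inj; rewrite trmx0 !trmx_mul JT mulNmx; apply/row_matrixP => i.
  rewrite row0; apply/eqP; rewrite linearN oppr_eq0 /= row_mul rowE; apply/eqP.
  set w := delta_mx _ _.
  have := congr1 (fun f => f (fcons (vec_a w) (tup_a V))) Eg.
  rewrite basic_form_col0; last first.
    move=> j; case: (unliftP ord0 j) => [j' ->|->]; rewrite ?fconsS ?fcons0 ?ffunE.
      by rewrite crd_xE mxE.
    by rewrite crd_xE mxE.
  rewrite (ce_diff_commuting cb) // => [/esym/eqP|]; last first.
    by move=> a b; apply: tup_a_commute.
  rewrite oppr_eq0 => /eqP e0; apply/matrixP => a b; rewrite !ord1 [RHS]mxE.
  rewrite mulmxA; apply: etrans e0; rewrite mxE.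
  apply: eq_bigr => j _; rewrite [tup_a V j]ffunE lie_aa altform_updZ.
  have := kapE j 0; rewrite G0 mulmx1 => ->; rewrite [kap^T _ _]mxE; congr (_ * _).
  by rewrite tr_row colE mulmxA -colE [RHS]mxE.
(* The bracket of x with a row of [V] exp(tD) is its derivative in t plus its [beta] value times z.
   The first parts add up to a derivative, the second are collected by [kap]. *)
have main : exp_minor M D V e =
   - ((alt_poly s P)^`() + (polyMx (kap *m V) *m G *m polyMx beta) 0 0).
  apply: poly_ext_horner => t.
  have := congr1 (fun f => f (fcons vec_x (tup_a (V *m ev t G)))) Eg.
  rewrite basic_form_x (ce_diff_commuting cb); last first.
    by move=> a b; apply: tup_a_commute.
  have -> : \det (V *m ev t G *m e) = (exp_minor M D V e).[t].
    by rewrite -[RHS]/(horner_eval t _) -det_map_mx !map_mxM /= !horner_polyMx.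
  move=> ->; rewrite hornerN hornerD (deriv_alt_poly sE) PE; congr (- _).
  have -> : ((polyMx (kap *m V) *m G *m polyMx beta) 0 0).[t] = (kap *m (V *m ev t G *m beta)) 0 0.
    transitivity (ev t (polyMx (kap *m V) *m G *m polyMx beta) 0 0); first by rewrite [RHS]mxE.
    by rewrite !map_mxM /= !horner_polyMx !mulmxA.
  rewrite [(kap *m _) _ _]mxE -big_split; apply: eq_bigr => j _ /=.
  rewrite [X in lie _ X]ffunE lie_xa altform_updD altform_updZ kapE.
  rewrite -!row_mul [row j _ 0 0]mxE mulrC; congr (g (upd _ _ _) + _).
  by rewrite /vec_a dP !row_row_mx !row0.
(* Each determinant in the expansion selects coordinate columns of [V] exp(tD), so it is a minor
   covered by [szmax]; differentiation then makes the inequality strict. *)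
have szP : (size (alt_poly s P) <= size (exp_minor M D V e))%N.
  apply: (leq_trans (size_sum _ _ _)); apply/bigmax_leqP_seq => p _ _.
  rewrite mul_polyC; apply: (leq_trans (size_scale_leq _ _)).
  apply: leq_trans (szmax (colsub p.2 (row_mx 0 (row_mx 0 1%:M)))).
  rewrite /exp_minor map_mxsub /= mulmx_colsub; apply: eq_leq; congr (size (polyseq (\det (colsub _ _)))).
  by rewrite /P !map_row_mx !map_mx0 map_mx1 !mul_mx_row !mulmx0 mulmx1.
have sz2 : (size ((polyMx (kap *m V) *m G *m polyMx beta) ord0 ord0) <= \rank (kermx J))%N.
  by apply: size_expX_row; apply: (kermx_nil D0 DJ).
have ltF : (size (alt_poly s P)^`() < size (exp_minor M D V e))%N.
  have [->|F0] := eqVneq (alt_poly s P) 0.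
    by rewrite deriv0 size_poly0; apply: leq_ltn_trans szr.
  exact: leq_trans (lt_size_deriv F0) szP.
have : (size (exp_minor M D V e) < size (exp_minor M D V e))%N.
  rewrite {1}main size_polyN; apply: (leq_ltn_trans (size_polyD _ _)).
  by rewrite gtn_max ltF; apply: leq_ltn_trans sz2 szr.
by rewrite ltnn.
Qed.

End NotExactMinor.
Lemma centre_case (k0 : 'rV[R]_n) : k0 != 0 -> k0 *m J = 0 -> k0 *m D = 0 -> k0 *m beta = 0 ->
  J^T = - J ->
  exists (z : centre L) (k : nat) (c : cohomology L k.+1), central_act z c <> 0.
Proof.
move=> k0N kJ kD kb JT.
have kcen l : lie (vec_a k0) l = 0.
  rewrite -(cK l) -[c l]hsubmxK -[rsubmx (c l)]hsubmxK /vec_a lie_bbE.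
  by rewrite kJ kD kb mul0mx !scaler0 !mxE !scale0r !subr0 addr0 !row_mx0 linear0.
have [kap kk] : exists kap : 'cV[R]_n, k0 *m kap = 1%:M.
  have [i ki] : exists i, k0 0 i != 0.
    by have /rV0Pn[i ki] := k0N; exists i.
  exists ((k0 0 i)^-1 *: delta_mx i 0); rewrite -scalemxAr -colE.
  by apply/matrixP => a b; rewrite !ord1 !mxE mulVf.
pose A : 'M[{poly R}]_(1 + (1 + n), 1 + 1) := row_mx (lift_a (polyMx kap)) (col_x n _).
apply: (@central_rep_nontrivial _ L (Centre kcen) 1 (detform c A 0)).
- exact: detform_altform.
- apply/funext => X; rewrite ce_diff_detform.
  (* kappa has no z component, so its differential is a multiple of xi /\ (D kappa), and xi is
     closed. Both Leibniz terms therefore vanish. *)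
  pose B (p : 'I_2) (q : unit) : 'cV[{poly R}]_(1 + (1 + n)) := col_x n _.
  pose C (p : 'I_2) (q : unit) : 'cV[{poly R}]_(1 + (1 + n)) :=
    if p == ord0 then lift_a (polyMx (D *m kap)) else 0.
  have -> : ce_det c A X = 0; last by rewrite coef0.
  rewrite (@ce_detE _ _ _ c 1 unit A B C).
    rewrite big1 ?oppr0 // => p _; apply: big1 => q _.
    have [->|p0] := eqVneq p ord0.
      rewrite col'0_row_mx (@det_mul_eqcol _ _ _ _ _ (lshift _ ord0) (rshift 1 (rshift 1 ord0))) ?mulr0 // => a.
      by rewrite row_mxEl !row_mxEr.
    rewrite /C (negbTE p0) (@det_mul_col0 _ _ _ _ _ (rshift 1 (lshift _ ord0))) ?mulr0 // => a.
    by rewrite row_mxEr row_mxEl mxE.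
  move=> p l l'; rewrite (big_pred1 tt) //.
  have -> : (polyMx (c l) *m B p tt) 0 0 = (crd_x c l)%:P by apply: mul_col_x.
  have -> : (polyMx (c l') *m B p tt) 0 0 = (crd_x c l')%:P by apply: mul_col_x.
  have mulA (v : 'M[{poly R}]_(1, _)) : v *m A = row_mx (v *m lift_a (polyMx kap)) (v *m col_x n _).
    exact: mul_mx_row.
  rewrite mulA /C; have [->|p0] := eqVneq p ord0.
    have crdE : crd_a c (lie l l') =
        crd_x c l *: (crd_a c l' *m D) - crd_x c l' *: (crd_a c l *m D).
      by rewrite /crd_a cE !row_mxKr.
    rewrite row_mx00 !mul_lift_a crdE -!map_mxM mulmxBl -!scalemxAl -!mulmxA /=.
    move: (crd_a c l' *m _) (crd_a c l *m _) => u v.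
    by rewrite !mxE rmorphB !rmorphM.
  rewrite (_ : p = rshift 1 ord0); last by case: p p0 => [[|[|[]]]] // *; apply: val_inj.
  transitivity (0 : {poly R}); last by rewrite !mulmx0 !mxE !mulr0 subrr.
  transitivity ((polyMx (c (lie l l')) *m col_x n _) 0 0); first exact: row_mxEr.
  rewrite mul_col_x.
  by rewrite /crd_x cE row_mxEr row_mxEl mxE.
(* The differential of a 0-form is an empty sum, whereas the contracted form takes the value 1 on
   x. *)
case=> g /(congr1 (fun f => f [ffun _ => vec_x])).
rewrite /ce_diff big_ord1 big_pred0; last by move=> j; rewrite !ord1.
set Y := [ffun _ => _]; rewrite /interior /detform cmx_fcons.
have -> : polyMx (col_mx (c (vec_a k0)) (cmx c Y)) *m A = block_mx 1%:M 0
    (polyMx (cmx c Y) *m lift_a (polyMx kap)) (polyMx (cmx c Y) *m col_x n _) :> 'M_(1 + 1).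
  rewrite map_col_mx /A mul_col_row; congr block_mx.
    by rewrite mul_lift_a crd_aE -map_mxM kk map_mx1.
  by apply/matrixP => a b; rewrite !ord1 mul_col_x crd_xE !mxE.
rewrite det_lblock det1 mul1r det_mx11.
have -> : (polyMx (cmx c Y) *m col_x n _) 0 0 = 1 :> {poly R}.
  transitivity ((polyMx (c (Y ord0)) *m col_x n _) 0 0).
    by rewrite -row_cmx map_row -row_mul [RHS]mxE.
  by rewrite mul_col_x ffunE crd_xE mxE.
by rewrite coef1 => /eqP; rewrite oner_eq0.
Qed.

Section Primitive.
Variables (q M r k : nat) (e : 'M[R]_(n, k)) (mu nu : 'M[R]_(n, q)).

Lemma interior_primitive_form :
  interior vec_z (primitive_form D c M r e mu nu) = basic_form e.
Proof.
apply/funext => Y; rewrite /interior /primitive_form !fctE.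
have zx : polyMx (c vec_z) *m col_x n _ = 0 :> 'M[{poly R}]_1.
  by apply/matrixP => a b; rewrite !ord1 mul_col_x vec_zE crd_xE !mxE.
have za m (w : 'M[{poly R}]_(n, m)) : polyMx (c vec_z) *m lift_a w = 0.
  by rewrite mul_lift_a vec_zE crd_aE map_mx0 mul0mx.
have zz : polyMx (c vec_z) *m col_z n _ = 1%:M :> 'M[{poly R}]_1.
  rewrite /vec_z bbK map_row_mx map_mx1 mul_row_col mulmx1 map_mx0 mul0mx.
  by rewrite addr0.
have -> : detform c (top_cols e) 0 (fcons vec_z Y) = basic_form e Y.
  rewrite /detform cmx_fcons map_col_mx top_colsE mul_col_row mul_mx_row.
  rewrite zz zx za row_mx0 det_lblock det1 mul1r /basic_form.
  rewrite -horner_coef0 -[_.[0]]/(horner_eval 0 _) -det_map_mx map_mxM /=.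
  by rewrite horner_polyMx /col_x /lift_a !map_row_mx !map_col_mx !map_mx0 map_mx1 horner_polyMx.
rewrite fct_sumE big1 ?subr0 // => i _; rewrite fct_sumE big1 // => l _.
rewrite (_ : forall (f : {ffun 'I_(1 + (1 + k)) -> L} -> R) m Z, (f *+ m) Z = f Z *+ m); last first.
  by move=> f m Z; elim: m => [|m IHm]; rewrite ?mulr0n // !mulrS !fctE IHm.
rewrite /detform cmx_fcons map_col_mx /low_cols mul_col_row !za.
by rewrite det_lblock det_mx11 mxE mul0r coef0 mul0rn.
Qed.

End Primitive.

Lemma model_theorem M : D ^+ M = 0 -> (0 < M)%N -> D *m J = - (J *m D^T) -> J^T = - J ->
  exists (z : centre L) (k : nat) (c : cohomology L k.+1), central_act z c <> 0.
Proof.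
move=> D0 M0 DJ JT.
have [[k0 [k0N [kJ [kD kb]]]]|nc] := pselect (exists k0 : 'rV[R]_n,
    k0 != 0 /\ k0 *m J = 0 /\ k0 *m D = 0 /\ k0 *m beta = 0).
  exact: (centre_case k0N).
have no_centre (k0 : 'rV_n) : k0 *m J = 0 -> k0 *m D = 0 -> k0 *m beta = 0 -> k0 = 0.
  by move=> *; apply/eqP/negP => /negP k0N; apply: nc; exists k0.
pose zc := Centre lie_zE.
have fin q r k (e : 'M_(n, k)) (H : 'M_(k, n)) (mu nu : 'M_(n, q)) :
    J = e *m H - (e *m H)^T + (D ^+ r *m mu *m nu^T - nu *m (D ^+ r *m mu)^T) ->
    (forall i (E : 'M_(1 + k, n)),
      (\det (polyMx E *m expX M (- D) *m polyMx (row_mx (col i nu) e)))`_r = 0) ->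
    (forall g : altform L k, basic_form e <> ce_diff g) ->
    exists (z : centre L) (k : nat) (c : cohomology L k.+1), central_act z c <> 0.
  move=> JE small nex.
  apply: (@central_rep_nontrivial _ L zc (1 + k) (primitive_form D c M r e mu nu)).
  - exact: primitive_form_alt.
  - exact: (primitive_form_closed cE JE D0 M0 small).
  by rewrite interior_primitive_form => -[g /nex].
have [[p [U [Phi [Uiso KU sz]]]]|small] := pselect (exists p (U : 'M_(p, n)) (Phi : 'M_(n, p)),
    [/\ isotropic J U, (kermx J <= U)%MS & (\rank (kermx J) < size (exp_minor M D U Phi))%N]).
  have [k [V [e [H [Viso JE szr szmax]]]]] := exp_minor_lagrangian D0 M0 DJ JT Uiso KU sz.
  (* With [q = 0] there are no correction terms and the condition on minors is vacuous. *)
  apply: (@fin 0%N 0%N k e H 0 0).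
  - by rewrite {1}JE trmx0 mulmx0 mul0mx subrr addr0.
  - by case.
  by move=> g; apply: (basic_form_not_exact_minor D0 M0 DJ JT Viso).
have [p U Phi Uiso KU|k [S [T [e [H [q [mu [nu [Se [Siso Sb] [SD Tlow] JE sm]]]]]]]]] :=
    small_minors_split D0 M0 DJ JT no_centre.
  by rewrite leqNgt; apply/negP => h; apply: small; exists p, U, Phi.
apply: (fin _ _ _ _ _ _ _ JE sm) => g.
exact: (basic_form_not_exact_triangular Siso Sb SD Tlow Se).
Qed.

End NotExact.

(** * Coordinates adapted to the abelian ideal *)

Section Brackets.
Variables (R : fieldType) (W : lieAlgType R).

Lemma lieDl (u v w : W) : lie (u + v) w = lie u w + lie v w.
Proof. by have := lie_linearl w 1 u v; rewrite !scale1r. Qed.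

Lemma lieDr (u v w : W) : lie w (u + v) = lie w u + lie w v.
Proof. by have := lie_linearr w 1 u v; rewrite !scale1r. Qed.

Lemma lie0l (w : W) : lie 0 w = 0.
Proof. by apply: (addrI (lie 0 w)); rewrite -lieDl !addr0. Qed.

Lemma lie0r (w : W) : lie w 0 = 0.
Proof. by apply: (addrI (lie w 0)); rewrite -lieDr !addr0. Qed.

Lemma lieZl a (u w : W) : lie (a *: u) w = a *: lie u w.
Proof. by have := lie_linearl w a u 0; rewrite !addr0 lie0l addr0. Qed.

Lemma lieZr a (u w : W) : lie w (a *: u) = a *: lie w u.
Proof. by have := lie_linearr w a u 0; rewrite !addr0 lie0r addr0. Qed.

Lemma lieC (u v : W) : lie u v = - lie v u.
Proof.
apply/eqP; rewrite -addr_eq0; have := liexx (u + v).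
by rewrite lieDl !lieDr !liexx add0r addr0 => ->.
Qed.

Lemma lie_suml (I : Type) (r : seq I) (F : I -> W) w :
  lie (\sum_(i <- r) F i) w = \sum_(i <- r) lie (F i) w.
Proof. by apply: (big_morph (fun u => lie u w)) => [u v|]; rewrite ?lieDl ?lie0l. Qed.

Lemma lie_sumr (I : Type) (r : seq I) (F : I -> W) w :
  lie w (\sum_(i <- r) F i) = \sum_(i <- r) lie w (F i).
Proof. by apply: (big_morph (lie w)) => [u v|]; rewrite ?lieDr ?lie0r. Qed.

Lemma mem_lie_brv (U V : {vspace W}) u v : u \in U -> v \in V -> lie u v \in lie_brv U V.
Proof.
move=> uU vV; rewrite (coord_vbasis uU) (coord_vbasis vV) lie_suml.
apply: memv_suml => i _; rewrite lieZl memvZ // lie_sumr; apply: memv_suml => j _.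
rewrite lieZr memvZ //; apply/memv_span/allpairsP.
by exists ((vbasis U)`_i, (vbasis V)`_j); rewrite !mem_nth ?size_tuple.
Qed.

End Brackets.

Section Coordinates.
Variables (R : numFieldType) (W L : lieAlgType R) (n : nat).
Variables (iota : {linear W -> L}) (z : centre L) (Omega : cocycle W 2).
Variables (h : L -> W * R) (x : W) (b : n.-tuple W) (A : {vspace W}).
Hypothesis h1 : forall w t, h (iota w + t *: (z : L)) = (w, t).
Hypothesis h2 : forall l, iota (h l).1 + (h l).2 *: (z : L) = l.
Hypothesis LE : forall x y, lie (iota x) (iota y) =
  iota (lie x y) + Omega [ffun i => tnth [tuple x; y] i] *: (z : L).
Hypothesis bA : basis_of A b.
Hypothesis xb : basis_of fullv [tuple of x :: b].
Hypotheses (Aid : lie_ideal A) (Aab : lie_abelian A).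

Local Notation X := [tuple of x :: b].

Definition span_a (a : 'rV[R]_n) : W := \sum_i a 0 i *: b`_i.

Lemma span_a_linear : linear span_a.
Proof.
move=> t u v; rewrite /span_a scaler_sumr -big_split; apply: eq_bigr => i _ /=.
by rewrite !mxE scalerDl scalerA.
Qed.
HB.instance Definition _ := GRing.isLinear.Build R 'rV[R]_n W _ span_a span_a_linear.

Definition vec_w (v : 'rV[R]_(1 + n)) : W := v 0 ord0 *: x + span_a (rsubmx v).

Definition crd_w (w : W) : 'rV[R]_(1 + n) := \row_i coord X i w.

Lemma crd_w_linear : linear crd_w.
Proof. by move=> t u v; apply/rowP => i; rewrite !mxE linearP. Qed.
HB.instance Definition _ := GRing.isLinear.Build R W 'rV[R]_(1 + n) _ crd_w crd_w_linear.

Lemma vec_wE v : vec_w v = \sum_i v 0 i *: X`_i.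
Proof.
rewrite big_ord_recl; congr (_ + _); apply: eq_bigr => i _.
by rewrite mxE; congr (v _ _ *: _); apply: val_inj.
Qed.

Lemma vec_w_linear : linear vec_w.
Proof.
move=> t u v; rewrite !vec_wE scaler_sumr -big_split; apply: eq_bigr => i _ /=.
by rewrite !mxE scalerDl scalerA.
Qed.
HB.instance Definition _ := GRing.isLinear.Build R 'rV[R]_(1 + n) W _ vec_w vec_w_linear.

Lemma crd_wK : cancel crd_w vec_w.
Proof.
move=> w; rewrite vec_wE [RHS](coord_basis xb (memvf w)).
by apply: eq_bigr => i _; rewrite mxE.
Qed.

Lemma vec_wK : cancel vec_w crd_w.
Proof.
move=> v; rewrite vec_wE; apply/rowP => i; rewrite mxE.
by apply: (coord_sum_free (fun i => v 0 i)); apply: basis_free xb.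
Qed.

Lemma span_a_mem a : span_a a \in A.
Proof.
apply: memv_suml => i _; rewrite memvZ //.
by apply: (basis_mem bA); rewrite mem_nth // size_tuple.
Qed.

Lemma vec_w_a a : vec_w (row_mx 0 a) = span_a a.
Proof.
by rewrite /vec_w row_mxKr (_ : _ 0 ord0 = 0) ?scale0r ?add0r // row_mx00 mxE.
Qed.

Lemma crd_w_mem w : w \in A -> crd_w w = row_mx 0 (rsubmx (crd_w w)).
Proof.
move=> /(coord_basis bA) ->; set s := \sum_i _.
have -> : s = vec_w (row_mx 0 (\row_i coord b i w)).
  by rewrite vec_w_a; apply: eq_bigr => i _; rewrite mxE.
by rewrite vec_wK row_mxKr.
Qed.

Definition om (u v : W) : R := Omega (fcons u (fcons v [ffun=> 0])).

Lemma omE u v : om u v = Omega [ffun i => tnth [tuple u; v] i].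
Proof.
congr (Omega _); apply/ffunP => i; rewrite [RHS]ffunE.
case: (unliftP ord0 i) => [i' ->|->]; last by rewrite fcons0.
by rewrite fconsS (ord1 i') fcons0.
Qed.

Lemma fcons_upd0 k (u : W) (Y : {ffun 'I_k -> W}) : fcons u Y = upd (fcons 0 Y) ord0 u.
Proof.
apply/ffunP => j; rewrite [RHS]ffunE; case: (unliftP ord0 j) => [j' ->|->].
  by rewrite !fconsS eq_sym (negbTE (neq_lift _ _)).
by rewrite eqxx fcons0.
Qed.

Lemma om_scalar v : scalar (om^~ v).
Proof.
move=> t u u'; rewrite /om (fcons_upd0 (_ + _)) (fcons_upd0 u) (fcons_upd0 u').
by rewrite (altform_updD (cocycle_val Omega)) (altform_updZ (cocycle_val Omega)).
Qed.

Lemma omC u v : om u v = - om v u.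
Proof. exact: altform_swap. Qed.

Lemma omDl u v w : om (u + v) w = om u w + om v w.
Proof. by have := om_scalar w 1 u v; rewrite scale1r mul1r. Qed.

Lemma om0l w : om 0 w = 0.
Proof. by apply: (addrI (om 0 w)); rewrite -omDl !addr0. Qed.

Lemma omZl t u w : om (t *: u) w = t * om u w.
Proof. by have := om_scalar w t u 0; rewrite !addr0 om0l addr0. Qed.

Lemma omDr u v w : om w (u + v) = om w u + om w v.
Proof. by rewrite omC omDl opprD -!omC. Qed.

Lemma omZr t u w : om w (t *: u) = t * om w u.
Proof. by rewrite omC omZl -mulrN -omC. Qed.

Lemma om_ww w : om w w = 0.
Proof.
have /eqP := omC w w; rewrite -addr_eq0 -mulr2n mulrn_eq0 /= => /eqP.
by [].
Qed.

Lemma om_suml (I : Type) (r : seq I) (F : I -> W) w :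
  om (\sum_(i <- r) F i) w = \sum_(i <- r) om (F i) w.
Proof. by apply: (big_morph (om^~ w)) => [u v|]; rewrite ?omDl ?om0l. Qed.

Definition mxD : 'M[R]_n := \matrix_i rsubmx (crd_w (lie x b`_i)).
Definition mxJ : 'M[R]_n := \matrix_(i, j) om b`_i b`_j.
Definition mxbeta : 'cV[R]_n := \col_i om x b`_i.

Lemma lie_x_span a : lie x (span_a a) = span_a (a *m mxD).
Proof.
rewrite mulmx_sum_row linear_sum lie_sumr; apply: eq_bigr => i _ /=.
rewrite lieZr linearZ /= rowK -vec_w_a -crd_w_mem ?crd_wK //.
by apply/Aid; rewrite (basis_mem bA) // mem_nth // size_tuple.
Qed.

Lemma om_x_span a : om x (span_a a) = (a *m mxbeta) 0 0.
Proof.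
rewrite omC om_suml -sumrN mxE; apply: eq_bigr => i _.
by rewrite omZl -mulrN -omC mxE.
Qed.

Lemma om_span a a' : om (span_a a) (span_a a') = (a *m mxJ *m a'^T) 0 0.
Proof.
rewrite -mulmxA mxE om_suml; apply: eq_bigr => i _; rewrite omZl; congr (_ * _).
rewrite omC om_suml -sumrN mxE; apply: eq_bigr => j _.
by rewrite omZl -mulrN -omC !mxE mulrC.
Qed.

Lemma mxJT : mxJ^T = - mxJ.
Proof. by apply/matrixP => i j; rewrite !mxE omC. Qed.

Lemma lie_span a a' : lie (span_a a) (span_a a') = 0.
Proof. by apply: Aab; apply: span_a_mem. Qed.

Lemma cb_w l : l = \sum_i crd_w l 0 i *: X`_i.
Proof. by rewrite -vec_wE crd_wK. Qed.

(** This is d Omega = 0 evaluated on x and two vectors of A, whose mutual bracket is zero. *)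
Lemma mxDJ : mxD *m mxJ = - (mxJ *m mxD^T).
Proof.
have cl (a a' : 'rV_n) : om (lie x (span_a a)) (span_a a') + om (span_a a) (lie x (span_a a')) = 0.
  have dO (O : cocycle W 2) : ce_diff O = 0 by case: O => w /= /eqP.
  pose Y : {ffun 'I_2 -> W} := fcons (span_a a) (fcons (span_a a') [ffun=> 0]).
  have Ys i : exists y, Y i = span_a y.
    case: (unliftP ord0 i) => [j ->|->]; last by exists a; rewrite /Y fcons0.
    by exists a'; rewrite /Y fconsS (ord1 j) fcons0.
  have Yc i j : lie (Y i) (Y j) = 0.
    by have [[y ->] [y' ->]] := (Ys i, Ys j); apply: lie_span.
  have := congr1 (fun f => f (fcons x Y)) (dO Omega).
  rewrite (ce_diff_commuting cb_w _ _ Yc) => /eqP; rewrite oppr_eq0 => /eqP <-.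
  have up k u v (Z : {ffun 'I_k -> W}) : upd (fcons u Z) ord0 v = fcons v Z.
    by rewrite (fcons_upd0 u) upd_same -fcons_upd0.
  rewrite big_ord_recl big_ord1 {1 2}/Y fcons0 up /om; congr (_ + Omega _).
  by rewrite /Y !fconsS fcons0 -fcons_upd up.
have ent (B : 'M[R]_n) i j :
    ((delta_mx 0 i : 'rV_n) *m B *m (delta_mx 0 j : 'rV_n)^T) 0 0 = B i j.
  by rewrite trmx_delta -colE -rowE !mxE.
apply/matrixP => i j; have := cl (delta_mx 0 i) (delta_mx 0 j).
rewrite !lie_x_span !om_span trmx_mul -mulmxA mulmxA -(mulmxA _ mxD) (mulmxA _ mxD^T).
rewrite -(mulmxA _ mxJ) !ent => /eqP; rewrite addr_eq0 => /eqP ->.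
by rewrite [RHS]mxE.
Qed.

(** Each application of [mxD] is a bracket with [x] and descends one step in the lower central
    series. *)
Lemma mxD_nil M : lower_central W M = 0%VS -> mxD ^+ M = 0.
Proof.
move=> nil; have mem (a : 'rV_n) m : span_a (a *m mxD ^+ m) \in lower_central W m.
  elim: m => [|m IH]; first by rewrite memvf.
  rewrite exprSr -[_ * _]/(_ *m _) mulmxA -lie_x_span.
  by apply: mem_lie_brv; rewrite ?memvf.
apply/row_matrixP => i; rewrite row0 rowE; have := mem (delta_mx 0 i) M.
rewrite nil memv0 -vec_w_a => /eqP /(congr1 crd_w); rewrite vec_wK linear0.
by move=> /(congr1 rsubmx); rewrite row_mxKr linear0.
Qed.

Definition vec_l (v : 'rV[R]_(1 + (1 + n))) : L :=
  iota (vec_w (rsubmx v)) + v 0 ord0 *: (z : L).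

Lemma vec_l_linear : linear vec_l.
Proof.
move=> t u v.
have E : iota (vec_w (rsubmx (t *: u + v))) =
    t *: iota (vec_w (rsubmx u)) + iota (vec_w (rsubmx v)).
  by rewrite (linearP rsubmx) (linearP vec_w) (linearP iota).
rewrite /vec_l E !mxE; move: (iota _) (iota _) => p q.
by rewrite scalerDl scalerDr scalerA addrACA.
Qed.
HB.instance Definition _ := GRing.isLinear.Build R 'rV[R]_(1 + (1 + n)) L _ vec_l vec_l_linear.

Definition crd_l (l : L) : 'rV[R]_(1 + (1 + n)) := row_mx (h l).2%:M (crd_w (h l).1).

Lemma crd_lK : cancel crd_l vec_l.
Proof.
by move=> l; rewrite /vec_l /crd_l row_mxKr crd_wK row_mx00 mxE eqxx mulr1n h2.
Qed.

Lemma vec_lK : cancel vec_l crd_l.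
Proof.
move=> v; rewrite /vec_l /crd_l h1 /= vec_wK; rewrite -[RHS]hsubmxK; congr row_mx.
apply/matrixP => i j; rewrite !ord1 !mxE eqxx mulr1n; congr (v _ _); exact: val_inj.
Qed.

Lemma crd_l_linear : linear crd_l.
Proof. exact: can2_linear vec_lK crd_lK. Qed.
HB.instance Definition _ := GRing.isLinear.Build R L 'rV[R]_(1 + (1 + n)) _ crd_l crd_l_linear.

Lemma crd_l_lie l l' : crd_l (lie l l') =
  row_mx (crd_a crd_l l *m mxJ *m (crd_a crd_l l')^T
          + crd_x crd_l l *: (crd_a crd_l l' *m mxbeta)
          - crd_x crd_l l' *: (crd_a crd_l l *m mxbeta))
    (row_mx 0 (crd_x crd_l l *: (crd_a crd_l l' *m mxD)
               - crd_x crd_l l' *: (crd_a crd_l l *m mxD))).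
Proof.
have split l0 : (h l0).1 = crd_x crd_l l0 *: x + span_a (crd_a crd_l l0).
  rewrite -[LHS]crd_wK /crd_a /crd_x /crd_l row_mxKr row_mxEr /vec_w.
  by congr (crd_w _ _ _ *: _ + _); apply: val_inj.
have -> : lie l l' = iota (lie (h l).1 (h l').1) + om (h l).1 (h l').1 *: (z : L).
  rewrite -{1}(h2 l) -{1}(h2 l') lieDl !lieDr !lieZl !lieZr !centreP.
  by rewrite (lieC _ z) centreP oppr0 !scaler0 !addr0 LE omE.
rewrite /crd_l h1 /= -/crd_l !split.
move: (crd_x _ l) (crd_a _ l) (crd_x _ l') (crd_a _ l') => t a t' a'.
congr row_mx.
  rewrite omDl !omDr !omZl !omZr om_ww om_span [om (span_a _) x]omC !om_x_span.
  move: (a *m mxbeta) (a' *m mxbeta) (a *m mxJ *m a'^T) => u v w.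
  by apply/matrixP => i j; rewrite !ord1 !mxE eqxx mulr1n; ring.
rewrite lieDl !lieDr !lieZl !lieZr liexx lie_span lie_x_span [lie (span_a a) x]lieC lie_x_span.
rewrite !scaler0 add0r addr0 scalerN -!linearZ -linearB /= -vec_w_a vec_wK.
by [].
Qed.

Lemma codim1_theorem M : lower_central W M = 0%VS ->
  exists (z : centre L) (k : nat) (c : cohomology L k.+1), central_act z c <> 0.
Proof.
(* The exponent [M.+1] guarantees that the truncated exponential has at least its constant term. *)
move=> nil; have D0 : mxD ^+ M.+1 = 0 by rewrite exprS mxD_nil // mulr0.
exact: (model_theorem crd_lK vec_lK crd_l_lie D0 (ltn0Sn M) mxDJ mxJT).
Qed.

End Coordinates.

Theorem mainTheorem1 (R : realType) (W L : lieAlgType R)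
    (Wnil : lie_nilpotent W)
    (Wab : exists A : {vspace W},
        [/\ lie_ideal A, lie_abelian A & (\dim A).+1 = \dim (fullv : {vspace W})])
    (WL : central_extension W L) :
  exists (z : centre L) (k : nat) (c : cohomology L k.+1),
    central_act z c <> 0.
Proof.
case: Wab => A [Aid Aab dA]; case: WL => iota [z [Omega [[h h1 h2] LE]]].
case: Wnil => M nil.
have /subvPn[x _ xA] : ~~ (fullv <= A)%VS.
  by apply/negP => /dimvS; rewrite -dA ltnn.
have xb : basis_of fullv [tuple of x :: vbasis A].
  rewrite basisEfree free_cons (span_basis (vbasisP A)) xA (basis_free (vbasisP A)).
  by rewrite subvf /= size_tuple -dA.
apply: (codim1_theorem (fun w t => h1 (w, t)) h2 LE (vbasisP A) xb Aid Aab nil).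
Qed.
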